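(* Let $\lambda\in\mathbb{R}\setminus\{0\}$, and let $\alpha=p/q\in\mathbb{T}$, with $(p,q)=1$, be the frequency of the almost Mathieu operator $H_{\alpha,\theta}$ with potential $v(x)=2\lambda\cos(2\pi x)$. Then $$\mathrm{Cap}\big(S_+(p/q)\big)=\big(1+|\lambda|^{q}\big)^{1/q}.$$ Also, let $\{p_n/q_n\}$ be a sequence of rationals that converges to $\alpha$. Then $\alpha-p_n/q_n$ can be represented as $\widetilde p_n/\widetilde q_n$ with $(\widetilde p_n,\widetilde q_n)=1$, and therefore $$\mathrm{Cap}\big(S_+(\widetilde p_n/\widetilde q_n)\big)=\big(1+|\lambda|^{\widetilde q_n}\big)^{1/\widetilde q_n}.$$ Combining these, $$\lim_{p_n/q_n\to\alpha}\mathrm{Cap}\big(S_+(\widetilde p_n/\widetilde q_n)\big)=\begin{cases}1&\text{if }|\lambda|<1\\|\lambda|&\text{if }|\lambda|\ge1\end{cases}\ \ \ne\ \ \big(1+|\lambda|^q\big)^{1/q}=\mathrm{Cap}\big(S_+(p/q)\big).$$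
   Context: $\mathbb{T}=\mathbb{R}/\mathbb{Z}$. For $\alpha,\theta\in\mathbb{T}$, $H_{\alpha,\theta}$ acts on $\ell^2(\mathbb{Z})$ by $(H_{\alpha,\theta}\psi)_n=\psi_{n-1}+\psi_{n+1}+v(\alpha n+\theta)\psi_n$, with spectrum $\sigma(\alpha,\theta)$. For a rational $r/s$ in lowest terms ($s\ge1$), $S_+(r/s)=\bigcup_{\theta\in\mathbb{T}}\sigma(r/s,\theta)$. Logarithmic capacity: for a Borel probability measure $\mu$ with compact support in $\mathbb{C}$, $I(\mu)=\iint\log\frac1{|z-w|}\,d\mu(w)\,d\mu(z)$, and $\mathrm{Cap}(E)=\sup\exp(-I(\mu))$ over Borel probability measures $\mu$ compactly supported in $E$.
   Formalization: The limit claim is stated for sequences p_n/q_n that differ from α in T for all large n; if p_n/q_n = α infinitely often, those terms give 0/1 with capacity 1+|λ|, and the stated limit fails. *)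

(* Defs.v *)
From HB Require Import structures.
From mathcomp Require Import all_boot all_order all_algebra.
From mathcomp Require Import all_classical all_reals all_analysis.
From mathcomp Require Import complex.

Set Implicit Arguments.
Unset Strict Implicit.
Unset Printing Implicit Defensive.

Import Order.TTheory GRing.Theory Num.Theory.
Import numFieldNormedType.Exports.

Local Open Scope classical_set_scope.
Local Open Scope ring_scope.

(* Points of the circle R/Z are given by real representatives. *)
Definition circle_eq (R : realType) (x y : R) : Prop :=
  exists m : int, x - y = m%:~R.

(* [circle_norm (x - y)] is the quotient metric on R/Z. *)
Definition circle_norm (R : realType) (x : R) : R :=
  inf [set `|x - m%:~R| | m in [set: int]].

Definition l2norm (R : realType) (psi : int -> R[i]) : \bar R :=
  sqrte (\esum_(n in [set: int]) ((Normc.normc (psi n)) ^+ 2)%:E).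

Definition l2 (R : realType) : set (int -> R[i]) :=
  [set psi | (l2norm psi < +oo)%E].

(* Operators are maps on all sequences; only their values on [l2] matter. *)
Definition bounded_l2_operator (R : realType)
    (B : (int -> R[i]) -> (int -> R[i])) : Prop :=
  [/\ forall psi, l2 psi -> l2 (B psi),
      forall (a : R[i]) psi phi, l2 psi -> l2 phi ->
        B (fun n => a * psi n + phi n) = (fun n => a * B psi n + B phi n)
    & exists M : R, forall psi, l2 psi ->
        (l2norm (B psi) <= M%:E * l2norm psi)%E].

Definition resolvent_set (R : realType)
    (T : (int -> R[i]) -> (int -> R[i])) : set R[i] :=
  [set z | exists B, bounded_l2_operator B /\
     forall psi, l2 psi ->
       B (fun n => T psi n - z * psi n) = psi /\
       (fun n => T (B psi) n - z * B psi n) = psi].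

Definition spectrum (R : realType)
    (T : (int -> R[i]) -> (int -> R[i])) : set R[i] :=
  ~` resolvent_set T.

Definition schrodinger (R : realType) (v : R -> R) (alpha theta : R)
    (psi : int -> R[i]) : int -> R[i] :=
  fun n => psi (n - 1) + psi (n + 1)
           + (v (alpha * n%:~R + theta))%:C%C * psi n.

Definition almost_mathieu_potential (R : realType) (lambda : R) : R -> R :=
  fun x => 2 * lambda * cos (2 * pi * x).

(* For a 1-periodic [v], the union over real phases is the union over R/Z, and
   the result depends only on the class of [alpha] in R/Z. *)
Definition S_plus (R : realType) (v : R -> R) (alpha : R) : set R[i] :=
  \bigcup_(theta in [set: R]) spectrum (schrodinger v alpha theta).

(* [R[i]^o] carries the topology of the complex modulus. *)
Notation borelC R := (g_sigma_algebraType (@open (R[i]^o))).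

Definition measure_support (R : realType) (mu : set (borelC R) -> \bar R) :
    set (R[i]^o) :=
  [set z | forall U : set (R[i]^o), open U -> U z -> (0 < mu U)%E].

(* In [\bar R], 0^-1 = +oo and lne +oo = +oo, so that the kernel is +oo on the
   diagonal. *)
Definition log_kernel (R : realType) (z w : R[i]) : \bar R :=
  lne ((Normc.normc (z - w))%:E^-1)%E.

Definition log_energy (R : realType) (mu : probability (borelC R) R) : \bar R :=
  (\int[mu]_z \int[mu]_w log_kernel z w)%E.

Definition Cap (R : realType) (E : set R[i]) : \bar R :=
  ereal_sup [set expeR (- log_energy mu)%E | mu in
    [set mu : probability (borelC R) R |
      compact (measure_support mu) /\ measure_support mu `<=` E]].

(* Main.v *)
Require Import Defs.
From HB Require Import structures.
From mathcomp Require Import all_boot all_order all_algebra all_fingroup.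
From mathcomp Require Import all_classical all_reals all_analysis.
From mathcomp Require Import measurable_realfun.
From mathcomp Require Import complex ring lra zify.

Set Implicit Arguments.
Unset Strict Implicit.
Unset Printing Implicit Defensive.

Import Order.TTheory GRing.Theory Num.Theory.
Import numFieldNormedType.Exports.

Local Open Scope classical_set_scope.
Local Open Scope ring_scope.

(** The proof goes through a real monic polynomial [D] of degree [q] such that
    [S_+(p/q)] is the set of the [z] for which [D(z)] is real and [|D(z)| <= 2 c],
    where [c = 1 + |lambda|^q]; the capacity of such a set is [c^(1/q)].

    The polynomial.  The discriminant [Delta_theta], the trace of the product of
    the transfer matrices over one period, is monic of degree [q] in the energy.
    Chambers' formula ([chambers_alg], [discr_chambers]) says that only its
    constant term depends on [theta]:
    [Delta_theta(z) = D(z) + kappa cos(2 pi q theta)] with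
    [|kappa| = 2 |lambda|^q].  It holds because, after multiplication by [w^q]
    with [w = e^(2 pi i theta)], the trace is a polynomial of degree at most [2 q]
    in [w] which is invariant under the rotation [w -> e^(2 pi i p/q) w].

    The spectrum.  A point [z] lies in the spectrum of [H_theta] iff
    [Delta_theta(z)] is real and [|Delta_theta(z)| <= 2]; the union of the spectra
    over [theta] is then the set above ([S_plus_preimage]).  If [z] is not such a
    point, [Delta_theta(z) = rho + 1/rho] with [0 < |rho| < 1]; as
    [Delta_theta(H) = S^q + S^-q] for the shift [S] ([discr_act]), the operator
    [Delta_theta(H) - Delta_theta(z)] is inverted by Neumann series, and it is a
    multiple of [H - z] ([resolvent_out]).  If [z] is such a point,
    [Delta_theta(z) = rho + 1/rho] with [|rho| = 1], so that [H psi = z psi] has a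
    bounded solution, whose cut-offs are approximate eigenvectors
    ([bloch_spectrum]); a Wronskian argument shows that [z] is real
    ([bloch_real]).

    Upper bound for the capacity ([log_energy_lower]).  Averaging over [n] points
    chosen independently according to a measure bounds its energy from below by
    the least sum of the kernel over the pairs of [n] points of the set
    ([averaging]).  The product of the mutual distances is the modulus of a
    Vandermonde determinant, in which the powers may be replaced by any monic
    polynomials ([det_monic_polys]); the products of [z^r], [r < q], with the
    Chebyshev polynomials of the interval [|x| <= 2 c], scaled to be monic and
    composed with [D], are bounded on the set by constants times powers of [c].

    Lower bound for the capacity ([preimage_energy_approx]).  A measure may be
    pulled back along a monic polynomial of degree [q] by averaging over the [q]
    branches of its inverse, and the energy is then divided by [q]
    ([energy_transfer]).  The uniform measure on the unit interval has finite
    energy, and pulling it back repeatedly along [x^2/c - 2 c], whose scaled form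
    [x^2 - 2 c^2] is monic and which maps the interval [|x| <= 2 c] two to one
    onto itself, makes the energy tend to [- ln c] ([clamp_energy_iter]).  One
    further pull-back, along [D], gives measures on the set with energies tending
    to [- (ln c) / q].

    The limit.  If [x] is not an integer and is congruent to a fraction with
    denominator [m] modulo the integers, its distance to the integers is at least
    [1/m] ([circle_norm_ge]); hence the denominators of [alpha - p_n/q_n] tend to
    infinity.  As [(1 + t^m)^(1/m)] is greater than [max(1, t)] and at most
    [2^(1/m) max(1, t)], its limit is [max(1, t)], which differs from each term
    ([lim_cap_lt], [cap_le_lim]). *)

(** * Transfer matrices and Chambers' formula *)

Section Transfer.
Variable R : comNzRingType.
Implicit Types (x : nat -> R) (y : R).

Let lift01 : lift ord0 ord0 = 1 :> 'I_2. Proof. exact/val_inj. Qed.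

(** Factor of a transfer matrix, with first row [(a, -y)] and second row [(y, 0)];
    the usual transfer matrix is the case [y = 1], and [y] keeps track of a common
    factor. *)
Definition step_mx (a y : R) : 'M[R]_2 :=
  \matrix_(i < 2, j < 2)
    if i == 0 then (if j == 0 then a else - y) else (if j == 0 then y else 0).

(** Product of the factors of indices [k - 1, ..., 0], in this order. *)
Fixpoint transfer x y k : 'M[R]_2 :=
  if k is k'.+1 then step_mx (x k') y *m transfer x y k' else 1%:M.

Lemma transfer0E x y k j :
  transfer x y k.+1 0 j = x k * transfer x y k 0 j - y * transfer x y k 1 j.
Proof. by rewrite /= !mxE big_ord_recl big_ord1 !mxE lift01 /= mulNr. Qed.

Lemma transfer1E x y k j : transfer x y k.+1 1 j = y * transfer x y k 0 j.
Proof. by rewrite /= !mxE big_ord_recl big_ord1 !mxE /= mul0r addr0. Qed.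

Lemma mxtrace2 (M : 'M[R]_2) : \tr M = M 0 0 + M 1 1.
Proof.
by rewrite /mxtrace big_ord_recl big_ord1 lift01.
Qed.

Lemma det2 (M : 'M[R]_2) : \det M = M 0 0 * M 1 1 - M 0 1 * M 1 0.
Proof.
have -> : M = \matrix_(i < 2, j < 2) M i j by apply/matrixP => i j; rewrite mxE.
rewrite (expand_det_row _ 0) big_ord_recl big_ord1 /cofactor !det_mx11 !mxE /=.
have e1 : lift 0 0 = 1 :> 'I_2 by apply/val_inj.
have e2 : lift 1 0 = 0 :> 'I_2 by apply/val_inj.
by rewrite !e1 e2 /= addn0 expr0 mul1r expr1 mulN1r mulrN.
Qed.

Lemma eq_transfer x x' y k :
  (forall i, (i < k)%N -> x i = x' i) -> transfer x y k = transfer x' y k.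
Proof.
elim: k => //= k IH h; rewrite h ?ltnSn // IH // => i ik.
by apply: h; apply: ltnW.
Qed.

Lemma transfer_det x k : \det (transfer x 1 k) = 1.
Proof.
elim: k => [|k IH] /=; first by rewrite det1.
by rewrite det_mulmx IH mulr1 det2 !mxE /= mulr0 sub0r mulN1r opprK.
Qed.

Lemma transferSr x y k :
  transfer x y k.+1 = transfer (fun i => x i.+1) y k *m step_mx (x 0) y.
Proof.
elim: k => [|k IH]; first by rewrite /= mul1mx mulmx1.
by rewrite [LHS]/= -/(transfer x y k.+1) IH mulmxA.
Qed.

(** Moving the base point by one step conjugates the matrix of a period. *)
Lemma transfer_tr_shift x y q : x q = x 0 ->
  \tr (transfer (fun i => x i.+1) y q) = \tr (transfer x y q).
Proof.
case: q => [|q] xq //.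
by rewrite [in RHS]transferSr [in LHS]/= xq mxtrace_mulC.
Qed.

Lemma transfer_scale x y w k :
  transfer (fun i => w * x i) (w * y) k = w ^+ k *: transfer x y k.
Proof.
elim: k => [|k IH] /=; first by rewrite expr0 scale1r.
have -> : step_mx (w * x k) (w * y) = w *: step_mx (x k) y.
  by apply/matrixP => i j; rewrite !mxE; do 2?case: eqP => _; rewrite ?mulrN ?mulr0.
by rewrite IH -scalemxAl -scalemxAr scalerA exprS.
Qed.

(** The transfer matrices propagate the solutions of
    [u (k+2) = x k * u (k+1) - u k]. *)
Lemma transfer_sol x (u : nat -> R) :
  (forall k, u k.+2 = x k * u k.+1 - u k) ->
  forall k, (u k.+1 = transfer x 1 k 0 0 * u 1%N + transfer x 1 k 0 1 * u 0%N) /\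
            (u k = transfer x 1 k 1 0 * u 1%N + transfer x 1 k 1 1 * u 0%N).
Proof.
move=> hu; elim=> [|k [IH1 IH2]].
  by rewrite /= !mxE /= !mul1r !mul0r add0r addr0.
rewrite !transfer0E !transfer1E hu IH1 IH2; split; ring.
Qed.

Lemma cayley_hamilton2 (M : 'M[R]_2) i j :
  \det M = 1 -> (M *m M) i j = \tr M * M i j - (i == j)%:R.
Proof.
rewrite mxtrace2 det2 => hd.
rewrite mxE big_ord_recl big_ord1.
rewrite lift01.
have [-> | ->] : i = 0 \/ i = 1 :> 'I_2
  by case: i => [[|[|]]] // ?; [left|right]; apply/val_inj.
all: have [-> | ->] : j = 0 \/ j = 1 :> 'I_2
  by case: j => [[|[|]]] // ?; [left|right]; apply/val_inj.
all: rewrite -?hd /=; ring.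
Qed.

End Transfer.

Lemma map_transfer (R S : comNzRingType) (f : {rmorphism R -> S})
    (x : nat -> R) (y : R) k :
  map_mx f (transfer x y k) = transfer (fun i => f (x i)) (f y) k.
Proof.
elim: k => [|k IH] /=; first by rewrite map_mx1.
rewrite map_mxM IH; congr (_ *m _); apply/matrixP => i j; rewrite !mxE.
by do 2?case: eqP => _; rewrite ?rmorphN ?rmorph0.
Qed.

Lemma map_tr_transfer (R S : comNzRingType) (f : {rmorphism R -> S})
    (x : nat -> R) (y : R) k :
  f (\tr (transfer x y k)) = \tr (transfer (fun i => f (x i)) (f y) k).
Proof. by rewrite -trace_map_mx map_transfer. Qed.

Section Discriminant.
Variable R : idomainType.

(** Degrees, in the energy ['X], of the entries of a transfer matrix. *)
Lemma transfer_monic_size (V : nat -> R) k :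
  let M := transfer (fun n => 'X - (V n)%:P) 1 k in
  [/\ size (M 0 0) = k.+1, M 0 0 \is monic, (size (M 0%R 1%R) <= k)%N,
      (size (M 1%R 0%R) <= k)%N & (0 < k)%N -> (size (M 1%R 1%R) <= k)%N].
Proof.
elim: k => [|k [s00 m00 s01 s10 s11]].
  by rewrite /= !mxE /= size_poly1 monic1 size_poly0.
rewrite /= in s00 m00 s01 s10 s11 *.
have szM : size (('X - (V k)%:P) * transfer (fun n => 'X - (V n)%:P) 1 k 0 0) = k.+2.
  by rewrite size_monicM ?monicXsubC -?size_poly_gt0 ?s00 // size_XsubC addSn /= add1n.
have lt1 : (size (- transfer (fun n => 'X - (V n)%:P) 1 k 1 0)%R < k.+2)%N.
  by rewrite size_polyN; apply: leq_ltn_trans s10 _; lia.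
have s11' : (size (transfer (fun n => 'X - (V n)%:P)%R 1%R k 1%R 1%R) <= k.+1)%N.
  case: (posnP k) => [->|/s11/leq_trans]; last by apply; lia.
  by rewrite /= mxE /= size_poly1.
rewrite -/(transfer (fun n => 'X - (V n)%:P) 1 k.+1).
rewrite !transfer0E !transfer1E !mul1r; split.
- by rewrite size_polyDl ?szM.
- rewrite monicE lead_coefDl ?szM // lead_coefM lead_coefXsubC mul1r.
  by rewrite -monicE.
- apply: leq_trans (size_polyD _ _) _; rewrite geq_max size_polyN s11' andbT.
  apply: leq_trans (size_polyMleq _ _) _; rewrite size_XsubC addSn /= add1n.
  by rewrite ltnS.
- by rewrite s00.
- by move=> _; apply: leq_trans s01 _.
Qed.

Lemma discriminant_monic (V : nat -> R) q : (0 < q)%N ->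
  let D := \tr (transfer (fun n => 'X - (V n)%:P) 1 q) in
  size D = q.+1 /\ D \is monic.
Proof.
move=> q0 D; have [s00 m00 _ _ /(_ q0) s11] := transfer_monic_size V q.
have lt1 : (size (transfer (fun n => 'X - (V n)%:P) 1 q 1 1)%R <
            size (transfer (fun n => 'X - (V n)%:P) 1 q 0 0)%R)%N by rewrite s00 ltnS.
rewrite /D mxtrace2 size_polyDl //; split=> //.
by rewrite monicE lead_coefDl // -monicE.
Qed.
End Discriminant.

Section Chambers.
Variable F : fieldType.
Variables (z lam zeta : F) (q : nat).
Hypothesis prim : q.-primitive_root zeta.

(** The entry [w * (z - lam * (w * zeta^n + (w * zeta^n)^-1))], as a polynomial in
    the variable [w]. *)
Let b (n : nat) : {poly F} :=
  z *: 'X - (lam * zeta ^+ n) *: 'X^2 - (lam * zeta ^- n)%:P.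

Lemma coef_scaled_step n i : (b n)`_i =
  z * (i == 1%N)%:R - lam * zeta ^+ n * (i == 2)%:R - (lam * zeta ^- n) * (i == 0)%:R.
Proof.
by rewrite /b !coefE; case: i => [|[|[|i]]] //=;
   rewrite ?(mulr1,mulr0,subr0,sub0r,oppr0).
Qed.

(** The transfer matrices multiplied by powers of [w], as polynomials in [w]. *)
Let T := transfer b 'X.

(** The entries of [T k] have degree at most [2 * k], and only the upper left one
    attains it. *)
Lemma scaled_transfer_coef k :
  [/\ forall i j m, (2 * k < m)%N -> (T k i j)`_m = 0,
      forall m, (2 * k <= m)%N -> (T k 0 1)`_m = 0,
      (0 < k)%N -> (T k 1 1)`_(2 * k) = 0 &
      (T k 0 0)`_(2 * k) = \prod_(n < k) (- (lam * zeta ^+ n))].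
Proof.
elim: k => [|k [h1 h2 h3 h4]].
  rewrite /T big_ord0 /=; split=> //.
  - by move=> i j [|m] // _; rewrite mxE coefMn coef1 mul0rn.
  - by move=> m _; rewrite mxE coef0.
  - by rewrite mxE coef1.
have I2 (i : 'I_2) : i = 0 \/ i = 1 :> 'I_2.
  by case: i => [[|[|]]] // ?; [left|right]; apply/val_inj.
have bM (p : {poly F}) m : (b k * p)`_m.+2 = z * p`_m.+1 -
    lam * zeta ^+ k * p`_m - (lam * zeta ^- k) * p`_m.+2.
  rewrite /b !mulrBl !coefB -!scalerAl !coefZ mul_polyC coefZ.
  by rewrite ['X * p]mulrC ['X^2 * p]mulrC coefMX coefMXn /= subn2.
have XM (p : {poly F}) m : ('X * p)`_m.+1 = p`_m by rewrite mulrC coefMX.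
split.
- move=> i j [|[|m]]; try lia; move=> hm.
  have [-> | ->] := I2 i; rewrite /T ?transfer0E ?transfer1E -/(T k).
    by rewrite coefB bM XM !h1 ?mulr0 ?subrr ?subr0 //; lia.
  by rewrite XM h1 //; lia.
- move=> [|[|m]]; try lia; move=> hm.
  by rewrite /T transfer0E -/(T k) coefB bM XM !h2 ?h1 ?mulr0 ?subrr ?subr0 //; lia.
- move=> _; rewrite /T transfer1E -/(T k) (_ : (2 * k.+1 = (2 * k).+2)%N); last lia.
  by rewrite XM h2.
- rewrite /T transfer0E -/(T k) (_ : (2 * k.+1 = (2 * k).+2)%N); last lia.
  rewrite coefB bM XM h4 !h1 ?mulr0 ?subr0 ?sub0r; try lia.
  by rewrite big_ord_recr /= mulrC mulrN.
Qed.

(** The trace over one period, multiplied by [w^q], as a polynomial in [w]. *)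
Let G := \tr (T q).

Lemma scaled_trace_coef_high m : (2 * q < m)%N -> G`_m = 0.
Proof.
move=> hm; rewrite /G mxtrace2 coefD.
by have [h _ _ _] := scaled_transfer_coef q; rewrite !h ?addr0.
Qed.

Lemma scaled_trace_coef_2q : G`_(2 * q) = \prod_(n < q) (- (lam * zeta ^+ n)).
Proof.
have q0 := prim_order_gt0 prim.
by rewrite /G mxtrace2 coefD; have [_ _ -> // ->] := scaled_transfer_coef q; rewrite addr0.
Qed.

Lemma scaled_trace_coef_0 : G`_0 = \prod_(n < q) (- (lam * zeta ^- n)).
Proof.
have q0 := prim_order_gt0 prim.
have ev k i j : (T k i j).[0] = transfer (fun n => (b n).[0]) 0 k i j.
  have := map_transfer (horner_eval 0) b 'X k.
  rewrite /= [horner_eval _ 'X]hornerX => /matrixP/(_ i j).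
  by rewrite mxE.
rewrite -horner_coef0 /G mxtrace2 hornerD !ev.
have b0 n : (b n).[0] = - (lam * zeta ^- n).
  by rewrite horner_coef0 coef_scaled_step /= !mulr0 subr0 sub0r mulr1.
have -> : transfer (fun n => (b n).[0]) 0 q 1 1 = 0.
  by case: q q0 => // k _; rewrite transfer1E mul0r.
rewrite addr0; elim: q => [|k IH]; first by rewrite /= mxE big_ord0.
by rewrite transfer0E mul0r subr0 IH b0 big_ord_recr /= mulrC.
Qed.

Let zeta0 : zeta != 0.
Proof.
apply/eqP => z0; have := prim_expr_order prim.
have /negPf q0 : (q != 0)%N by rewrite -lt0n (prim_order_gt0 prim).
by rewrite z0 expr0n q0 => /eqP; rewrite eq_sym oner_eq0.
Qed.

(** Replacing [w] by [zeta * w] moves the base point by one step, up to factors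
    whose product is [zeta^q = 1]. *)
Lemma scaled_trace_rotate : G \Po (zeta *: 'X) = G.
Proof.
rewrite /G mxtrace2 !comp_polyD.
have ev i j : T q i j \Po (zeta *: 'X) = transfer (fun n => b n.+1) 'X q i j.
  have -> : T q i j \Po (zeta *: 'X) =
      map_mx (comp_poly (zeta *: 'X)) (T q) i j by rewrite mxE.
  rewrite /T map_transfer /= comp_polyX.
  have -> : zeta *: 'X = zeta%:P * 'X :> {poly F} by rewrite mul_polyC.
  rewrite (@eq_transfer _ _ (fun i => zeta%:P * b i.+1)) ?transfer_scale.
    by rewrite -rmorphXn /= (prim_expr_order prim) scale1r.
  move=> n _; rewrite /b !(comp_polyB, comp_polyZ, comp_polyC, comp_Xn_poly, comp_polyX).
  rewrite !mul_polyC !scalerBr exprZn !scalerA.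
  have -> : (lam * zeta ^- n)%:P = zeta *: (lam * zeta ^- n.+1)%:P.
    by rewrite -mul_polyC -polyCM exprS; congr _%:P; field; rewrite expf_neq0 ?zeta0.
  congr (_ *: _ - _ *: _ - _); first by rewrite mulrC.
  by rewrite [zeta ^+ n.+1]exprS; ring.
rewrite !ev -!mxtrace2; apply: transfer_tr_shift.
by rewrite /b (prim_expr_order prim) expr0.
Qed.

(** Hence only powers of [w^q] occur. *)
Lemma scaled_trace_coef_ndvd m : ~~ (q %| m)%N -> G`_m = 0.
Proof.
move=> ndv; have := congr1 (fun p : {poly F} => p`_m) scaled_trace_rotate.
have -> : (G \Po (zeta *: 'X))`_m = zeta ^+ m * G`_m.
  rewrite comp_polyE coef_sum.
  case: (ltnP m (size G)) => hm.
    rewrite (bigD1 (Ordinal hm)) //= exprZn !coefZ coefXn eqxx mulr1.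
    rewrite big1 ?addr0 1?mulrC // => i ne.
    rewrite exprZn !coefZ coefXn (_ : (m == i) = false) ?mulr0 //.
    by apply/negbTE; apply: contra ne => /eqP e; apply/eqP/val_inj.
  rewrite [G`_m]nth_default // mulr0 big1 // => i _.
  rewrite exprZn !coefZ coefXn (_ : (m == i) = false) ?mulr0 //.
  by apply/negbTE; apply: contraTneq (ltn_ord i) => <-; rewrite -leqNgt.
move/eqP; rewrite -[X in _ == X]mul1r -subr_eq0 -mulrBl mulf_eq0 subr_eq0.
by rewrite -(prim_order_dvd prim) (negbTE ndv) /= => /eqP.
Qed.

Lemma scaled_trace_horner (w : F) :
  G.[w] = G`_0 + G`_q * w ^+ q + G`_(2 * q) * w ^+ (2 * q).
Proof.
have q0 := prim_order_gt0 prim.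
have sz : (size G <= (2 * q).+1)%N.
  by apply/leq_sizeP => j hj; apply: scaled_trace_coef_high.
rewrite (horner_coef_wide _ sz).
have oq : (q < (2 * q).+1)%N by lia.
rewrite (bigD1 ord0) //= (bigD1 (Ordinal oq)) //=; last by rewrite -val_eqE /= -lt0n.
rewrite (bigD1 ord_max) /=; last by rewrite -!val_eqE /=; lia.
rewrite big1 ?addr0 ?expr0 ?mulr1 ?addrA // => i.
rewrite -!val_eqE /= => /andP[/andP[i0 iq] i2q].
rewrite scaled_trace_coef_ndvd ?mul0r //; apply/negP => /dvdnP[k ek].
have := ltn_ord i; rewrite ek in i0 iq i2q *.
case: k ek i0 iq i2q => [|[|[|k]]] ek i0 iq i2q; lia.
Qed.

(** The product is [zeta^(q (q - 1) / 2)], a sign. *)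
Lemma prim_prod_sq : (\prod_(n < q) zeta ^+ n) ^+ 2 = 1.
Proof.
rewrite prodrXr -exprM; apply/eqP; rewrite -(prim_order_dvd prim).
rewrite (_ : (\sum_(i < q) i = \sum_(0 <= i < q) i)%N); last by rewrite big_mkord.
by rewrite bin2_sum mulnC mul2n; have := mul_bin_diag q 1; rewrite bin1;
 case: (q) => // n; rewrite -mul2n /= => e; rewrite -e; apply: dvdn_mulr.
Qed.

(** Chambers' formula: the trace depends on the phase [w] only through
    [w^q + w^-q]. *)
Lemma chambers_alg : exists d : F, forall w : F, w != 0 ->
  \tr (transfer (fun n => z - lam * (w * zeta ^+ n + (w * zeta ^+ n)^-1)) 1 q) =
  d + (- lam) ^+ q * (\prod_(n < q) zeta ^+ n) * (w ^+ q + w ^- q).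
Proof.
exists (G`_q) => w w0.
have wq0 : w ^+ q != 0 by rewrite expf_neq0.
apply: (mulfI wq0).
have pl : (- lam) ^+ q = \prod_(n < q) (- lam) by rewrite prodr_const card_ord.
have e1 : G`_(2 * q) = (- lam) ^+ q * (\prod_(n < q) zeta ^+ n).
  rewrite scaled_trace_coef_2q pl -big_split /=.
  by apply: eq_bigr => i _; rewrite mulNr.
have e0 : G`_0 = (- lam) ^+ q * (\prod_(n < q) zeta ^+ n).
  have -> : \prod_(n < q) zeta ^+ n = (\prod_(n < q) zeta ^+ n)^-1.
    have := prim_prod_sq; rewrite expr2 => h.
    have p0 : \prod_(n < q) zeta ^+ n != 0.
      by apply/eqP => h0; move: h; rewrite h0 mul0r => /eqP; rewrite eq_sym oner_eq0.
    by apply: (mulfI p0); rewrite h mulfV.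
  rewrite scaled_trace_coef_0 pl -prodfV -big_split /=.
  by apply: eq_bigr => i _; rewrite mulNr.
transitivity (G.[w]).
  have -> : G.[w] = \tr (transfer
      (fun n => w * (z - lam * (w * zeta ^+ n + (w * zeta ^+ n)^-1))) (w * 1) q).
    have := map_transfer (horner_eval w) b 'X q.
    rewrite /= [horner_eval _ 'X]hornerX => /matrixP ev.
    rewrite /G !mxtrace2 hornerD.
    have ev' i j : (T q i j).[w] = transfer (fun n => (b n).[w]) w q i j.
      by have := ev i j; rewrite mxE.
    rewrite !ev'.
    have -> : transfer (fun n => (b n).[w]) w q = transfer
        (fun n => w * (z - lam * (w * zeta ^+ n + (w * zeta ^+ n)^-1))) w q.
      apply: eq_transfer => n _.
      by rewrite /b !hornerE /=; field; rewrite expf_neq0 ?zeta0 ?w0.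
    by rewrite mulr1.
  by rewrite transfer_scale mxtraceZ.
rewrite scaled_trace_horner e0 e1 mulrDr (_ : w ^+ (2 * q) = w ^+ q * w ^+ q); last first.
  by rewrite mul2n -addnn exprD.
rewrite !mulrDr; field; exact: wq0.
Qed.
End Chambers.

(** * Square-summable sequences *)

Section Normc.
Variable R : realType.
Implicit Types (z : R[i]).
Local Notation normc := Normc.normc.

Lemma normc_sq z : normc z ^+ 2 = complex.Re z ^+ 2 + complex.Im z ^+ 2.
Proof. by case: z => a b /=; rewrite sqr_sqrtr // addr_ge0 ?sqr_ge0. Qed.

Lemma normc_ge0 z : 0 <= normc z.
Proof. by case: z => a b /=; rewrite sqrtr_ge0. Qed.

Lemma normc_real (a : R) : normc a%:C%C = `|a|.
Proof. by rewrite /= expr0n /= addr0 sqrtr_sqr. Qed.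

Lemma normc_eq0 z : (normc z == 0) = (z == 0).
Proof.
by apply/eqP/eqP => [|->]; [exact: Normc.eq0_normc|exact: Normc.normc0].
Qed.

Lemma normcX z n : normc (z ^+ n) = normc z ^+ n.
Proof.
by elim: n => [|n IH]; rewrite ?expr0 ?Normc.normc1 // !exprS Normc.normcM IH.
Qed.

Lemma Re_le_normc z : `|complex.Re z| <= normc z.
Proof.
by rewrite -(@ler_pXn2r _ 2) ?nnegrE ?normc_ge0 // normc_sq real_normK ?num_real // lerDl sqr_ge0.
Qed.

Lemma Im_le_normc z : `|complex.Im z| <= normc z.
Proof.
by rewrite -(@ler_pXn2r _ 2) ?nnegrE ?normc_ge0 // normc_sq real_normK ?num_real // lerDr sqr_ge0.
Qed.

(** A weighted triangle inequality for squares; the weights make the Neumann series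
    below converge with the sharp constant. *)
Lemma normcD_sq (a b : R[i]) (t : R) : 0 < t < 1 ->
  normc (a + b) ^+ 2 <= normc a ^+ 2 / (1 - t) + normc b ^+ 2 / t.
Proof.
move=> /andP[t0 t1].
rewrite !normc_sq; case: a => a1 a2; case: b => b1 b2 /=.
have t1' : 0 < 1 - t by lra.
have key (x y : R) : (x + y) ^+ 2 <= x ^+ 2 / (1 - t) + y ^+ 2 / t.
  rewrite -subr_ge0.
  have -> : x ^+ 2 / (1 - t) + y ^+ 2 / t - (x + y) ^+ 2 =
     (t * x - (1 - t) * y) ^+ 2 / (t * (1 - t)) by field; lra.
  by rewrite divr_ge0 ?sqr_ge0 // mulr_ge0 //; lra.
rewrite !mulrDl; have := key a1 b1; have := key a2 b2; lra.
Qed.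

Lemma Re_sum (I : Type) (r : seq I) (F : I -> R[i]) :
  complex.Re (\sum_(i <- r) F i) = \sum_(i <- r) complex.Re (F i).
Proof.
by elim: r => [|x r IH]; rewrite ?big_nil // !big_cons -IH; case: (F x) (\sum_(i<-r) F i) => ? ? [].
Qed.

Lemma Im_sum (I : Type) (r : seq I) (F : I -> R[i]) :
  complex.Im (\sum_(i <- r) F i) = \sum_(i <- r) complex.Im (F i).
Proof.
by elim: r => [|x r IH]; rewrite ?big_nil // !big_cons -IH; case: (F x) (\sum_(i<-r) F i) => ? ? [].
Qed.

End Normc.

Section L2.
Variable R : realType.
Local Notation normc := Normc.normc.
Local Notation C := (R[i]).
Implicit Types (psi phi : int -> C) (s t : R).

(** [l2b psi s] says that the squared l2 norm of [psi] is at most [s]; it is stated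
    with finite sums, which avoids extended reals. *)
Definition l2b psi s :=
  forall F : seq int, uniq F -> \sum_(n <- F) normc (psi n) ^+ 2 <= s.

(** The squared l2 norm, as an extended real. *)
Let sqsum psi : \bar R := (\esum_(n in [set: int]) (normc (psi n) ^+ 2)%:E)%E.

Let sqsumP psi s : (sqsum psi <= s%:E)%E <-> l2b psi s.
Proof.
split.
  move=> h F uF; rewrite -lee_fin; apply: le_trans h.
  apply: ereal_sup_ubound; exists [set` F].
    by split; [exact: finite_seq|].
  by rewrite -sumEFin -fsbig_seq.
move=> h; apply: ge_ereal_sup => _ [X [finX _] <-].
rewrite fsbig_finite //= sumEFin lee_fin; apply: h; exact: finmap.fset_uniq.
Qed.

Lemma l2bP psi : l2 psi <-> exists s, l2b psi s.
Proof.
rewrite /l2 /= /l2norm -/(sqsum psi).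
have s0 : (0 <= sqsum psi)%E by apply: esum_ge0 => n _; rewrite lee_fin sqr_ge0.
split => [|[s /sqsumP hs]].
  case E : (sqsum psi) => [r| |] //= _.
  - by exists r; apply/sqsumP; rewrite E.
  - by rewrite E in s0.
by case: (sqsum psi) hs => [r| |] //=; rewrite ?ltry ?ltNyr.
Qed.

Lemma l2b_norm_le M psi phi : 0 <= M -> l2 psi ->
  (forall s, l2b psi s -> l2b phi (M ^+ 2 * s)) ->
  (l2norm phi <= M%:E * l2norm psi)%E.
Proof.
move=> M0; rewrite /l2 /= /l2norm -!/(sqsum _) => l2psi h.
have s0 p : (0 <= sqsum p)%E by apply: esum_ge0 => n _; rewrite lee_fin sqr_ge0.
case E : (sqsum psi) l2psi => [r| |] //= _; last by have := s0 psi; rewrite E.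
have r0 : 0 <= r by rewrite -lee_fin -E.
have /sqsumP h1 : l2b phi (M ^+ 2 * r) by apply/h/sqsumP; rewrite E.
apply: (@le_trans _ _ (sqrte (M ^+ 2 * r)%:E)).
  by rewrite lee_sqrt // lee_fin mulr_ge0 // sqr_ge0.
by rewrite /= lee_fin sqrtrM ?sqr_ge0 // sqrtr_sqr ger0_norm.
Qed.

Lemma l2b_of_norm_le M psi phi : 0 <= M ->
  (l2norm phi <= M%:E * l2norm psi)%E ->
  forall s, l2b psi s -> l2b phi (M ^+ 2 * s).
Proof.
move=> M0; rewrite /l2norm -!/(sqsum _) => h s /sqsumP hs; apply/sqsumP.
have s0 p : (0 <= sqsum p)%E by apply: esum_ge0 => n _; rewrite lee_fin sqr_ge0.
move: h hs (s0 psi) (s0 phi).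
case: (sqsum psi) => [r| |] //=.
rewrite -EFinM.
case: (sqsum phi) => [r'| |] //=.
rewrite !lee_fin => h rs r0 r'0.
have : Num.sqrt r' ^+ 2 <= (M * Num.sqrt r) ^+ 2.
  by rewrite ler_pXn2r ?nnegrE ?mulr_ge0 ?sqrtr_ge0.
rewrite exprMn !sqr_sqrtr // => /le_trans; apply.
by rewrite ler_wpM2l // sqr_ge0.
Qed.

Lemma l2b_ge0 psi s : l2b psi s -> 0 <= s.
Proof. by move=> /(_ [::] isT); rewrite big_nil. Qed.

Lemma l2b_pt psi s n : l2b psi s -> normc (psi n) ^+ 2 <= s.
Proof. by move=> /(_ [:: n] isT); rewrite big_seq1. Qed.

Lemma l2b_shift psi s (m : int) : l2b psi s -> l2b (fun n => psi (n + m)) s.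
Proof.
move=> h F uF.
rewrite -(big_map (fun n => n + m) xpredT (fun n => normc (psi n) ^+ 2)).
by apply: h; rewrite map_inj_uniq //; apply: addIr.
Qed.

Lemma l2b_mul psi s (a : int -> C) m :
  0 <= m -> (forall n, normc (a n) <= m) ->
  l2b psi s -> l2b (fun n => a n * psi n) (m ^+ 2 * s).
Proof.
move=> m0 am h F uF.
apply: (@le_trans _ _ (m ^+ 2 * \sum_(n <- F) normc (psi n) ^+ 2)).
  rewrite mulr_sumr; apply: ler_sum => n _.
  rewrite Normc.normcM exprMn ler_wpM2r ?sqr_ge0 //.
  by rewrite ler_pXn2r ?nnegrE ?normc_ge0.
by rewrite ler_wpM2l ?sqr_ge0 // h.
Qed.

Lemma l2b_add_weight psi phi s t r : 0 < r < 1 -> l2b psi s -> l2b phi t ->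
  l2b (fun n => psi n + phi n) (s / (1 - r) + t / r).
Proof.
move=> /andP[r0 r1] hs ht F uF.
apply: (@le_trans _ _ ((\sum_(n <- F) normc (psi n) ^+ 2) / (1 - r) +
                       (\sum_(n <- F) normc (phi n) ^+ 2) / r)).
  rewrite !mulr_suml -big_split /=; apply: ler_sum => n _.
  by apply: normcD_sq; rewrite r0.
by apply: lerD; rewrite ler_pM2r ?invr_gt0 ?subr_gt0 //; [exact: hs|exact: ht].
Qed.

Lemma l2b_add psi phi s t : l2b psi s -> l2b phi t ->
  l2b (fun n => psi n + phi n) (2 * s + 2 * t).
Proof.
move=> hs ht; have := @l2b_add_weight _ _ _ _ 2^-1 _ hs ht.
have -> : 1 - 2^-1 = 2^-1 :> R by field.
by rewrite invrK ![_ * 2]mulrC; apply; apply/andP; split; lra.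
Qed.

Lemma l2_lin a psi phi : l2 psi -> l2 phi -> l2 (fun n => a * psi n + phi n).
Proof.
move=> /l2bP[s hs] /l2bP[t ht]; apply/l2bP.
exists (2 * (normc a ^+ 2 * s) + 2 * t); apply: l2b_add => //.
by apply: l2b_mul => //; exact: normc_ge0.
Qed.

Lemma l2b_fin (f : int -> C) (l : seq int) (b : R) :
  (forall n, normc (f n) <= if n \in l then b else 0) -> l2b f ((size l)%:R * b ^+ 2).
Proof.
move=> h F uF.
apply: (@le_trans _ _ (\sum_(n <- F) if n \in l then b ^+ 2 else 0)).
  apply: ler_sum => n _; have := h n; case: ifP => _ hn.
    by rewrite ler_pXn2r ?nnegrE ?normc_ge0 // (le_trans (normc_ge0 _) hn).
  have -> : normc (f n) = 0 by apply/eqP; rewrite eq_le hn normc_ge0.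
  by rewrite expr0n.
rewrite -big_mkcond /= -big_filter big_const_seq count_predT iter_addr addr0 -[leLHS]mulr_natl.
rewrite ler_wpM2r ?sqr_ge0 // ler_nat uniq_leq_size ?filter_uniq // => x.
by rewrite mem_filter => /andP[].
Qed.

(** Maps that are bounded for the l2 norm. *)
Definition bop (B : (int -> C) -> int -> C) :=
  exists2 M, 0 <= M & forall psi s, l2b psi s -> l2b (B psi) (M * s).

Lemma bop_l2 B psi : bop B -> l2 psi -> l2 (B psi).
Proof. by move=> [M _ h] /l2bP[s /h hs]; apply/l2bP; exists (M * s). Qed.

Lemma bop_comp B B' : bop B -> bop B' -> bop (fun psi => B (B' psi)).
Proof.
move=> [M M0 h] [M' M0' h']; exists (M * M'); first exact: mulr_ge0.
by move=> psi s /h'/h; rewrite mulrA.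
Qed.

Lemma bop_add B B' : bop B -> bop B' -> bop (fun psi n => B psi n + B' psi n).
Proof.
move=> [M M0 h] [M' M0' h']; exists (2 * M + 2 * M'); first by rewrite addr_ge0 ?mulr_ge0.
move=> psi s hs; rewrite mulrDl -!mulrA; exact: l2b_add (h _ _ hs) (h' _ _ hs).
Qed.

Lemma bop_mul (a : int -> C) m B : (forall n, normc (a n) <= m) -> bop B ->
  bop (fun psi n => a n * B psi n).
Proof.
move=> am [M M0 h]; have m0 : 0 <= m by apply: le_trans (normc_ge0 _) (am 0).
exists (m ^+ 2 * M); first by rewrite mulr_ge0 ?sqr_ge0.
by move=> psi s /h hs; rewrite -mulrA; apply: l2b_mul.
Qed.

Lemma bop_shift (m : int) B : bop B -> bop (fun psi n => B psi (n + m)).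
Proof. by move=> [M M0 h]; exists M => // psi s /h; exact: l2b_shift. Qed.

Lemma bop_id : bop id.
Proof. by exists 1 => // psi s; rewrite mul1r. Qed.

Lemma bop_sum (I : Type) (r : seq I) (B : I -> (int -> C) -> int -> C) :
  (forall i, bop (B i)) -> bop (fun psi n => \sum_(i <- r) B i psi n).
Proof.
move=> h; elim: r => [|i r [M M0 hM]].
  exists 0 => // psi s _ F uF; rewrite mul0r big1 // => n _.
  by rewrite big_nil Normc.normc0 expr0n.
have [M' M'0 hM'] := bop_add (h i) (ex_intro2 _ _ M M0 hM).
exists M' => // psi s /hM' h2 F uF.
by under eq_bigr do rewrite big_cons; apply: h2.
Qed.

(** If [T - z] is bijective on l2 with a bounded inverse, [z] is in the resolvent
    set of [T]. *)
Lemma resolvent_bij (T : (int -> C) -> int -> C) (z : C) (M : R) :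
  (forall a psi phi, T (fun n => a * psi n + phi n) = (fun n => a * T psi n + T phi n)) ->
  0 <= M ->
  (forall psi s, l2b psi s -> exists2 phi, l2 phi &
     (fun n => T phi n - z * phi n) = psi /\ (forall s, l2b psi s -> l2b phi (M ^+ 2 * s))) ->
  (forall eta, l2 eta -> (forall n, T eta n - z * eta n = 0) -> eta = (fun=> 0)) ->
  (forall psi, l2 psi -> l2 (fun n => T psi n - z * psi n)) ->
  resolvent_set T z.
Proof.
move=> lin M0 ex inj Tl2.
have ex' psi : exists phi, l2 psi -> l2 phi /\
     (fun n => T phi n - z * phi n) = psi /\ (forall s, l2b psi s -> l2b phi (M ^+ 2 * s)).
  have [/l2bP[s hs]|nl2] := pselect (l2 psi); last by exists psi.
  by have [phi h1 h2] := ex _ _ hs; exists phi.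
have [B hB] := choice ex'.
have uniq phi1 phi2 : l2 phi1 -> l2 phi2 ->
    (fun n => T phi1 n - z * phi1 n) = (fun n => T phi2 n - z * phi2 n) -> phi1 = phi2.
  move=> l1 l2' e.
  have l3 := l2_lin (-1) l2' l1.
  have e0 : (fun n => -1 * phi2 n + phi1 n) = (fun=> 0).
    apply: inj => // n; rewrite lin /=.
    have := congr1 (fun f => f n) e; rewrite /= => e'.
    by move: e' => /eqP; rewrite -subr_eq0 => /eqP <-; ring.
  apply/funext => n; have := congr1 (fun f => f n) e0; rewrite /= mulN1r addrC.
  by move/eqP; rewrite subr_eq0 => /eqP.
exists B; split.
  split.
  - by move=> psi /hB[].
  - move=> a psi phi hpsi hphi.
    have [l1 [e1 _]] := hB _ hpsi; have [l2' [e2 _]] := hB _ hphi.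
    have [l3 [e3 _]] := hB _ (l2_lin a hpsi hphi).
    apply: uniq => //; first exact: l2_lin.
    rewrite e3 lin; apply/funext => n.
    have <- := congr1 (fun f => f n) e1; have <- := congr1 (fun f => f n) e2.
    by rewrite /=; ring.
  - exists M => psi hpsi; have [l1 [_ h]] := hB _ hpsi.
    exact: l2b_norm_le.
move=> psi hpsi; have [l1 [e1 _]] := hB _ hpsi.
split=> //; have [l3 [e3 _]] := hB _ (Tl2 _ hpsi).
by apply: uniq.
Qed.
End L2.

(** * Neumann series, and the discriminant as a sum of shifts *)

Section Neumann.
Variable R : realType.
Local Notation normc := Normc.normc.
Local Notation C := (R[i]).
Implicit Types (psi phi : int -> C) (s t : R).

(** Here and below [S] is the shift, and [|rho| < 1]; [1 - rho S^m] is injective on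
    l2. *)
Lemma l2_geo_inj (rho : C) (m : int) eta : normc rho < 1 -> l2 eta ->
  (forall n, eta n = rho * eta (n + m)) -> eta = (fun=> 0).
Proof.
move=> r1 /l2bP[s hs] e; apply/funext => n.
have it k : eta n = rho ^+ k * eta (n + m *+ k).
  elim: k => [|k IH]; first by rewrite expr0 mul1r mulr0n addr0.
  by rewrite IH e exprSr -mulrA mulrSr addrA.
have r0 := normc_ge0 rho.
have h k : normc (eta n) ^+ 2 <= (normc rho ^+ 2) ^+ k * s.
  rewrite (it k) Normc.normcM normcX exprMn -!exprM mulnC.
  by rewrite ler_wpM2l ?exprn_ge0 // (l2b_pt _ hs).
have c0 : (fun k => (normc rho ^+ 2) ^+ k * s) @ \oo --> (0 * s : R).
  apply: cvgMl; apply: cvg_expr.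
  by rewrite ger0_norm ?exprn_ge0 // exprn_ilt1.
have : normc (eta n) ^+ 2 <= 0.
  rewrite -[X in _ <= X](mul0r s) -(cvg_lim _ c0) //.
  by apply: limr_ge; [apply/cvg_ex; eexists; exact: c0 | near=> k; exact: h].
rewrite le_eqVlt ltNge sqr_ge0 orbF sqrf_eq0 normc_eq0 => /eqP //.
Unshelve. all: by end_near. Qed.

(** The Neumann series inverts [1 - rho S^m] on l2. *)
Lemma l2_geo_solve (rho : C) (m : int) psi s : normc rho < 1 -> l2b psi s ->
  exists phi, (forall n, phi n - rho * phi (n + m) = psi n) /\
    forall s, l2b psi s -> l2b phi ((1 - normc rho)^-1 ^+ 2 * s).
Proof.
move=> r1 hs; have r0 := normc_ge0 rho; set r := normc rho in r0 r1 *.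
pose u (n : int) (k : nat) := rho ^+ k * psi (n + m *+ k).
(* partial sums of the Neumann series; they satisfy [S (K+1) = psi + rho S^m (S K)] *)
pose S (K : nat) (n : int) := \sum_(0 <= k < K) u n k.
have SS K n : S K.+1 n = psi n + rho * S K (n + m).
  rewrite /S big_nat_recl // /u expr0 mul1r mulr0n addr0 mulr_sumr; congr (_ + _).
  by apply: eq_bigr => k _; rewrite mulrA -exprS mulrS addrA.
have Sb t : l2b psi t -> forall K, l2b (S K) ((1 - r)^-1 ^+ 2 * t).
  move=> ht; have t0 := l2b_ge0 ht.
  elim=> [|K IH].
    move=> F uF; rewrite big1 => [|n _].
      by rewrite mulr_ge0 // exprn_ge0 // invr_ge0 subr_ge0 ltW.
    by rewrite /S big_geq // Normc.normc0 expr0n.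
  case: (eqVneq r 0) => [r00|rn0].
    move=> F uF; under eq_bigr do rewrite SS.
    have -> : rho = 0 by apply/eqP; rewrite -normc_eq0; apply/eqP.
    rewrite r00 subr0 invr1 expr1n mul1r.
    by under eq_bigr do rewrite mul0r addr0; exact: ht.
  have h1 := l2b_mul r0 (a := fun=> rho) (fun=> lexx r) (l2b_shift m IH).
  have rp : 0 < r < 1 by rewrite lt_def rn0 r0.
  (* with weight [r] the bound [t / (1 - r)^2] reproduces itself *)
  have := l2b_add_weight rp ht h1.
  rewrite (_ : t / (1 - r) + _ = (1 - r)^-1 ^+ 2 * t); last by field; rewrite rn0; lra.
  by move=> h F uF; under eq_bigr do rewrite SS; exact: h.
pose lre n := limn (series (fun k => complex.Re (u n k))).
pose lim_im n := limn (series (fun k => complex.Im (u n k))).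
have bu n k : normc (u n k) <= Num.sqrt s * r ^+ k.
  rewrite /u Normc.normcM normcX mulrC ler_wpM2r ?exprn_ge0 //.
  rewrite -[X in X <= _]ger0_norm ?normc_ge0 // -sqrtr_sqr ler_wsqrtr //.
  exact: l2b_pt hs.
have cv (v : nat -> R) n : (forall k, `|v k| <= normc (u n k)) -> cvgn (series v).
  move=> hv; apply: normed_cvg.
  apply: (@series_le_cvg _ _ (fun k => Num.sqrt s * r ^+ k)) => //=.
  - by move=> k; rewrite mulr_ge0 ?sqrtr_ge0 ?exprn_ge0.
  - by move=> k; apply: le_trans (hv k) (bu n k).
  - have := @is_cvg_geometric_series _ (Num.sqrt s) r; rewrite /geometric /=.
    by apply; rewrite ger0_norm.
have cre n : (fun K => complex.Re (S K n)) @ \oo --> lre n.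
  rewrite (_ : (fun K => _) = series (fun k => complex.Re (u n k))).
    by apply: cv => k; exact: Re_le_normc.
  by apply/funext => K; rewrite /S Re_sum.
have cim n : (fun K => complex.Im (S K n)) @ \oo --> lim_im n.
  rewrite (_ : (fun K => _) = series (fun k => complex.Im (u n k))).
    by apply: cv => k; exact: Im_le_normc.
  by apply/funext => K; rewrite /S Im_sum.
pose phi n : C := Complex (lre n) (lim_im n).
exists phi; split.
  move=> n; apply/eqP; rewrite subr_eq; apply/eqP.
  have e1 K : complex.Re (S K.+1 n) = complex.Re (psi n) +
      (complex.Re rho * complex.Re (S K (n + m)) - complex.Im rho * complex.Im (S K (n + m))).
    by rewrite SS; case: (psi n) (rho) (S K _) => ? ? [? ?] [].
  have e2 K : complex.Im (S K.+1 n) = complex.Im (psi n) +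
      (complex.Re rho * complex.Im (S K (n + m)) + complex.Im rho * complex.Re (S K (n + m))).
    by rewrite SS; case: (psi n) (rho) (S K _) => ? ? [? ?] [].
  have re1 : lre n = complex.Re (psi n) +
      (complex.Re rho * lre (n + m) - complex.Im rho * lim_im (n + m)).
    apply: (@cvg_unique _ _ ((fun K => complex.Re (S K.+1 n)) @ \oo)) => //.
      by have := cre n; rewrite -cvg_shiftS.
    have -> := funext e1.
    by apply: cvgD; [exact: cvg_cst|apply: cvgB; apply: cvgMr].
  have re2 : lim_im n = complex.Im (psi n) +
      (complex.Re rho * lim_im (n + m) + complex.Im rho * lre (n + m)).
    apply: (@cvg_unique _ _ ((fun K => complex.Im (S K.+1 n)) @ \oo)) => //.
      by have := cim n; rewrite -cvg_shiftS.
    have -> := funext e2.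
    by apply: cvgD; [exact: cvg_cst|apply: cvgD; apply: cvgMr].
  by rewrite /phi re1 re2; case: (psi n) (rho) => ? ? [? ?].
move=> t ht F uF.
have cN n : (fun K => normc (S K n) ^+ 2) @ \oo --> (normc (phi n) ^+ 2 : R).
  under eq_fun do rewrite normc_sq.
  rewrite normc_sq /= !expr2.
  by apply: cvgD; under eq_fun do rewrite expr2; apply: cvgM.
have cF : (fun K => \sum_(n <- F) normc (S K n) ^+ 2) @ \oo -->
    (\sum_(n <- F) normc (phi n) ^+ 2 : R).
  elim: (F) => [|n G IH].
    by rewrite big_nil; under eq_fun do rewrite big_nil; exact: cvg_cst.
  by rewrite big_cons; under eq_fun do rewrite big_cons; apply: cvgD.
rewrite -(cvg_lim _ cF) //; apply: limr_le.
  by apply/cvg_ex; eexists; exact: cF.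
by near=> K; exact: Sb.
Unshelve. all: by end_near. Qed.

(** [S^m + S^-m - (rho + rho^-1)] factors as
    [- rho^-1 (1 - rho S^m) (1 - rho S^-m)], hence it is invertible on l2. *)
Lemma l2_trig_solve (rho : C) (m : int) psi s : normc rho < 1 -> rho != 0 -> l2b psi s ->
  exists phi, (forall n, phi (n + m) + phi (n - m) - (rho + rho^-1) * phi n = psi n) /\
    forall s, l2b psi s -> l2b phi (normc rho ^+ 2 *
       ((1 - normc rho)^-1 ^+ 2 * ((1 - normc rho)^-1 ^+ 2 * s))).
Proof.
move=> r1 rn0 hs.
have [phi1 [e1 b1]] := l2_geo_solve m r1 hs.
have [phi2 [e2 b2]] := l2_geo_solve (- m) r1 (b1 _ hs).
exists (fun n => - rho * phi2 n); split.
  move=> n; rewrite -e1 -!e2 addrK.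
  by field.
move=> t /b1/b2 ht; apply: l2b_mul => //; first exact: normc_ge0.
by move=> _; rewrite normcN.
Qed.

Lemma l2_trig_inj (rho : C) (m : int) eta : normc rho < 1 -> rho != 0 -> l2 eta ->
  (forall n, eta (n + m) + eta (n - m) - (rho + rho^-1) * eta n = 0) -> eta = (fun=> 0).
Proof.
move=> r1 rn0 l2e e.
apply: (@l2_geo_inj rho (- m)) => // n; apply/eqP; rewrite -subr_eq0; apply/eqP.
pose xi n := - rho * eta (n - m) + eta n.
have xi0 : xi = (fun=> 0).
  apply: (@l2_geo_inj rho m) => //.
    apply: l2_lin => //; case/l2bP: l2e => t ht; apply/l2bP; exists t.
    exact: l2b_shift.
  move=> k; rewrite /xi addrK; apply/eqP; rewrite -subr_eq0.
  rewrite (_ : _ - _ = - rho * (eta (k + m) + eta (k - m) - (rho + rho^-1) * eta k)).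
    by rewrite e mulr0.
  by field.
by have := congr1 (fun f => f n) xi0; rewrite /xi /= mulNr addrC.
Qed.

End Neumann.

Section Magic.
Variable R : realType.
Local Notation normc := Normc.normc.
Local Notation C := (R[i]).
Implicit Types (psi phi : int -> C) (g h : {poly C}).
Variable V : int -> R.

(** The discrete Schrödinger operator with potential [V]. *)
Definition Hop psi : int -> C := fun n => psi (n - 1) + psi (n + 1) + (V n)%:C%C * psi n.

Lemma Hop_lin a psi phi :
  Hop (fun n => a * psi n + phi n) = (fun n => a * Hop psi n + Hop phi n).
Proof. by apply/funext => n; rewrite /Hop; ring. Qed.

Lemma iter_Hop_lin k a psi phi :
  iter k Hop (fun n => a * psi n + phi n) =
  (fun n => a * iter k Hop psi n + iter k Hop phi n).
Proof. by elim: k => [//|k IH]; rewrite !iterS IH Hop_lin. Qed.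

(** Action of the polynomials on sequences, ['X] acting as [Hop]. *)
Definition hact g psi : int -> C := fun n => \sum_(i < size g) g`_i * iter i Hop psi n.

Lemma hact_wide N g psi n : (size g <= N)%N ->
  hact g psi n = \sum_(i < N) g`_i * iter i Hop psi n.
Proof.
move=> sN; rewrite /hact (big_ord_widen_cond _ xpredT (fun i => g`_i * iter i Hop psi n) sN).
rewrite big_mkcond /=; apply: eq_bigr => i _; case: ltnP => // h.
by rewrite nth_default // mul0r.
Qed.

Lemma hact_lin g a psi phi :
  hact g (fun n => a * psi n + phi n) = (fun n => a * hact g psi n + hact g phi n).
Proof.
apply/funext => n; rewrite /hact mulr_sumr -big_split /=; apply: eq_bigr => i _.
by rewrite iter_Hop_lin; ring.
Qed.

Lemma hactD g h psi n : hact (g + h) psi n = hact g psi n + hact h psi n.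
Proof.
pose N := maxn (size (g + h)) (maxn (size g) (size h)).
rewrite !(@hact_wide N) ?leq_max ?leqnn ?orbT // -big_split /=.
by apply: eq_bigr => i _; rewrite coefD mulrDl.
Qed.

Lemma hactC c psi : hact c%:P psi = (fun n => c * psi n).
Proof.
apply/funext => n; rewrite (@hact_wide 1) ?size_polyC_leq1 // big_ord1.
by rewrite coefC.
Qed.

Lemma hactZ c g psi n : hact (c%:P * g) psi n = c * hact g psi n.
Proof.
rewrite !(@hact_wide (size g)) ?mul_polyC ?size_scale_leq //.
by rewrite mulr_sumr; apply: eq_bigr => i _; rewrite coefZ mulrA.
Qed.

Lemma hactN g psi n : hact (- g) psi n = - hact g psi n.
Proof. by rewrite -mulN1r -polyCN hactZ mulN1r. Qed.

Lemma hactX g psi : hact (g * 'X) psi = hact g (Hop psi).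
Proof.
apply/funext => n; rewrite (@hact_wide (size g).+1).
  rewrite big_ord_recl [X in X + _](_ : _ = 0) ?add0r; last by rewrite coefMX mul0r.
  apply: eq_bigr => i _.
  by rewrite lift0 coefMX iterSr.
by apply: leq_trans (size_polyMleq _ _) _; rewrite size_polyX addn2.
Qed.

Lemma hactXsubC c g psi n :
  hact (('X - c%:P) * g) psi n = hact g (Hop psi) n - c * hact g psi n.
Proof. by rewrite mulrBl hactD hactN hactZ ['X * g]mulrC hactX. Qed.

Lemma hact0 psi : hact 0 psi = fun=> 0.
Proof. by apply/funext => n; rewrite /hact size_poly0 big_ord0. Qed.

Lemma hact1 psi : hact 1 psi = psi.
Proof. by rewrite -polyC1 hactC; apply/funext => n; rewrite mul1r. Qed.

Lemma hactM g h psi : hact (g * h) psi = hact g (hact h psi).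
Proof.
elim/poly_ind: h psi => [|h c IH] psi.
  rewrite mulr0 hact0; apply/esym; apply/funext => n.
  have := hact_lin g (-1) psi psi.
  have -> : (fun n => -1 * psi n + psi n) = fun=> 0.
    by apply/funext => k; rewrite mulN1r addNr.
  by move=> ->; rewrite mulN1r addNr.
apply/funext => n; rewrite mulrDr hactD mulrA hactX IH mulrC hactZ.
have -> : hact (h * 'X + c%:P) psi = (fun n => c * psi n + hact h (Hop psi) n).
  by apply/funext => k; rewrite hactD hactX hactC addrC.
by rewrite hact_lin addrC.
Qed.

Lemma hact_Hop g psi : hact g (Hop psi) = Hop (hact g psi).
Proof. by rewrite -hactX mulrC hactM -(mul1r 'X) hactX hact1. Qed.

(** Transfer matrix over the [k] sites from [n] on, as polynomials in the energy. *)
Local Notation Tx n k := (transfer (fun i : nat => 'X - ((V (n + i%:Z))%:C%C)%:P : {poly C}) 1 k).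

(** Every sequence solves the eigenvalue equation when the energy acts as the
    operator itself, hence is propagated by the transfer matrices. *)
Lemma transfer_act k n psi :
  psi (n + k%:Z) = hact (Tx n k 0 0) psi n + hact (Tx n k 0 1) psi (n - 1) /\
  psi (n + k%:Z - 1) = hact (Tx n k 1 0) psi n + hact (Tx n k 1 1) psi (n - 1).
Proof.
elim: k psi => [|k IH] psi.
  rewrite addr0 /= !mxE /= !mulr1n !mulr0n hact0 hact1; split; ring.
have [IH1 IH2] := IH psi; have [IH3 _] := IH (Hop psi).
have eS : n + k.+1%:Z = n + k%:Z + 1 by rewrite -addn1 PoszD addrA.
rewrite !transfer0E !transfer1E !mul1r eS addrK; split; last exact: IH1.
rewrite !hactD !hactN !hactXsubC.
have -> : psi (n + k%:Z + 1) = Hop psi (n + k%:Z) - (V (n + k%:Z))%:C%C * psi (n + k%:Z) -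
    psi (n + k%:Z - 1) by rewrite /Hop; ring.
rewrite IH3 IH2 IH1; ring.
Qed.

Variable q : nat.
Hypothesis q0 : (0 < q)%N.
Hypothesis Vq : forall n, V (n + q%:Z) = V n.

(** The discriminant of a potential of period [q]. *)
Definition discr : {poly C} := \tr (Tx 0 q).

Lemma discr_shift n : \tr (Tx n q) = discr.
Proof.
have st m : \tr (Tx (m + 1) q) = \tr (Tx m q).
  rewrite -[RHS]transfer_tr_shift ?addr0 ?Vq //.
  congr (\tr _); apply: eq_transfer => i _; congr ('X - ((V _)%:C%C)%:P).
  by rewrite -addn1 PoszD; ring.
elim: n => [//|n IH|n IH].
  by rewrite (_ : n.+1%:Z = n%:Z + 1) ?st //; lia.
by rewrite -IH (_ : - n%:Z = - n.+1%:Z + 1) ?st //; lia.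
Qed.

(** The discriminant acts as the sum of the two translations by a period: apply
    the Cayley-Hamilton theorem to the matrix of a period. *)
Lemma discr_act psi n : hact discr psi n = psi (n + q%:Z) + psi (n - q%:Z).
Proof.
suff act b : hact discr psi (b + q%:Z) = psi (b + q%:Z + q%:Z) + psi b.
  by have := act (n - q%:Z); rewrite subrK.
have Vb : Tx (b + q%:Z) q = Tx b q.
  by apply: eq_transfer => i _; rewrite [b + q%:Z + i%:Z]addrAC Vq.
have act := transfer_act q.
have [h1 _] := act (b + q%:Z) psi; rewrite Vb in h1.
have [h2 _] := act b (hact (Tx b q 0 0) psi).
have [_ h3] := act b (hact (Tx b q 0 1) psi).
have [h4 _] := act b (hact discr psi).
set M := Tx b q in h1 h2 h3 h4.
have hM j : M 0 0 * M 0 j + M 1 j * M 0 1 = discr * M 0 j - (0 == j)%:R.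
  rewrite -(discr_shift b) -cayley_hamilton2 ?transfer_det // mxE big_ord_recl big_ord1.
  have -> : lift ord0 ord0 = 1 :> 'I_2 by apply/val_inj.
  by rewrite [M 1 j * _]mulrC.
have e0 : hact (M 0 0) (hact (M 0 0) psi) b + hact (M 1 0) (hact (M 0 1) psi) b =
    hact (M 0 0) (hact discr psi) b - psi b.
  by rewrite -!hactM -hactD hM hactD hactN hact1 [discr * _]mulrC.
have e1 : hact (M 0 1) (hact (M 0 0) psi) (b - 1) + hact (M 1 1) (hact (M 0 1) psi) (b - 1) =
    hact (M 0 1) (hact discr psi) (b - 1).
  by rewrite -!hactM -hactD [M 0 1 * M 0 0]mulrC hM hactD hactN hact0 subr0 [discr * _]mulrC.
rewrite h1 h2 h3 h4; move: e0 e1; set x1 := hact _ _ _; set x2 := hact _ _ _.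
move=> e0 e1; rewrite addrACA e0.
by rewrite e1; ring.
Qed.

End Magic.

(** * Spectrum of a periodic operator *)

Section Joukowski.
Variable R : realType.
Local Notation normc := Normc.normc.
Local Notation C := (R[i]).

Lemma normc1_inv (rho : C) : normc rho = 1 ->
  rho + rho^-1 = (2 * complex.Re rho)%:C%C /\ -1 <= complex.Re rho <= 1.
Proof.
move=> h; have := normc_sq rho; rewrite h expr1n.
case: rho h => x y /= _ h; split; last by apply/andP; split; nra.
  rewrite invc_norm normc_def /= -h sqrtr1 expr1n invr1 mul1r.
  by apply/eqP; rewrite eq_complex /= subrr eqxx andbT; apply/eqP; ring.
Qed.

(** A root [rho] of [rho^2 - E rho + 1] or its inverse has modulus less than [1],
    or both have modulus [1] and [E] is real and in the interval from [-2] to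
    [2]. *)
Lemma joukowski (E : C) :
  (exists2 rho : C, normc rho < 1 & rho != 0 /\ E = rho + rho^-1) \/
  (exists2 e : R, -2 <= e <= 2 & E = e%:C%C).
Proof.
pose rho := (E + sqrtc (E ^+ 2 - 4)) / 2.
have e2 : (rho ^+ 2 - E * rho + 1) = 0.
  rewrite /rho.
  have -> : ((E + sqrtc (E ^+ 2 - 4)) / 2) ^+ 2 - E * ((E + sqrtc (E ^+ 2 - 4)) / 2) + 1 =
    (sqrtc (E ^+ 2 - 4) ^+ 2 - (E ^+ 2 - 4)) / 4 by field.
  by rewrite sqr_sqrtc subrr mul0r.
have rn0 : rho != 0.
  by apply: contra_eq_neq e2 => ->; rewrite expr0n mulr0 subrr add0r oner_neq0.
have eE : E = rho + rho^-1.
  apply: (mulIf rn0); rewrite mulrDl mulVf //.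
  by apply/eqP; rewrite -subr_eq0 -oppr_eq0 -e2; apply/eqP; ring.
have [h|h|h] := ltgtP (normc rho) 1.
- by left; exists rho.
- left; exists rho^-1; last by rewrite invr_eq0 invrK addrC.
  by rewrite Normc.normcV invf_lt1 // (lt_trans ltr01).
- right; have [e1 /andP[b1 b2]] := normc1_inv h.
  by exists (2 * complex.Re rho); [lra | rewrite eE e1].
Qed.

Lemma joukowski_real (e : R) : -2 <= e <= 2 ->
  exists2 rho : C, normc rho = 1 & e%:C%C = rho + rho^-1.
Proof.
move=> /andP[h1 h2].
have h : 0 <= 1 - (e / 2) ^+ 2 by nra.
pose rho : C := Complex (e / 2) (Num.sqrt (1 - (e / 2) ^+ 2)).
have h1' : normc rho = 1 by rewrite /= sqr_sqrtr // addrC subrK sqrtr1.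
exists rho => //; have [-> _] := normc1_inv h1'.
by rewrite /=; congr (_%:C)%C; field.
Qed.
End Joukowski.

Section Spectrum.
Variable R : realType.
Local Notation normc := Normc.normc.
Local Notation C := (R[i]).
Variable V : int -> R.
Variable q : nat.
Hypothesis q0 : (0 < q)%N.
Hypothesis Vq : forall n, V (n + q%:Z) = V n.
Variable bV : R.
Hypothesis Vb : forall n, `|V n| <= bV.
Local Notation H := (Hop V).
Local Notation hact := (hact V).
Local Notation discr := (discr V q).

Lemma discr_horner z :
  discr.[z] = \tr (transfer (fun i : nat => z - (V i%:Z)%:C%C) 1 q).
Proof.
rewrite -[LHS]/(horner_eval z discr) map_tr_transfer rmorph1; congr (\tr _).
by apply: eq_transfer => i _; rewrite /= /horner_eval hornerXsubC add0r.
Qed.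

Lemma bop_Hop : bop H.
Proof.
apply: (@bop_add _ (fun psi n => psi (n - 1) + psi (n + 1)) (fun psi n => (V n)%:C%C * psi n)).
  by apply: bop_add; apply: (@bop_shift _ _ id); exact: bop_id.
apply: (@bop_mul _ (fun n => (V n)%:C%C) bV id) => [n|]; last exact: bop_id.
by rewrite normc_real.
Qed.

Lemma bop_hact g : bop (hact g).
Proof.
apply: (@bop_sum _ _ (index_enum 'I_(size g))
  (fun i psi n => g`_i * iter i H psi n)) => i.
apply: (@bop_mul _ (fun=> g`_i) (normc g`_i) (iter i H)) => //.
elim: (nat_of_ord i) => [|k IH]; first exact: bop_id.
exact: (bop_comp bop_Hop IH).
Qed.

(** Factor [discr - discr(z)] as [Q * ('X - z)]; then [Q] applied to the inverse of
    [S^q + S^-q - discr(z)] inverts [H - z]. *)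
Lemma resolvent_out (z rho : C) : normc rho < 1 -> rho != 0 ->
  discr.[z] = rho + rho^-1 -> resolvent_set H z.
Proof.
move=> r1 rn0 ez.
have [Q eQ] : exists Q, discr - (discr.[z])%:P = Q * ('X - z%:P).
  by apply/factor_theorem; rewrite /root !hornerE subrr.
have act psi n : hact (Q * ('X - z%:P)) psi n =
    psi (n + q%:Z) + psi (n - q%:Z) - (rho + rho^-1) * psi n.
  by rewrite -eQ hactD hactN hactC discr_act // ez.
have [MQ MQ0 bQ] := bop_hact Q.
pose k := (1 - normc rho)^-1 ^+ 2.
have k0 : 0 <= k by rewrite exprn_ge0 // invr_ge0 subr_ge0 ltW.
pose M2 := MQ * (normc rho ^+ 2 * (k * k)).
have M20 : 0 <= M2.
  by apply: mulr_ge0 => //; apply: mulr_ge0; [exact: sqr_ge0|exact: mulr_ge0].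
apply: (@resolvent_bij _ H z (Num.sqrt M2)).
- exact: Hop_lin.
- exact: sqrtr_ge0.
- move=> psi s hs; have [phi [e1 b1]] := l2_trig_solve q%:Z r1 rn0 hs.
  have b t : l2b psi t -> l2b (hact Q phi) (Num.sqrt M2 ^+ 2 * t).
    by move=> /b1/bQ; rewrite sqr_sqrtr // /M2 /k !mulrA.
  exists (hact Q phi); first by apply/l2bP; eexists; exact: b hs.
  split=> //; apply/funext => n.
  by rewrite -e1 -act [Q * _]mulrC hactXsubC hact_Hop.
- move=> eta l2e e; apply: (@l2_trig_inj _ rho q%:Z) => // n.
  rewrite -act hactM.
  have -> : hact ('X - z%:P) eta = fun=> 0.
    by apply/funext => m; rewrite -(mulr1 ('X - _)) hactXsubC !hact1 e.
  have := hact_lin V Q (-1) eta eta.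
  have -> : (fun n => -1 * eta n + eta n) = fun=> 0.
    by apply/funext => m; rewrite mulN1r addNr.
  by move=> ->; rewrite mulN1r addNr.
- move=> psi l2p.
  have [M M0 bM] := bop_Hop; case/l2bP: (l2p) => s hs.
  have h := l2_lin (- z) l2p (bop_l2 bop_Hop l2p).
  by rewrite (_ : (fun n => _) = (fun n => - z * psi n + H psi n)) //;
    apply/funext => n; rewrite mulNr addrC.
Qed.

(** Floquet solutions: the multiplier [rho] is an eigenvalue of the matrix of a
    period. *)
Lemma bloch_solution (z rho : C) : rho != 0 -> discr.[z] = rho + rho^-1 ->
  exists psi : int -> C, [/\ exists n, psi n != 0, forall n, H psi n = z * psi n &
    forall n, psi (n + q%:Z) = rho * psi n].
Proof.
move=> rn0 ez.
pose x (i : nat) : C := z - (V i%:Z)%:C%C.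
have Vqn (i : nat) : V (i + q)%N = V i by rewrite PoszD Vq.
pose M := transfer x 1 q.
have trM : \tr M = rho + rho^-1 by rewrite -ez discr_horner.
have /det0P[v v0 vM] : \det (M^T - rho%:M) == 0.
  apply/eqP; rewrite det2 !mxE /= !mulr1n !mulr0n !subr0.
  have d1 : \det M = 1 by exact: transfer_det.
  rewrite det2 in d1; rewrite mxtrace2 in trM.
  have -> : (M 0 0 - rho) * (M 1 1 - rho) - M 1 0 * M 0 1 =
    (M 0 0 * M 1 1 - M 0 1 * M 1 0) - rho * (M 0 0 + M 1 1) + rho ^+ 2 by ring.
  by rewrite d1 trM; field.
(* the solution on the half-line, with [u k] at site [k - 1] *)
pose u := fix u n : C := if n is n'.+1 then
   (if n' is n''.+1 then x n'' * u n' - u n'' else v 0 0) else v 0 1.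
have uS k : u k.+2 = x k * u k.+1 - u k by [].
have [s1 s2] := transfer_sol uS q.
have eM j : M j 0 * v 0 0 + M j 1 * v 0 1 = rho * v 0 j.
  have /rowP/(_ j) := vM; rewrite !mxE big_ord_recl big_ord1.
  have -> : lift ord0 ord0 = 1 :> 'I_2 by apply/val_inj.
  rewrite !mxE => e; apply/eqP; rewrite -subr_eq0 -e.
  have E1 : (0 == 1 :> 'I_2) = false by [].
  have E2 : (1 == 0 :> 'I_2) = false by [].
  have E0 : @ord0 1 = 0 by [].
  have [-> | ->] : j = 0 \/ j = 1 :> 'I_2
    by case: (j) => [[|[|]]] // ?; [left|right]; apply/val_inj.
    by rewrite ?E0 ?eqxx ?E1 ?E2 /= ?mulr1n ?mulr0n; apply/eqP; ring.
  by rewrite ?E0 ?eqxx ?E1 ?E2 /= ?mulr1n ?mulr0n; apply/eqP; ring.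
have uq : forall k, u (k + q)%N = rho * u k /\ u (k.+1 + q)%N = rho * u k.+1.
  elim=> [|k [IH1 IH2]].
    by rewrite add0n add1n s1 s2 -!/M !eM.
  split=> //; rewrite !addSn !uS -!addSn IH1 IH2.
  by rewrite /x Vqn; ring.
have uqk k m : u (k + m * q)%N = rho ^+ m * u k.
  elim: m => [|m IH]; first by rewrite addn0 mul1r.
  by rewrite mulSn addnCA addnC (uq _).1 IH exprS mulrA.
(* extension to all sites: move right by enough periods *)
pose psi (n : int) : C := rho ^- (absz n) * u (absz (n + 1 + (absz n * q)%:Z)).
have psiE n k (j : nat) : n + 1 + (k * q)%:Z = j%:Z -> psi n = rho ^- k * u j.
  move=> ej; rewrite /psi.
  have [i ei] : exists i : nat, n + 1 + ((absz n) * q)%:Z = i%:Z.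
    have : 0 <= n + 1 + ((absz n) * q)%:Z by nia.
    by case: (n + 1 + _) => // i _; exists i.
  rewrite ei absz_nat.
  have ek m : rho ^+ m != 0 by rewrite expf_neq0.
  suff : rho ^+ k * u i = rho ^+ (absz n) * u j.
    move=> e; apply: (mulfI (ek k)); rewrite mulrCA e.
    by field; rewrite !ek.
  by rewrite -!uqk; congr u; nia.
exists psi; split.
- have [h|h] := eqVneq (v 0 0) 0; last first.
    by exists 0; rewrite (@psiE 0 0%N 1%N) // expr0 invr1 mul1r.
  have [h'|h'] := eqVneq (v 0 1) 0; last first.
    by exists (-1); rewrite (@psiE (-1) 0%N 0%N) // expr0 invr1 mul1r.
  case/eqP: v0; apply/rowP => j; rewrite mxE.
  have [-> | ->] // : j = 0 \/ j = 1 :> 'I_2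
    by case: (j) => [[|[|]]] // ?; [left|right]; apply/val_inj.
- move=> n; pose k := (absz n).
  have [j ej] : exists j : nat, n + (k * q)%:Z = j%:Z.
    have : 0 <= n + (k * q)%:Z by nia.
    by case: (n + _) => // i _; exists i.
  rewrite /Hop (@psiE n k j.+1) ?(@psiE (n - 1) k j) ?(@psiE (n + 1) k j.+2); try lia.
  rewrite uS /x.
  have -> : V j%:Z = V n.
    rewrite -ej; elim: (k) => [|m IH]; first by rewrite mul0n addr0.
    by rewrite mulSn addnC PoszD addrA Vq.
  ring.
- move=> n; pose k := (absz n).
  have [j ej] : exists j : nat, n + 1 + (k * q)%:Z = j%:Z.
    have : 0 <= n + 1 + (k * q)%:Z by nia.
    by case: (n + 1 + _) => // i _; exists i.
  rewrite (@psiE n k j) // (@psiE _ k (j + q)%N); last by lia.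
  by rewrite (uq _).1; ring.
Qed.

Section Bloch.
Variables (z rho : C) (psi : int -> C).
Hypothesis psi_nz : exists n, psi n != 0.
Hypothesis psi_eq : forall n, H psi n = z * psi n.
Hypothesis psi_q : forall n, psi (n + q%:Z) = rho * psi n.
Hypothesis rho1 : normc rho = 1.

Let norm_per n : normc (psi (n + q%:Z)) = normc (psi n).
Proof. by rewrite psi_q Normc.normcM rho1 mul1r. Qed.

Let norm_perk n k : normc (psi (n + (k * q)%:Z)) = normc (psi n).
Proof.
elim: k => [|k IH]; first by rewrite mul0n addr0.
by rewrite mulSn addnC PoszD addrA norm_per.
Qed.

(** The squared norm over one period. *)
Let s := \sum_(0 <= n < q) normc (psi n%:Z) ^+ 2.

Let s_gt0 : 0 < s.
Proof.
have s0 : 0 <= s by apply: sumr_ge0 => i _; exact: sqr_ge0.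
rewrite lt_def s0 andbT; apply/negP => /eqP e.
have [n /negP[]] := psi_nz; rewrite -normc_eq0 -sqrf_eq0.
have [m [k [mq em]]] : exists m k : nat, (m < q)%N /\
   (n + (k * q)%:Z = m%:Z \/ n = m%:Z + (k * q)%:Z).
  have q0' : q%:Z != 0 by lia.
  exists (absz (n %% q)%Z), (absz (n %/ q)%Z).
  have h1 := divz_eq n q%:Z; have h2 := modz_ge0 n q0'; have h3 := ltz_mod n q0'.
  split; first by lia.
  by have [h|h] := lerP 0 (n %/ q)%Z; [right|left]; nia.
have -> : normc (psi n) = normc (psi m%:Z).
  by case: em => [<-|->]; rewrite norm_perk.
move: e; rewrite /s big_mkord => /eqP; rewrite psumr_eq0 => [|i _]; last exact: sqr_ge0.
by move=> /allP/(_ (Ordinal mq)); rewrite mem_index_enum => /(_ isT).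
Qed.

(** The Wronskian [w] of [psi] with its conjugate is periodic, and its increments
    are [Im z * |psi n|^2]. *)
Lemma bloch_real : complex.Im z = 0.
Proof.
pose w n := complex.Im ((psi n)^*%C * psi (n + 1)).
have wq n : w (n + q%:Z) = w n.
  rewrite /w addrAC !psi_q rmorphM mulrACA.
  have -> : rho^*%C * rho = 1.
    rewrite mulrC -sqr_normc normc_def -normc_sq.
    by rewrite sqrtr_sqr ger0_norm ?normc_ge0 // rho1 expr1n.
  by rewrite mul1r.
have e n : complex.Im z * normc (psi n) ^+ 2 = w n - w (n - 1).
  have := congr1 (fun x => complex.Im ((psi n)^*%C * x)) (psi_eq n).
  rewrite normc_sq /w subrK /Hop.
  case: (psi n) (psi (n - 1)) (psi (n + 1)) (z) => a b [a1 b1] [a2 b2] [zr zi] /=.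
  by move=> h; nra.
have : complex.Im z * s = w ((q.-1)%:Z) - w (-1).
  rewrite /s mulr_sumr.
  under eq_bigr do rewrite e.
  rewrite (_ : w (q.-1)%:Z = w (q%:Z - 1)); last by congr w; lia.
  elim: (q) => [|k IH]; first by rewrite big_geq // sub0r subrr.
  by rewrite big_nat_recr //= IH (_ : k.+1%:Z - 1 = k%:Z); [ring|lia].
rewrite (_ : (q.-1)%:Z = -1 + q%:Z); last by lia.
rewrite wq subrr => /eqP; rewrite mulf_eq0 (gt_eqF s_gt0) orbF => /eqP //.
Qed.

(** If [H - z] had a bounded inverse, the cut-off of [psi] to [N] periods, of
    squared norm [N * s], would be bounded uniformly in [N], because its image under
    [H - z] is supported at four boundary sites. *)
Lemma bloch_spectrum : ~ resolvent_set H z.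
Proof.
move=> [B [[Bl2 _ [M0 hM0]] hB]].
pose M := Num.max M0 0.
have M_ge0 : 0 <= M by rewrite le_max lexx orbT.
have b_ex : exists2 b, 0 <= b & forall n, normc (psi n) <= b.
  exists (Num.sqrt s); first exact: sqrtr_ge0.
  move=> n; rewrite -[X in X <= _]ger0_norm ?normc_ge0 // -sqrtr_sqr ler_wsqrtr //.
  have q0' : q%:Z != 0 by lia.
  have [m [k [mq em]]] : exists m k : nat, (m < q)%N /\
     (n + (k * q)%:Z = m%:Z \/ n = m%:Z + (k * q)%:Z).
    exists (absz (n %% q)%Z), (absz (n %/ q)%Z).
    have h1 := divz_eq n q%:Z; have h2 := modz_ge0 n q0'; have h3 := ltz_mod n q0'.
    split; first by lia.
    by have [h|h] := lerP 0 (n %/ q)%Z; [right|left]; nia.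
  have -> : normc (psi n) = normc (psi m%:Z).
    by case: em => [<-|->]; rewrite norm_perk.
  rewrite /s big_mkord (bigD1 (Ordinal mq)) //= lerDl.
  by apply: sumr_ge0 => i _; exact: sqr_ge0.
have [b b0 hb] := b_ex.
have key N : N%:R * s <= M ^+ 2 * (4%:R * (2 * b) ^+ 2).
  pose L := (N * q)%N.
  pose inL (n : int) := (0 <= n) && (n < L%:Z).
  pose phi (n : int) : C := if inL n then psi n else 0.
  pose f n := H phi n - z * phi n.
  have nN : normc (0 : C) = 0 by exact: Normc.normc0.
  have phib n : normc (phi n) <= if n \in [seq i%:Z | i <- iota 0 L] then b else 0.
    rewrite /phi; case: ifP => h; last by rewrite nN; case: ifP.
    case: ifP => [_|/negP[]]; first exact: hb.
    apply/mapP; exists (absz n).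
      by rewrite mem_iota /= add0n; move: h; rewrite /inL; lia.
    by move: h; rewrite /inL; lia.
  have l2phi : l2 phi by apply/l2bP; eexists; exact: l2b_fin phib.
  pose d n k := phi k - (if inL n then psi k else 0).
  have fd n : f n = d n (n - 1) + d n (n + 1).
    rewrite /f /d /Hop [phi n]/phi; case: ifP => _; last by ring.
    have <- := psi_eq n; rewrite /Hop; ring.
  have db n k : normc (d n k) <= if inL n == inL k then 0 else b.
    rewrite /d /phi; case: (inL n); case: (inL k);
      rewrite ?subrr ?subr0 ?sub0r ?normcN ?nN; by [exact: hb|exact: lexx].
  have fb n : normc (f n) <= if n \in [:: -1; 0; L%:Z - 1; L%:Z] then 2 * b else 0.
    rewrite fd; apply: le_trans (le_normcD _ _) _.
    have := db n (n - 1); have := db n (n + 1).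
    case: ifP => h1; case: ifP => h2; case: ifP => h3; try lra.
      by move/negP: h3 => []; move/eqP: h1; move/eqP: h2; rewrite !inE /inL; lia.
      by move/negP: h3 => []; move/eqP: h1; move/eqP: h2; rewrite !inE /inL; lia.
    by move/negP: h3 => []; move/eqP: h1; move/eqP: h2; rewrite !inE /inL; lia.
  have l2f := l2b_fin fb.
  have [Bf _] := hB _ l2phi.
  have l2f' : l2 f by apply/l2bP; eexists; exact: l2f.
  have := @l2b_of_norm_le _ M f phi M_ge0 _ _ l2f.
  have -> : (l2norm phi <= M%:E * l2norm f)%E.
    rewrite -[in X in (X <= _)%E]Bf; apply: le_trans (hM0 _ l2f') _.
    by rewrite lee_wpmul2r ?lee_fin ?le_max ?lexx // sqrte_ge0.
  move=> /(_ isT [seq i%:Z | i <- iota 0 L]);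
    rewrite map_inj_uniq ?iota_uniq; last by move=> ? ? [].
  move=> /(_ isT); apply: le_trans.
  rewrite big_map (eq_big_seq (fun i : nat => normc (psi i%:Z) ^+ 2)); last first.
    move=> i; rewrite mem_iota add0n => hi; rewrite /phi.
    by have -> : inL i%:Z by rewrite /inL; lia.
  rewrite /L; have -> : iota 0 (N * q) = index_iota 0 (N * q) by rewrite /index_iota subn0.
  elim: (N) => [|n IH]; first by rewrite mul0r mul0n big_geq.
  rewrite mulSn addnC (@big_cat_nat _ _ _ (n * q)) ?leq_addr //=.
  rewrite -addn1 natrD mulrDl mul1r lerD // -{1}[(n * q)%N]add0n big_addn addKn.
  rewrite /s le_eqVlt; apply/orP; left; apply/eqP; apply: eq_bigr => i _.
  by rewrite PoszD norm_perk.
set K := M ^+ 2 * _ in key.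
have K0 : 0 <= K / s by rewrite divr_ge0 ?(ltW s_gt0) // !mulr_ge0 ?sqr_ge0.
by have := archi_boundP K0; rewrite ltr_pdivrMr // ltNge key.
Qed.
End Bloch.
End Spectrum.

(** * The union of the spectra as a polynomial preimage *)

Section Cis.
Variable R : realType.
Local Notation C := (R[i]).
Implicit Types s t : R.

(** The point of angle [t] on the unit circle. *)
Definition cis t : C := Complex (cos t) (sin t).

Lemma cisD s t : cis (s + t) = cis s * cis t.
Proof. by apply/eqP; rewrite eq_complex /= cosD sinD [cos s * sin t + _]addrC !eqxx. Qed.

Lemma cis0 : cis 0 = 1.
Proof. by rewrite /cis cos0 sin0. Qed.

Lemma cisX t n : cis t ^+ n = cis (t * n%:R).
Proof.
elim: n => [|n IH]; first by rewrite mulr0 cis0.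
by rewrite exprS IH -cisD -natr1; congr cis; ring.
Qed.

Lemma cis_neq0 t : cis t != 0.
Proof.
rewrite eq_complex /=; apply/negP => /andP[/eqP h1 /eqP h2].
by have := cos2Dsin2 t; rewrite h1 h2 expr0n addr0 => /eqP; rewrite eq_sym oner_eq0.
Qed.

Lemma cisV t : (cis t)^-1 = cis (- t).
Proof.
apply: (mulfI (cis_neq0 t)); rewrite mulfV ?cis_neq0 // -cisD subrr cis0 //.
Qed.

Lemma cisDV t : cis t + (cis t)^-1 = (2 * cos t)%:C%C.
Proof.
rewrite cisV; apply/eqP; rewrite eq_complex /= cosN sinN subrr eqxx andbT.
by apply/eqP; ring.
Qed.

Lemma cos_periodz t (m : int) : cos (t + 2 * pi * m%:~R) = cos t.
Proof.
have hn s (n : nat) : cos (s + 2 * pi * n%:R) = cos s.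
  rewrite -(periodicn (@cosD2pi R) n s); congr cos.
  by rewrite -[_ *+ n]mulr_natr -[pi *+ 2]mulr_natr; ring.
case: m => n; first exact: hn.
by rewrite NegzE mulrNz -[LHS](hn _ n.+1) mulrN subrK.
Qed.

Lemma cis_periodz t (m : int) : cis (t + 2 * pi * m%:~R) = cis t.
Proof.
rewrite /cis cos_periodz; congr Complex.
rewrite -[t]opprK -[_ + _](subrK (pi / 2)) sinDpihalf -[in RHS](subrK (pi/2) (- - t)) sinDpihalf.
by rewrite -(cos_periodz (- - t - pi / 2) m); congr cos; ring.
Qed.

Lemma cis_eq1_dvd (m : int) (q : nat) : (0 < q)%N ->
  cis (2 * pi * (m%:~R / q%:R)) = 1 :> C -> (q %| m)%Z.
Proof.
move=> q0 h; have q0' : q%:Z != 0 by lia.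
have q0R : (q%:R : R) != 0 by rewrite pnatr_eq0; lia.
pose r := (m %% q)%Z; have r_ge0 : 0 <= r := modz_ge0 m q0'.
have r_lt : r < q%:Z by have := ltz_mod m q0'; rewrite -/r; lia.
have em : m%:~R = ((m %/ q)%Z)%:~R * q%:R + r%:~R :> R.
  by rewrite {1}(divz_eq m q) rmorphD rmorphM.
have : cis (2 * pi * (r%:~R / q%:R)) = 1 :> C.
  rewrite -h -(cis_periodz _ (m %/ q)%Z) em; congr cis; field; exact: q0R.
move=> /(congr1 (@complex.Re R)) /= c1.
have [r0|rp] := leP r 0.
  by rewrite /dvdz; have := divz_eq m q; rewrite -/r => e; apply/dvdz_mod0P; lia.
exfalso.
have s0 : 0 < sin (pi * (r%:~R / q%:R) : R).
  apply: sin_gt0_pi; have p0 := pi_gt0 R.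
  have q1 : 0 < (q%:R : R) by rewrite ltr0n.
  have r1 : 0 < (r%:~R : R) by rewrite ltr0z.
  have r2 : (r%:~R : R) < q%:R by rewrite -[q%:R]/((q%:Z)%:~R) ltr_int.
  rewrite mulr_gt0 ?divr_gt0 //=.
  by rewrite -[X in _ < X]mulr1 ltr_pM2l // ltr_pdivrMr // mul1r.
move: c1; rewrite (_ : 2 * pi * _ = (pi * (r%:~R / q%:R)) *+ 2); last by rewrite mulr2n; ring.
rewrite cos_mulr2n cos2sin2 mulr2n => c1.
have : 0 < sin (pi * (r%:~R / q%:R) : R) ^+ 2 by rewrite exprn_gt0.
by move: c1; lra.
Qed.

Lemma cis_primitive (p : int) (q : nat) : (0 < q)%N -> coprimez p q%:Z ->
  q.-primitive_root (cis (2 * pi * (p%:~R / q%:R)) : C).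
Proof.
move=> q0 cop; have q0R : (q%:R : R) != 0 by rewrite pnatr_eq0; lia.
apply/andP; split=> //; apply/forallP => i; apply/eqP.
rewrite unity_rootE cisX; apply/eqP/eqP => [h|ei].
  have : (q %| p * i.+1%:Z)%Z.
    apply: cis_eq1_dvd => //; rewrite -h; congr cis.
    by rewrite rmorphM /= -[i.+1%:~R]/(i.+1%:R); field.
  rewrite Gauss_dvdzr; last by rewrite coprimez_sym.
  by rewrite /dvdz /= => /dvdn_leq -/(_ isT); have := ltn_ord i; lia.
rewrite ei -cis0 -(cis_periodz 0 p); congr cis; field; exact: q0R.
Qed.
End Cis.

Section SPlus.
Variable R : realType.
Local Notation C := (R[i]).
Local Notation normc := Normc.normc.
Variables (lam : R) (p : int) (q : nat).
Hypothesis q0 : (0 < q)%N.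
Hypothesis cop : coprimez p q%:Z.
Let al : R := p%:~R / q%:R.
Let V (th : R) (n : int) : R := almost_mathieu_potential lam (al * n%:~R + th).
Let q0R : (q%:R : R) != 0. Proof. by rewrite pnatr_eq0; lia. Qed.

Let Vq th n : V th (n + q%:Z) = V th n.
Proof.
rewrite /V /almost_mathieu_potential -[in RHS](cos_periodz _ p).
congr (_ * cos _); rewrite /al rmorphD /=; field; exact: q0R.
Qed.

Let Vb th n : `|V th n| <= 2 * `|lam|.
Proof.
rewrite /V /almost_mathieu_potential normrM -[X in _ <= X]mulr1 ler_pM ?cos_max //.
by rewrite normrM ger0_norm.
Qed.

(** Only the constant term of the discriminant depends on the phase. *)
Lemma discr_chambers : exists2 kappa : R, `|kappa| = 2 * `|lam| ^+ q &
  exists D : {poly R}, [/\ D \is monic, size D = q.+1 &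
  forall th z, (discr (V th) q).[z] = (map_poly (real_complex R) D).[z] +
    (kappa * cos (2 * pi * (q%:R * th)))%:C%C].
Proof.
pose zeta := cis (2 * pi * al).
have prim : q.-primitive_root zeta by exact: cis_primitive.
have /eqP := prim_prod_sq prim; rewrite sqrf_eq1 => eta1.
have [eta [eta2 etaE]] : exists eta : R, `|eta| = 1 /\ \prod_(n < q) zeta ^+ n = eta%:C%C.
  case/orP: eta1 => /eqP ->; [exists 1|exists (-1)]; rewrite ?normrN normr1; split=> //.
  by rewrite rmorphN rmorph1.
pose k := (- lam) ^+ q * eta.
pose T := \tr (transfer (fun i : nat => 'X - (V 0 i%:Z)%:P) 1 q).
exists (2 * k).
  by rewrite /k !normrM eta2 mulr1 normrX normrN ger0_norm.
have [sT mT] : size T = q.+1 /\ T \is monic by exact: discriminant_monic.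
exists (T - (2 * k)%:P).
have lt1 : (size (- (2 * k)%:P : {poly R}) < size T)%N.
  by rewrite sT size_polyN; apply: leq_ltn_trans (size_polyC_leq1 _) _.
split.
- by rewrite monicE lead_coefDl // -monicE.
- by rewrite size_polyDl.
move=> th z.
have [d hd] := chambers_alg z (lam%:C)%C prim.
have ch t : (discr (V t) q).[z] = d + (2 * k * cos (2 * pi * (q%:R * t)))%:C%C.
  rewrite discr_horner //.
  have := hd (cis (2 * pi * t)) (cis_neq0 _); rewrite etaE => e.
  transitivity (\tr (transfer (fun n => z - lam%:C%C * (cis (2 * pi * t) * zeta ^+ n +
      (cis (2 * pi * t) * zeta ^+ n)^-1)) 1 q)).
    congr (\tr _); apply: eq_transfer => n _; congr (_ - _).
    rewrite /zeta cisX -cisD cisDV -rmorphM; congr (_%:C)%C.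
    rewrite /V /almost_mathieu_potential [RHS]mulrCA mulrA; congr (_ * cos _).
    by rewrite -[n%:~R]/(n%:R : R); ring.
  rewrite e; congr (_ + _).
  rewrite cisX cisDV -rmorphN -rmorphXn -!rmorphM; congr (_%:C)%C.
  rewrite /k (_ : 2 * pi * t * q%:R = 2 * pi * (q%:R * t)); last by ring.
  ring.
have e0 : (map_poly (real_complex R) T).[z] = (discr (V 0) q).[z].
  congr (_.[_]); rewrite /T map_tr_transfer rmorph1 /discr; congr (\tr _).
  by apply: eq_transfer => i _; rewrite /= rmorphB /= map_polyX map_polyC /= add0r.
rewrite rmorphB /= map_polyC /= hornerD hornerN hornerC e0 !ch mulr0 mulr0 cos0 mulr1.
ring.
Qed.

(** [S_plus] is the preimage of an interval by a real monic polynomial of degree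
    [q], all of whose preimages of that interval are real. *)
Lemma S_plus_preimage : exists D : {poly R}, [/\ D \is monic, size D = q.+1,
  forall (x : R) z, `|x| <= 2 * (1 + `|lam| ^+ q) ->
     (map_poly (real_complex R) D).[z] = x%:C%C -> complex.Im z = 0 &
  S_plus (almost_mathieu_potential lam) al = [set z | exists2 x : R,
     `|x| <= 2 * (1 + `|lam| ^+ q) & (map_poly (real_complex R) D).[z] = x%:C%C]].
Proof.
have [kappa k1 [D [mD sD hD]]] := discr_chambers.
exists D.
have bloch (x : R) z : `|x| <= 2 * (1 + `|lam| ^+ q) ->
    (map_poly (real_complex R) D).[z] = x%:C%C ->
    exists th rho psi, [/\ exists n, psi n != 0, forall n, Hop (V th) psi n = z * psi n,
      forall n, psi (n + q%:Z) = rho * psi n & normc rho = 1].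
  move=> hx ex; pose u := x / (2 * (1 + `|lam| ^+ q)).
  have c0 : 0 < 2 * (1 + `|lam| ^+ q) by rewrite mulr_gt0 // ltr_pwDl // exprn_ge0.
  have u1 : `|u| <= 1.
    by rewrite /u normrM normfV (gtr0_norm c0) ler_pdivrMr // mul1r.
  (* the phase is chosen so that the discriminant is [2 * u] *)
  pose t := - u * Num.sg kappa.
  have t1 : `|t| <= 1.
    rewrite /t normrM normrN normr_sg; case: (kappa == 0); rewrite ?mulr0 // mulr1 //.
  have P0 : 2 * pi * q%:R != 0 :> R.
    by rewrite mulf_neq0 // mulf_neq0 // gt_eqF // pi_gt0.
  pose th := acos t * (2 * pi * q%:R)^-1.
  have cth : cos (2 * pi * (q%:R * th)) = t.
    have -> : 2 * pi * (q%:R * th) = acos t * (2 * pi * q%:R / (2 * pi * q%:R)).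
      by rewrite /th; ring.
    by rewrite mulfV // mulr1 acosK // in_itv /= -ler_norml.
  have eth : (discr (V th) q).[z] = (2 * u)%:C%C.
    rewrite hD ex cth -rmorphD; congr (_%:C)%C.
    rewrite (_ : kappa * t = - u * (Num.sg kappa * kappa)); last by rewrite /t; ring.
    rewrite -normrEsg k1 (_ : x = u * (2 * (1 + `|lam| ^+ q))); first by ring.
    by rewrite /u divfK // gt_eqF.
  have [|rho r1 er] := @joukowski_real R (2 * u).
    by move: u1; rewrite ler_norml => /andP[? ?]; lra.
  have rn0 : rho != 0 by rewrite -normc_eq0 r1 oner_neq0.
  have [psi [h1 h2 h3]] := bloch_solution q0 (Vq th) rn0 (etrans eth er).
  by exists th, rho, psi.
split=> //.
- move=> x z hx ex; have [th [rho [psi [h1 h2 h3 h4]]]] := bloch x z hx ex.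
  exact: (bloch_real q0 h1 h2 h3 h4).
- apply/seteqP; split=> z /=.
    move=> [th _]; rewrite /spectrum /= => hres.
    case: (joukowski (discr (V th) q).[z]) => [[rho r1 [rn0 er]]|[e he ee]].
      by exfalso; apply: hres; apply: (resolvent_out q0 (Vq th) (Vb th) r1 rn0 er).
    exists (e - kappa * cos (2 * pi * (q%:R * th))).
      apply: le_trans (ler_normB _ _) _.
      rewrite (_ : 2 * (1 + `|lam| ^+ q) = 2 + 2 * `|lam| ^+ q) ?lerD //; last by ring.
        by rewrite ler_norml.
      rewrite normrM k1 -[X in _ <= X]mulr1 ler_wpM2l ?cos_max //.
    by rewrite rmorphB /= -ee hD addrK.
  move=> [x hx ex]; have [th [rho [psi [h1 h2 h3 h4]]]] := bloch x z hx ex.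
  exists th => //; rewrite /spectrum /=.
  exact: (bloch_spectrum q0 h1 h2 h3 h4).
Qed.
End SPlus.

(** * Topology and measurability on the complex plane *)

Section ComplexTopology.
Variable R : realType.
Local Notation C := (R[i]).
Local Notation normc := Normc.normc.

Lemma normC_normc (z : C) : `|z| = (normc z)%:C%C.
Proof. by rewrite normc_def; case: z. Qed.

Lemma openCP (U : set (C^o)) : open U <->
  forall z, U z -> exists2 r : R, 0 < r & forall w, normc (z - w) < r -> U w.
Proof.
split=> [oU z Uz|h].
  have : nbhs z U by apply: open_nbhs_nbhs.
  move=> /nbhs_ballP[e /= e0 he].
  have eR : e \is Num.real by rewrite realE ltW.
  exists (complex.Re e).
    by move: e0; rewrite ltcE /= => /andP[].
  move=> w hw; apply: he; rewrite /ball /= normC_normc -(RRe_real eR) ltcR //.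
rewrite openE => z /h[r r0 hr]; apply/nbhs_ballP.
exists r%:C%C; first by rewrite /= ltcR.
by move=> w; rewrite /ball /= normC_normc ltcR; exact: hr.
Qed.

Lemma continuous_real_complex : continuous (fun x : R => x%:C%C : C^o).
Proof.
apply/continuousP => U /openCP oU; rewrite openE => x /= /oU[r r0 hr].
apply/nbhs_ballP; exists r => // y; rewrite /ball /= => hy; apply: hr.
by rewrite -rmorphB normc_real.
Qed.

Lemma continuous_Re : continuous (fun z : C^o => complex.Re z : R).
Proof.
apply/continuousP => U; rewrite openE => oU; apply/openCP => z /= /oU /nbhs_ballP[r /= r0 hr].
exists r => // w hw; apply: hr; rewrite /ball /=.
by apply: le_lt_trans hw; have := Re_le_normc (z - w); case: (z) (w) => ? ? [].
Qed.

Lemma continuous_Im : continuous (fun z : C^o => complex.Im z : R).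
Proof.
apply/continuousP => U; rewrite openE => oU; apply/openCP => z /= /oU /nbhs_ballP[r /= r0 hr].
exists r => // w hw; apply: hr; rewrite /ball /=.
by apply: le_lt_trans hw; have := Im_le_normc (z - w); case: (z) (w) => ? ? [].
Qed.

Lemma open_measurableC (U : set (C^o)) : open U -> measurable (U : set (borelC R)).
Proof. by move=> oU; apply: sub_sigma_algebra. Qed.

Lemma closed_measurableC (U : set (C^o)) : closed U -> measurable (U : set (borelC R)).
Proof.
by move=> cU; rewrite -[U]setCK; apply: measurableC; apply: open_measurableC; exact: closed_openC.
Qed.

Lemma continuous_measurableC (f : C^o -> R) :
  continuous f -> measurable_fun [set: borelC R] (f : borelC R -> R).
Proof.
move=> /continuousP cf.
apply: (measurability _ (RGenOInfty.measurableE R)).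
move=> _ [_ [x ->] <-]; rewrite setTI.
apply: open_measurableC; apply: cf; exact: interval_open.
Qed.

Lemma measurable_ReC : measurable_fun [set: borelC R] (@complex.Re R : borelC R -> R).
Proof. apply: continuous_measurableC; exact: continuous_Re. Qed.

Lemma measurable_ImC : measurable_fun [set: borelC R] (@complex.Im R : borelC R -> R).
Proof. apply: continuous_measurableC; exact: continuous_Im. Qed.

Lemma measurable_real_complex :
  measurable_fun [set: R] (fun x : R => x%:C%C : borelC R).
Proof.
apply: (@measurability _ _ _ (borelC R) _ _ (@open (C^o))) => //.
move=> _ [U oU <-]; rewrite setTI; apply: open_measurable.
by have /continuousP := continuous_real_complex; apply.
Qed.

Lemma measurable_dist d (T : measurableType d) (f g : T -> borelC R) :
  measurable_fun setT f -> measurable_fun setT g ->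
  measurable_fun setT (fun t => normc (f t - g t)).
Proof.
move=> mf mg.
have e t : normc (f t - g t) = Num.sqrt ((complex.Re (f t) - complex.Re (g t)) ^+ 2 +
   (complex.Im (f t) - complex.Im (g t)) ^+ 2).
  by case: (f t) (g t) => a b [].
rewrite (funext e).
apply: (measurableT_comp (continuous_measurable_fun (@sqrt_continuous R))).
apply: measurable_funD; apply: measurable_funX; apply: measurable_funB.
- exact: (measurableT_comp measurable_ReC).
- exact: (measurableT_comp measurable_ReC).
- exact: (measurableT_comp measurable_ImC).
- exact: (measurableT_comp measurable_ImC).
Qed.

(** The logarithmic kernel as a function of the distance. *)
Definition kern (t : R) : \bar R := lne ((t%:E)^-1)%E.

Lemma kern0 : kern 0 = +oo%E.
Proof. by rewrite /kern inve0. Qed.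

Lemma kern_pos t : 0 < t -> kern t = (- ln t)%:E.
Proof.
by move=> t0; rewrite /kern inver gt_eqF // lne_EFin ?invr_gt0 // lnV.
Qed.

Lemma kern_neg t : t < 0 -> kern t = -oo%E.
Proof. by move=> t0; rewrite /kern inver lt_eqF //= invr_le0 ltW. Qed.

Lemma measurable_kern : measurable_fun [set: R] kern.
Proof.
rewrite (_ : kern = fun t => if 0 < t then (- ln t)%:E else if t < 0 then -oo%E else +oo%E).
  apply: measurable_fun_ifT.
  - exact: measurable_fun_ltr.
  - apply/measurable_EFinP; apply: measurableT_comp => //; exact: measurable_ln.
  - by apply: measurable_fun_ifT => //; exact: measurable_fun_ltr.
apply/funext => t; have [t0|t0|->] := ltgtP t 0.
- exact: kern_neg.
- exact: kern_pos.
- exact: kern0.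
Qed.

Lemma measurable_log_kernel d (T : measurableType d) (f g : T -> borelC R) :
  measurable_fun setT f -> measurable_fun setT g ->
  measurable_fun setT (fun t => log_kernel (f t) (g t)).
Proof.
by move=> mf mg; apply: (measurableT_comp measurable_kern); exact: measurable_dist.
Qed.

(** A measure is carried by its support: countably many discs of measure zero,
    with rational centres and radii [1/n], cover the complement. *)
Lemma measure_support_negligible (mu : probability (borelC R) R) :
  mu.-negligible (~` measure_support mu : set (borelC R)).
Proof.
pose B (t : rat * rat * nat) : set (borelC R) :=
  [set w | normc (Complex (ratr t.1.1) (ratr t.1.2) - w) < t.2.+1%:R^-1].
have oB t : open (B t : set (C^o)).
  apply/openCP => z; rewrite /B /= => hz.
  exists (t.2.+1%:R^-1 - normc (Complex (ratr t.1.1) (ratr t.1.2) - z)).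
    by rewrite subr_gt0.
  move=> w; rewrite ltrBrDl; apply: le_lt_trans.
  by rewrite -[X in normc X <= _](_ : (Complex (ratr t.1.1) (ratr t.1.2) - z) + (z - w) = _);
     [exact: le_normcD|ring].
pose F n : set (borelC R) := if unpickle n is Some t then
  (if mu (B t) == 0%E then B t else set0) else set0.
have nF n : mu.-negligible (F n).
  rewrite /F; case: unpickle => [t|]; last exact: negligible_set0.
  case: eqP => [e|_]; last exact: negligible_set0.
  by exists (B t); split=> //; apply: open_measurableC; exact: oB.
apply: negligibleS (negligible_bigcup nF) => z /=.
rewrite /measure_support /= => /existsNP[U /not_implyP[oU /not_implyP[Uz nU]]].
have U0 : mu U = 0%E.
  by apply/eqP; rewrite -measure_le0 leNgt; apply/negP.
have /openCP := oU => /(_ z Uz)[r r0 hr].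
pose n := Num.bound (2 / r).
pose e : R := n.+1%:R^-1.
have e0 : 0 < e by rewrite invr_gt0.
have er : 2 * e < r.
  have : 2 / r < n.+1%:R.
    by apply: lt_trans (archi_boundP _) _; rewrite ?ltr_nat // divr_ge0 // ltW.
  by rewrite /e ltr_pdivrMr // ltr_pdivrMr // mulrC.
have lt_e (x : R) : x - e / 2 < x + e / 2 by lra.
have [a] := rat_in_itvoo (lt_e (complex.Re z)).
rewrite in_itv /= => /andP[a1 a2].
have [b] := rat_in_itvoo (lt_e (complex.Im z)).
rewrite in_itv /= => /andP[b1 b2].
have nab : normc (Complex (ratr a) (ratr b) - z) < e.
  rewrite -(@ltr_pXn2r _ 2) ?nnegrE ?normc_ge0 ?ltW // normc_sq.
  have sq (x : R) : - (e / 2) < x < e / 2 -> x ^+ 2 < e ^+ 2 / 4.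
    move=> h; have : `|x| < e / 2 by rewrite ltr_norml.
    move=> h'; rewrite -real_normK ?num_real //.
    rewrite (_ : e ^+ 2 / 4 = (e / 2) ^+ 2); last by field.
    by rewrite ltr_pXn2r ?nnegrE // ltW // divr_gt0.
  have h1 : (ratr a - complex.Re z) ^+ 2 < e ^+ 2 / 4 by apply: sq; apply/andP; split; lra.
  have h2 : (ratr b - complex.Im z) ^+ 2 < e ^+ 2 / 4 by apply: sq; apply/andP; split; lra.
  have e2 : 0 < e ^+ 2 by rewrite exprn_gt0.
  by move: h1 h2; case: (z) => x y /= h1 h2; lra.
have [k ek] : exists k, @unpickle (rat * rat * nat)%type k = Some (a, b, n).
  by eexists; exact: pickleK.
exists k; first by [].
rewrite /F ek; case: eqP => [_|[]]; first exact: nab.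
apply/eqP; rewrite -measure_le0 -U0; apply: le_measure; rewrite ?inE.
- by apply: open_measurableC; exact: oB.
- exact: open_measurableC.
- move=> w; rewrite /B /= => hw; apply: hr; apply: le_lt_trans er.
  rewrite (_ : z - w = - (Complex (ratr a) (ratr b) - z) + (Complex (ratr a) (ratr b) - w));
    last by ring.
  apply: le_trans (le_normcD _ _) _; rewrite normcN.
  by have := hw; rewrite -/e; move: nab => h1 h2; rewrite mulr_natl mulr2n lerD // ltW.
Qed.

End ComplexTopology.

(** * Shifted logarithmic energies *)

Section Shift.
Context d (T : measurableType d) (R : realType).
Variable mu : probability T R.
Variable E : set T.
Hypothesis mE : measurable E.
Hypothesis muE : mu (~` E) = 0%E.
Local Open Scope ereal_scope.

Lemma mass1 : mu E = 1.
Proof.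
have := probability_setC mu mE; rewrite muE => /esym.
have : mu E \is a fin_num by rewrite fin_num_measure.
by case: (mu E) => [r| |] // _ /eqP; rewrite -EFinB eqe subr_eq0 => /eqP <-.
Qed.

(** Here and below [E] is a set of full measure. *)
Lemma ge0_integral_carrier (f : T -> \bar R) : measurable_fun setT f ->
  (forall x, 0 <= f x) -> \int[mu]_x f x = \int[mu]_(x in E) f x.
Proof.
move=> mf f0; rewrite (@ge0_negligible_integral _ _ _ mu setT (~` E)) //.
  by rewrite setTD setCK.
exact: measurableC.
Qed.

(** A function bounded below by [- M] on [E] is integrated through its nonnegative
    shift, even if the integral is infinite. *)
Lemma integral_shift (f : T -> \bar R) (M : R) : measurable_fun setT f -> (0 <= M)%R ->
  (forall x, E x -> 0 <= f x + M%:E) ->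
  \int[mu]_x f x + M%:E = \int[mu]_(x in E) (f x + M%:E).
Proof.
move=> mf M0 fM; rewrite integralE.
have mp := measurable_funepos mf; have mn := measurable_funeneg mf.
rewrite !ge0_integral_carrier //.
have mpE := measurable_funTS (D := E) mp; have mnE := measurable_funTS (D := E) mn.
have mfE := measurable_funTS (D := E) mf.
have intM : \int[mu]_(x in E) M%:E = M%:E.
  by rewrite integral_cst // -[RHS]mule1; congr (_ * _); exact: mass1.
have e1 : \int[mu]_(x in E) (f x + M%:E) + \int[mu]_(x in E) f^\- x =
   \int[mu]_(x in E) f^\+ x + M%:E.
  rewrite -[in RHS]intM -!ge0_integralD //.
  - apply: eq_integral => x /[!inE] Ex.
    rewrite funeposE funenegE; have := fM _ Ex; case: (f x) => [r| |] //= h; last first.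
      by rewrite max_r ?leNye // max_l ?leey // adde0.
    rewrite -!EFin_max -!EFinD; congr (_%:E).
    by case: (leP r 0%R); case: (leP (- r)%R 0%R) => ? ?; lra.
  - by apply: emeasurable_funD.
have fin : \int[mu]_(x in E) f^\- x \is a fin_num.
  rewrite ge0_fin_numE; last by apply: integral_ge0.
  apply: (@le_lt_trans _ _ (\int[mu]_(x in E) M%:E)); last by rewrite intM ltry.
  apply: ge0_le_integral => // x Ex; rewrite funenegE ge_max lee_fin M0 andbT.
  by have := fM _ Ex; case: (f x) => [r| |] //=; rewrite -?EFinN ?lee_fin ?leNye //; lra.
by rewrite addeAC -e1 addeK.
Qed.
End Shift.

Section LogEnergy.
Variable R : realType.
Local Notation C := (R[i]).
Local Notation normc := Normc.normc.
Variable mu : probability (borelC R) R.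
Local Open Scope ereal_scope.

Lemma measurable_log_kernel_r z : measurable_fun setT (fun w : borelC R => log_kernel z w).
Proof. by apply: measurable_log_kernel => //; exact: measurable_cst. Qed.

Lemma measurable_potential : measurable_fun setT
  (fun z : borelC R => \int[mu]_w log_kernel z w).
Proof.
pose k (t : borelC R * borelC R) := log_kernel t.1 t.2.
have mk : measurable_fun setT k by exact: measurable_log_kernel.
rewrite (_ : (fun z => _) = (fun z => fubini_F mu k^\+ z - fubini_F mu k^\- z)).
  apply: emeasurable_funB.
  - apply: measurable_fun_fubini_tonelli_F => //; exact: measurable_funepos.
  - apply: measurable_fun_fubini_tonelli_F => //; exact: measurable_funeneg.
apply/funext => z; rewrite integralE /fubini_F.
by congr (_ - _); apply: eq_integral => w _; rewrite ?funeposE ?funenegE.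
Qed.

Lemma log_energy_shift (E : set (borelC R)) (M : R) : measurable E -> mu (~` E) = 0 ->
  (0 <= M)%R -> (forall z w, E z -> E w -> 0 <= log_kernel z w + M%:E) ->
  log_energy mu + M%:E = \int[mu]_(z in E) \int[mu]_(w in E) (log_kernel z w + M%:E).
Proof.
move=> mE muE M0 kM.
have inner z : E z -> \int[mu]_w log_kernel z w + M%:E =
    \int[mu]_(w in E) (log_kernel z w + M%:E).
  move=> Ez; apply: integral_shift => //; first exact: measurable_log_kernel_r.
  by move=> w; exact: kM.
rewrite /log_energy (integral_shift mE muE measurable_potential M0).
  by apply: eq_integral => z /[!inE]; exact: inner.
by move=> z Ez; rewrite inner //; apply: integral_ge0 => w; exact: kM.
Qed.

(** On a bounded set the kernel is bounded below. *)
Lemma kern_ge (B t : R) : (0 < B)%R -> (0 <= t <= B)%R -> (- ln B)%:E <= kern t.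
Proof.
move=> B0 /andP[]; rewrite le_eqVlt => /orP[/eqP <- _|t0 tB].
  by rewrite kern0 leey.
by rewrite kern_pos // lee_fin lerN2 ler_ln ?posrE.
Qed.
End LogEnergy.

(** * Averaging sums over pairs *)

Section Averaging.
Context d (T : measurableType d) (R : realType).
Variable mu : probability T R.
Variable E : set T.
Hypothesis mE : measurable E.
Hypothesis muE : mu (~` E) = 0%E.
Local Open Scope ereal_scope.
Variable L : T -> T -> \bar R.
Hypothesis L0 : forall z w, E z -> E w -> 0 <= L z w.
Hypothesis Lsym : forall z w, L z w = L w z.
Hypothesis mL : forall z, E z -> measurable_fun E (L z).
Let U z := \int[mu]_(w in E) L z w.
Hypothesis mU : measurable_fun E U.
Let J := \int[mu]_(z in E) U z.

(** Sum of [L] over the pairs of entries of a sequence. *)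
Fixpoint pairsum (s : seq T) : \bar R :=
  if s is z :: s' then \sum_(w <- s') L z w + pairsum s' else 0.

(** All entries of the sequence lie in [E]. *)
Definition all_in (s : seq T) := forall x, List.In x s -> E x.

Let U0 z : E z -> 0 <= U z.
Proof. by move=> Ez; apply: integral_ge0 => w Ew; apply: L0. Qed.

Let J0 : 0 <= J.
Proof. by apply: integral_ge0 => z; exact: U0. Qed.

Let sumL0 z s : E z -> all_in s -> 0 <= \sum_(w <- s) L z w.
Proof.
move=> Ez; elim: s => [|w s IH] h; first by rewrite big_nil.
rewrite big_cons adde_ge0 //; first by apply: L0 => //; apply: h; left.
by apply: IH => x xs; apply: h; right.
Qed.

Let sumU0 s : all_in s -> 0 <= \sum_(w <- s) U w.
Proof.
elim: s => [|w s IH] h; first by rewrite big_nil.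
rewrite big_cons adde_ge0 //; first by apply: U0; apply: h; left.
by apply: IH => x xs; apply: h; right.
Qed.

Let pair0 s : all_in s -> 0 <= pairsum s.
Proof.
elim: s => [|w s IH] h //=.
have hs : all_in s by move=> x xs; apply: h; right.
by rewrite adde_ge0 // ?IH // sumL0 //; apply: h; left.
Qed.

Let sum_int s : all_in s ->
  measurable_fun E (fun z => \sum_(w <- s) L z w) /\
  \int[mu]_(z in E) \sum_(w <- s) L z w = \sum_(w <- s) U w.
Proof.
elim: s => [|w s IH] h.
  split; first by under eq_fun do rewrite big_nil; exact: measurable_cst.
  by rewrite big_nil; under eq_integral do rewrite big_nil; rewrite integral0.
have hs : all_in s by move=> x xs; apply: h; right.
have Ew : E w by apply: h; left.
have [m1 e1] := IH hs.
have m2 : measurable_fun E (fun z => L z w).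
  by under eq_fun do rewrite Lsym; exact: mL.
split.
  by under eq_fun do rewrite big_cons; exact: emeasurable_funD.
rewrite big_cons -e1; under eq_integral do rewrite big_cons.
rewrite ge0_integralD //.
- by congr (_ + _); apply: eq_integral => z _; exact: Lsym.
- by move=> z Ez; apply: L0.
- by move=> z Ez; apply: sumL0.
Qed.

(** The mean of [pairsum (t ++ s)] when the [k] entries of [t] are independent and
    distributed according to [mu]. *)
Let F (k : nat) (s : seq T) : \bar R :=
  pairsum s + k%:R%:E * \sum_(w <- s) U w + 'C(k, 2)%:R%:E * J.

Let F_step k s : all_in s -> F k.+1 s = \int[mu]_(z in E) F k (z :: s).
Proof.
move=> hs; have [m1 e1] := sum_int hs.
rewrite /F; under eq_integral do rewrite /= big_cons.
have mcst (x : \bar R) : measurable_fun E (fun=> x) by exact: measurable_cst.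
have icst (x : \bar R) : \int[mu]_(z in E) x = x.
  by rewrite integral_cst // -[RHS]mule1; congr (_ * _); exact: mass1.
have m3 : measurable_fun E (fun z => U z + \sum_(w <- s) U w) by exact: emeasurable_funD.
have n3 z : E z -> 0 <= U z + \sum_(w <- s) U w by move=> Ez; rewrite adde_ge0 ?U0 ?sumU0.
have m4 : measurable_fun E (fun z => k%:R%:E * (U z + \sum_(w <- s) U w)).
  exact: measurable_funeM.
have n4 z : E z -> 0 <= k%:R%:E * (U z + \sum_(w <- s) U w).
  by move=> Ez; rewrite mule_ge0 ?n3 // lee_fin.
have n2 z : E z -> 0 <= \sum_(w <- s) L z w + pairsum s.
  by move=> Ez; rewrite adde_ge0 ?sumL0 ?pair0.
have m2 : measurable_fun E (fun z => \sum_(w <- s) L z w + pairsum s).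
  exact: emeasurable_funD.
rewrite ge0_integralD //; last 3 first.
- by move=> z Ez; rewrite adde_ge0 ?n2 ?n4.
- exact: emeasurable_funD.
- by move=> z _; rewrite mule_ge0 // lee_fin.
rewrite ge0_integralD // ge0_integralD //; last 2 first.
- by move=> z Ez; exact: sumL0.
- by move=> z Ez; exact: pair0.
rewrite ge0_integralZl_EFin // ge0_integralD //; last first.
  by move=> z Ez; exact: sumU0.
rewrite !icst e1 -/J.
set S := \sum_(w <- s) U w; set P := pairsum s.
have S0 : 0 <= S by exact: sumU0.
have pos (m : nat) : 0 <= m%:R%:E :> \bar R by rewrite lee_fin.
have -> : k.+1%:R%:E * S = S + k%:R%:E * S.
  by rewrite -natr1 EFinD ge0_muleDl // mul1e addeC.
rewrite binS bin1 natrD EFinD (ge0_muleDl J (pos _) (pos _)) (ge0_muleDr _ J0 S0).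
rewrite (_ : P + (S + k%:R%:E * S) + ('C(k, 2)%:R%:E * J + k%:R%:E * J) =
   (S + P) + (k%:R%:E * J + k%:R%:E * S) + 'C(k, 2)%:R%:E * J) //.
rewrite [S + P]addeC -!addeA; congr (_ + (_ + _)).
by rewrite [RHS]addeCA; congr (_ + _); rewrite addeC.
Qed.

(** A lower bound for the sums over the pairs of [n] points is a lower bound for
    their mean, which is ['C(n, 2)] times the energy. *)
Lemma averaging (n : nat) (b : R) : (0 <= b)%R ->
  (forall s, size s = n -> all_in s -> b%:E <= pairsum s) ->
  b%:E <= 'C(n, 2)%:R%:E * J.
Proof.
move=> b0 h.
suff key k : forall s, all_in s ->
    (forall t, size t = k -> all_in t -> b%:E <= pairsum (t ++ s)) -> b%:E <= F k s.
  have := key n [::]; rewrite /F /= big_nil mule0 !add0e; apply=> // t st at_.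
  by rewrite cats0; exact: h.
elim: k => [|k IH] s hs ht.
  rewrite /F mul0e adde0 bin0n mul0e adde0; have := ht [::]; apply=> //.
rewrite F_step //.
apply: (@le_trans _ _ (\int[mu]_(z in E) b%:E)).
  have -> : \int[mu]_(z in E) b%:E = b%:E => //.
  by rewrite integral_cst // -[RHS]mule1; congr (_ * _); exact: mass1.
have hz z : E z -> all_in (z :: s) by move=> Ez x /= [<-//|]; exact: hs.
have [m1 _] := sum_int hs.
apply: ge0_le_integral => //.
- apply: emeasurable_funD; last exact: measurable_cst.
  apply: emeasurable_funD; first by apply: emeasurable_funD => //; exact: measurable_cst.
  apply: measurable_funeM; under eq_fun do rewrite big_cons.
  by apply: emeasurable_funD => //; exact: measurable_cst.
- move=> z Ez; apply: IH; first exact: hz.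
  move=> t st at_.
  rewrite -cat_rcons; apply: ht; first by rewrite size_rcons st.
  by move=> x; rewrite -cats1 => xin; have [/at_//|/= [<-//|//]] := List.in_app_or _ _ _ xin.
Qed.
End Averaging.

(** * Products of mutual distances *)

Section Vandermonde.
Variable R : realType.
Local Notation C := (R[i]).
Local Notation normc := Normc.normc.

(** Product of the mutual distances of the entries of a sequence. *)
Fixpoint pairprod (s : seq C) : R :=
  if s is z :: s' then (\prod_(w <- s') normc (z - w)) * pairprod s' else 1.

Lemma pairprod_ge0 s : 0 <= pairprod s.
Proof.
elim: s => [|z s IH] //=; rewrite mulr_ge0 //.
by apply: prodr_ge0 => w _; exact: normc_ge0.
Qed.

Lemma normc_prod (I : Type) (r : seq I) (P : pred I) (F : I -> C) :
  normc (\prod_(i <- r | P i) F i) = \prod_(i <- r | P i) normc (F i).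
Proof. by apply: (big_morph _ (@Normc.normcM R) (@Normc.normc1 R)). Qed.

Lemma normc_sum (I : Type) (r : seq I) (P : pred I) (F : I -> C) :
  normc (\sum_(i <- r | P i) F i) <= \sum_(i <- r | P i) normc (F i).
Proof.
elim/big_rec2: _ => [|i y x _ h]; first by rewrite Normc.normc0.
by apply: le_trans (le_normcD _ _) _; rewrite lerD2l.
Qed.

Lemma pairprod_det (s : seq C) :
  pairprod s = normc (\det (Vandermonde (size s) (\row_(j < size s) s`_j))).
Proof.
rewrite det_Vandermonde normc_prod; under eq_bigr do rewrite normc_prod.
elim: s => [|z s IH]; first by rewrite /= big_ord0.
rewrite [LHS]/= [RHS]big_ord_recl; congr (_ * _).
  rewrite [RHS]big_mkcond big_ord_recl /= mul1r (big_nth 0) big_mkord; apply: eq_bigr => i _.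
  by rewrite !mxE -normcN opprB.
rewrite IH; apply: eq_bigr => i _; rewrite [RHS]big_mkcond big_ord_recl /= mul1r.
by rewrite [LHS]big_mkcond; apply: eq_bigr => j _; rewrite !mxE.
Qed.

(** Any monic polynomials of the same degrees may replace the powers in a
    Vandermonde determinant. *)
Lemma det_monic_polys n (a : 'rV[C]_n) (p : nat -> {poly C}) :
  (forall j, p j \is monic) -> (forall j, size (p j) = j.+1) ->
  \det (\matrix_(i < n, j < n) (p i).[a 0 j]) = \det (Vandermonde n a).
Proof.
move=> mp sp.
have -> : \matrix_(i < n, j < n) (p i).[a 0 j] =
    (\matrix_(i < n, k < n) (p i)`_k) *m Vandermonde n a.
  apply/matrixP => i j; rewrite !mxE (@horner_coef_wide _ n) ?sp //.
  by apply: eq_bigr => k _; rewrite !mxE.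
rewrite det_mulmx det_trig; last first.
  apply/is_trig_mxP => i j ij; rewrite mxE nth_default // sp //.
rewrite big1 ?mul1r // => i _; rewrite mxE.
by have /monicP := mp i; rewrite lead_coefE sp.
Qed.

Lemma fact_le_exp n : (n`! <= n ^ n)%N.
Proof.
rewrite fact_prod -[X in (_ <= _ ^ X)%N](subn0 n) -prod_nat_const_nat big_add1 /=.
rewrite !big_mkord; apply: leq_prod => i _; exact: ltn_ord.
Qed.

(** Expand the determinant, whose row of index [j] is bounded by [m j]. *)
Lemma pairprod_bound (s : seq C) (p : nat -> {poly C}) (m : nat -> R) :
  (forall j, p j \is monic) -> (forall j, size (p j) = j.+1) ->
  (forall j z, List.In z s -> normc (p j).[z] <= m j) ->
  pairprod s <= (size s)%:R ^+ size s * \prod_(j < size s) m j.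
Proof.
move=> mp sp bp.
have prod0 : 0 <= \prod_(j < size s) m j.
  case: s bp => [|z s] bp; first by rewrite big_ord0.
  apply: prodr_ge0 => j _; apply: le_trans (bp j z _); first exact: normc_ge0.
  by left.
set n := size s in prod0 *.
rewrite pairprod_det -(det_monic_polys _ mp sp) /determinant.
apply: le_trans (normc_sum _ _ _) _.
apply: (@le_trans _ _ (\sum_(t : 'S_n) \prod_(j < n) m j)).
  apply: ler_sum => t _; rewrite Normc.normcM normc_prod.
  have -> : normc ((-1) ^+ t : C) = 1.
    by rewrite normcX normcN Normc.normc1 expr1n.
  rewrite mul1r; apply: ler_prod => i _; rewrite normc_ge0 /= !mxE; apply: bp.
  have : (t i < size s)%N := ltn_ord _.
  elim: (s) (nat_of_ord (t i)) => [|w s' IH] [|k] //= h; first by left.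
  by right; exact: IH.
rewrite sumr_const card_Sn -[leLHS]mulr_natl ler_wpM2r //.
by rewrite -natrX ler_nat fact_le_exp.
Qed.

Local Open Scope ereal_scope.

Lemma kernM (x y : R) : (0 <= x)%R -> (0 <= y)%R -> kern (x * y) = kern x + kern y.
Proof.
rewrite le_eqVlt => /orP[/eqP <- y0|x0].
  rewrite mul0r kern0; move: y0; rewrite le_eqVlt => /orP[/eqP <-|y0].
    by rewrite kern0.
  by rewrite kern_pos.
rewrite le_eqVlt => /orP[/eqP <-|y0]; first by rewrite mulr0 kern0 kern_pos.
by rewrite !kern_pos ?mulr_gt0 // lnM ?posrE // opprD EFinD.
Qed.

Lemma kern1 : kern 1 = 0 :> \bar R.
Proof. by rewrite kern_pos // ln1 oppr0. Qed.

Lemma sum_kern (z : C) (s : seq C) (M : R) :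
  \sum_(w <- s) (log_kernel z w + M%:E) =
  kern (\prod_(w <- s) normc (z - w)) + ((size s)%:R * M)%:E.
Proof.
elim: s => [|w s IH]; first by rewrite !big_nil kern1 mul0r add0e.
rewrite !big_cons IH kernM ?normc_ge0 //; last first.
  by apply: prodr_ge0 => ? _; exact: normc_ge0.
rewrite addeACA; congr (_ + _).
by rewrite -EFinD /= -natr1 mulrDl mul1r addrC.
Qed.

Lemma pairsum_kern (s : seq C) (M : R) :
  pairsum (fun z w : borelC R => log_kernel z w + M%:E) s =
  kern (pairprod s) + ('C(size s, 2)%:R * M)%:E.
Proof.
elim: s => [|z s IH]; first by rewrite /= kern1 mul0r add0e.
rewrite /= IH sum_kern kernM ?pairprod_ge0 //; last first.
  by apply: prodr_ge0 => ? _; exact: normc_ge0.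
rewrite addeACA; congr (_ + _).
by rewrite -EFinD binS bin1 natrD mulrDl addrC.
Qed.
End Vandermonde.

(** * Lower bound for the energy *)

Section PolyBound.
Variable R : realType.
Local Notation C := (R[i]).
Local Notation normc := Normc.normc.

Lemma monic_sublevel_bounded (D : {poly C}) (q : nat) (a : R) :
  D \is monic -> size D = q.+1 -> (0 < q)%N ->
  exists2 B : R, 1 <= B & forall z, normc D.[z] <= a -> normc z <= B.
Proof.
move=> mD sD q0; pose K := \sum_(i < q) normc D`_i.
exists (Num.max 1 (`|a| + K)); first by rewrite le_max lexx.
move=> z hz; rewrite le_max; have [//|z1] := leP (normc z) 1.
have z0 : 0 < normc z by apply: lt_trans z1.
have e : z ^+ q = D.[z] - \sum_(i < q) D`_i * z ^+ i.
  rewrite horner_coef sD big_ord_recr /=.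
  have -> : D`_q = 1 by have /monicP := mD; rewrite lead_coefE sD.
  by rewrite mul1r addrC addrK.
have := congr1 (@Normc.normc R) e; rewrite normcX => e1.
have h1 : normc z ^+ q <= normc D.[z] + \sum_(i < q) normc (D`_i * z ^+ i).
  rewrite e1; apply: le_trans (le_normcD _ _) _.
  by rewrite normcN lerD2l normc_sum.
have zq1 : 1 <= normc z ^+ q.-1 by rewrite exprn_ege1 // ltW.
have h2 : \sum_(i < q) normc (D`_i * z ^+ i) <= K * normc z ^+ q.-1.
  rewrite mulr_suml; apply: ler_sum => i _; rewrite Normc.normcM normcX.
  rewrite ler_wpM2l ?normc_ge0 // ler_weXn2l ?(ltW z1) //.
  by have := ltn_ord i; lia.
have h3 : normc D.[z] <= `|a| * normc z ^+ q.-1.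
  apply: (le_trans hz); apply: (le_trans (ler_norm a)).
  by rewrite -[leLHS]mulr1 ler_wpM2l.
rewrite -(@ler_pM2r _ (normc z ^+ q.-1)); last by apply: lt_le_trans zq1.
rewrite -exprS prednK // mulrDl; apply: (le_trans h1); exact: lerD.
Qed.

(** The pair of the Dickson polynomials of indices [m] and [m + 1] evaluated at
    [D]. *)
Fixpoint dickson_pair (c : C) (D : {poly C}) m : {poly C} * {poly C} :=
  if m is m'.+1 then
    let: (f, g) := dickson_pair c D m' in (g, D * g - (c ^+ 2)%:P * f)
  else (2%:P, D).

(** The Dickson polynomial of index [m], with parameter [c ^ 2], evaluated at [D]:
    the Chebyshev polynomial of the interval [|x| <= 2 c], scaled to be monic for
    [m > 0] and equal to [2] for [m = 0]. *)
Definition dickson c D m := (dickson_pair c D m).1.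

Lemma dicksonSS c D m :
  dickson c D m.+2 = D * dickson c D m.+1 - (c ^+ 2)%:P * dickson c D m.
Proof. by rewrite /dickson /=; case: (dickson_pair c D m). Qed.

Lemma dickson_monic_size c D q m : D \is monic -> size D = q.+1 -> (0 < q)%N ->
  dickson c D m.+1 \is monic /\ size (dickson c D m.+1) = (m.+1 * q).+1.
Proof.
move=> mD sD q0.
suff : [/\ (size (dickson c D m) <= (m * q).+1)%N, dickson c D m.+1 \is monic &
    size (dickson c D m.+1) = (m.+1 * q).+1] by case.
elim: m => [|m [s1 mo s2]].
  rewrite /dickson /=; split; rewrite ?mul1n //.
  by rewrite size_polyC; case: (_ != 0).
have szM : size (D * dickson c D m.+1) = (m.+2 * q).+1.
  by rewrite size_monicM // -?size_poly_gt0 ?s2 // sD !mulSn; lia.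
have lt : (size (- ((c ^+ 2)%:P * dickson c D m)%R)%R < size (D * dickson c D m.+1)%R)%N.
  rewrite szM size_polyN mul_polyC; apply: leq_ltn_trans (size_scale_leq _ _) _.
  by apply: leq_ltn_trans s1 _; rewrite !mulSn; lia.
split; first by rewrite s2.
- by rewrite dicksonSS monicE lead_coefDl // -monicE monicMl.
- by rewrite dicksonSS size_polyDl.
Qed.

Lemma dickson_val (c t : R) D z m : D.[z] = (2 * c * cos t)%:C%C ->
  (dickson c%:C%C D m).[z] = (2 * c ^+ m * cos (m%:R * t))%:C%C.
Proof.
move=> h.
suff : (dickson c%:C%C D m).[z] = (2 * c ^+ m * cos (m%:R * t))%:C%C /\
  (dickson c%:C%C D m.+1).[z] = (2 * c ^+ m.+1 * cos (m.+1%:R * t))%:C%C by case.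
elim: m => [|m [IH1 IH2]].
  rewrite /dickson /= hornerC h mul0r cos0 mul1r expr1 expr0 !mulr1; split=> //.
  by rewrite rmorphMn rmorph1.
split=> //; have -> : 2 * c ^+ m.+2 * cos (m.+2%:R * t) =
    (2 * c * cos t) * (2 * c ^+ m.+1 * cos (m.+1%:R * t)) -
    c ^+ 2 * (2 * c ^+ m * cos (m%:R * t)).
  have -> : m.+2%:R * t = m.+1%:R * t + t by rewrite -[m.+2%:R]natr1; ring.
  have -> : m%:R * t = m.+1%:R * t - t by rewrite -[m.+1%:R]natr1; ring.
  by rewrite [cos (_ - t)]cosB cosD (exprS c m.+1) (exprS c m); ring.
rewrite dicksonSS hornerD hornerN !hornerM hornerC IH1 IH2 h.
rewrite [RHS]rmorphB; congr (_ - _); first by rewrite [RHS]rmorphM.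
by rewrite [RHS]rmorphM rmorphXn.
Qed.

Lemma dickson_bound (c x : R) D z m : 0 < c -> `|x| <= 2 * c -> D.[z] = x%:C%C ->
  normc (dickson c%:C%C D m).[z] <= 2 * c ^+ m.
Proof.
move=> c0 hx h; pose t := acos (x / (2 * c)).
have c2 : 0 < 2 * c by rewrite mulr_gt0.
have ct : 2 * c * cos t = x.
  have xc : x / (2 * c) \in `[-1, 1].
    rewrite in_itv /= -ler_norml.
    by rewrite normrM normfV (gtr0_norm c2) ler_pdivrMr // mul1r.
  by rewrite /t acosK // mulrC divfK // gt_eqF.
rewrite (@dickson_val c t) ?ct // normc_real normrM -[leRHS]mulr1 ler_pM ?cos_max //.
by rewrite normrM !ger0_norm ?exprn_ge0 // ltW.
Qed.
End PolyBound.

Section Upper.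
Variable R : realType.
Local Notation C := (R[i]).
Local Notation normc := Normc.normc.
Variables (D : {poly C}) (q : nat) (c : R).
Hypothesis mD : D \is monic.
Hypothesis sD : size D = q.+1.
Hypothesis q0 : (0 < q)%N.
Hypothesis c1 : 1 <= c.
Let E : set (borelC R) := [set z | exists2 x : R, `|x| <= 2 * c & D.[z] = x%:C%C].
Hypothesis mE : measurable E.

Let c0 : 0 < c. Proof. exact: lt_le_trans c1. Qed.

(** Monic polynomial of degree [j] that is small on [E]. *)
Let test (j : nat) : {poly C} :=
  (if (j %/ q)%N == 0%N then 1 else dickson c%:C%C D (j %/ q)) * 'X^(j %% q).

Let test_monic j : test j \is monic.
Proof.
rewrite /test monicMl ?monicXn //; case: eqP => [_|]; first exact: monic1.
by case: (j %/ q)%N => // m _; case: (dickson_monic_size c%:C%C m mD sD q0).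
Qed.

Let test_size j : size (test j) = j.+1.
Proof.
have key (f : {poly C}) m : f \is monic -> size f = (m * q).+1 ->
    m = (j %/ q)%N -> size (f * 'X^(j %% q)) = j.+1.
  move=> mf sf em; rewrite size_monicM ?size_polyXn ?sf -?size_poly_gt0 ?size_polyXn //.
  by rewrite em addSn /= addnS -divn_eq.
rewrite /test; case: eqP => [e|].
  by apply: (key 1 0%N); rewrite ?monic1 ?size_poly1 ?e.
case em : (j %/ q)%N => [|m] // _.
by have [? ?] := dickson_monic_size c%:C%C m mD sD q0; apply: (key _ m.+1).
Qed.

(** With the [test] polynomials the product of the mutual distances of [n] points of
    [E] is at most [n^n] times [K^n c^(n (n - 1) / (2 q))] for a constant [K], and
    dividing by the number of pairs leaves only the power of [c]. *)
Lemma log_energy_lower (mu : probability (borelC R) R) : mu (~` E) = 0%E ->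
  ((- (ln c / q%:R))%:E <= log_energy mu)%E.
Proof.
move=> muE.
have [B B1 hB] := monic_sublevel_bounded (2 * c) mD sD q0.
have B0 : 0 < B by apply: lt_le_trans B1.
have EB z : E z -> normc z <= B.
  by move=> [x hx ez]; apply: hB; rewrite ez normc_real.
pose M := ln (2 * B).
have M0 : 0 <= M by rewrite /M ln_ge0 //; lra.
have kM z w : E z -> E w -> (0 <= log_kernel z w + M%:E)%E.
  move=> Ez Ew.
  have : ((- M)%:E <= log_kernel z w)%E.
    apply: kern_ge; first by rewrite mulr_gt0.
    rewrite normc_ge0 /=; apply: le_trans (le_normcD _ _) _; rewrite normcN.
    by have := EB _ Ez; have := EB _ Ew; lra.
  by rewrite -leeBlDr // sub0e -EFinN.
have shift := log_energy_shift mE muE M0 kM.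
pose J := (\int[mu]_(z in E) \int[mu]_(w in E) (log_kernel z w + M%:E))%E.
have mk z : measurable_fun E (fun w : borelC R => log_kernel z w + M%:E)%E.
  apply: emeasurable_funD => //; apply: measurable_funTS; exact: measurable_log_kernel_r.
have mU : measurable_fun E (fun z : borelC R => \int[mu]_(w in E) (log_kernel z w + M%:E))%E.
  apply: (@eq_measurable_fun _ _ _ _ _ (fun z : borelC R => \int[mu]_w log_kernel z w + M%:E)%E).
    move=> z /[!inE] Ez; apply: integral_shift => //; first exact: measurable_log_kernel_r.
    by move=> w; exact: kM.
  by apply: emeasurable_funD => //; apply: measurable_funTS; exact: measurable_potential.
have ksym (z w : borelC R) : (log_kernel z w + M%:E = log_kernel w z + M%:E)%E.
  by rewrite /log_kernel -normcN opprB.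
have J0 : (0 <= J)%E.
  by apply: integral_ge0 => z Ez; apply: integral_ge0 => w Ew; exact: kM.
(* bounds of the test polynomials on [E] *)
pose m (j : nat) := 2 * B ^+ q * c ^+ (j %/ q).
have m0 j : 0 < m j by rewrite /m !mulr_gt0 ?exprn_gt0.
pose N n : R := n%:R ^+ n * \prod_(j < n) m j.
have key n : (0 < n)%N -> (('C(n, 2)%:R * M - ln (N n))%:E <= 'C(n, 2)%:R%:E * J)%E.
  move=> n0; have [neg|pos] := ltP ('C(n, 2)%:R * M - ln (N n)) 0.
    apply: (@le_trans _ _ 0%E); first by rewrite lee_fin ltW.
    by rewrite mule_ge0 // lee_fin.
  apply: (averaging mE muE kM ksym (fun z _ => mk z) mU pos) => s sn sE.
  rewrite pairsum_kern sn addrC EFinD leeD2r //.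
  have N0 : 0 < N n.
    by rewrite /N mulr_gt0 ?exprn_gt0 ?ltr0n // prodr_gt0.
  apply: kern_ge => //; rewrite pairprod_ge0 /= /N -sn.
  apply: (pairprod_bound test_monic test_size) => j z /sE Ez.
  have Bz := EB _ Ez.
  case: Ez => x hx ez.
  rewrite /test hornerM Normc.normcM hornerXn normcX /m mulrAC.
  have h1 : normc z ^+ (j %% q) <= B ^+ q.
    apply: (@le_trans _ _ (B ^+ (j %% q))).
      by apply: lerXn2r; rewrite ?nnegrE ?normc_ge0 ?(ltW B0).
    by apply: ler_weXn2l => //; apply: ltnW; rewrite ltn_mod.
  apply: ler_pM => //; rewrite ?normc_ge0 ?exprn_ge0 ?normc_ge0 //.
  case: eqP => [->|_]; last exact: dickson_bound hx ez.
  by rewrite hornerC Normc.normc1 expr0 mulr1; lra.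
pose K := ln (2 * B ^+ q).
have lnN n : (0 < n)%N -> ln (N n) <= n%:R * ln n%:R + n%:R * K + 'C(n, 2)%:R * (ln c / q%:R).
  move=> n0; have n0R : 0 < n%:R :> R by rewrite ltr0n.
  rewrite /N lnM ?posrE ?exprn_gt0 ?prodr_gt0 // lnXn // -[ln n%:R *+ n]mulr_natl -addrA lerD2l.
  have -> : ln (\prod_(j < n) m j) = \sum_(j < n) ln (m j).
    elim: (n) => [|k IH]; first by rewrite !big_ord0 ln1.
    by rewrite !big_ord_recr /= lnM ?posrE ?prodr_gt0 // IH.
  have -> : n%:R * K + 'C(n, 2)%:R * (ln c / q%:R) = \sum_(j < n) (K + j%:R * (ln c / q%:R)).
    rewrite big_split /= sumr_const card_ord -[K *+ n]mulr_natl -mulr_suml.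
    by rewrite -natr_sum -bin2_sum big_mkord.
  apply: ler_sum => j _; rewrite /m lnM ?posrE ?mulr_gt0 ?exprn_gt0 // -/K lerD2l lnXn //.
  rewrite -[leLHS]mulr_natl mulrA [leRHS]mulrAC ler_wpM2r ?ln_ge0 //.
  have qR : 0 < q%:R :> R by rewrite ltr0n.
  by rewrite ler_pdivlMr // -natrM ler_nat leq_divM.
have eJ : (log_energy mu = J - M%:E)%E by rewrite /J -shift addeK.
case eJ' : J => [r| |]; last 2 first.
- by rewrite eJ eJ' /= leey.
- by move: J0; rewrite eJ'.
rewrite eJ eJ' -EFinB lee_fin leNgt; apply/negP => lt.
(* a gap [dl] to the claimed bound would give [(n - 1) * dl / 2 <= ln n + K] for
   all [n > 1] *)
pose dl := - (ln c / q%:R) - (r - M).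
have dl0 : 0 < dl by rewrite subr_gt0.
have bnd n : (1 < n)%N -> (n%:R - 1) * dl / 2 <= ln n%:R + K.
  move=> n1; have n0 : (0 < n)%N by lia.
  have := key n n0; rewrite eJ' -EFinM lee_fin => h1; have h2 := lnN n n0.
  have n0R : 0 < n%:R :> R by rewrite ltr0n.
  have eC : ('C(n, 2)%:R : R) = n%:R * (n%:R - 1) / 2.
    have : (n * n.-1 = 'C(n, 2) * 2)%N by have := mul_bin_diag n 1; rewrite bin1 [in RHS]mulnC.
    move=> /(congr1 (fun k => k%:R : R)); rewrite !natrM -subn1 natrB // => ->.
    by rewrite mulfK.
  have eD : n%:R * ((n%:R - 1) * dl / 2) = 'C(n, 2)%:R * dl by rewrite eC; ring.
  by rewrite -(ler_pM2l n0R) eD /dl; move: h1 h2; lra.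
pose a := 4 / dl.
have a0 : 0 < a by rewrite divr_gt0.
have lnb n : (0 < n)%N -> ln n%:R <= n%:R * dl / 4 + ln a.
  move=> n0; have n0R : 0 < n%:R :> R by rewrite ltr0n.
  have -> : ln n%:R = ln (n%:R / a) + ln a.
    by rewrite -lnM ?posrE ?divr_gt0 // divfK // gt_eqF.
  rewrite lerD2r; have := le_ln1Dx (_ : -1 < n%:R / a - 1).
  rewrite subrKC => /(_ _)/le_trans; apply; first by rewrite ltrBrDl subrr divr_gt0.
  rewrite /a invf_div mulrA; lra.
pose n := (Num.bound (`|4 / dl * (dl / 2 + ln a + K)|)).+2.
have n1 : (1 < n)%N by [].
have := archi_boundP (normr_ge0 (4 / dl * (dl / 2 + ln a + K))).
move=> h3; have h4 : 4 / dl * (dl / 2 + ln a + K) < n%:R.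
  apply: le_lt_trans (ler_norm _) _; apply: lt_le_trans h3 _.
  by rewrite ler_nat /n; do 2 apply: leqW.
have h5 : dl / 2 + ln a + K < n%:R * dl / 4.
  have : (4 / dl * (dl / 2 + ln a + K)) * (dl / 4) < n%:R * (dl / 4).
    by rewrite ltr_pM2r // divr_gt0.
  rewrite (_ : 4 / dl * _ * (dl / 4) = dl / 2 + ln a + K) ?mulrA //.
  by field; rewrite gt_eqF.
have := bnd n n1; have := lnb n (ltnW n1); lra.
Qed.
End Upper.

(** * Measurable choice of the roots *)

Section Roots.
Variable R : realType.

Lemma prod_XaddC_coef_gt0 (s : seq R) : (forall r, r \in s -> 0 < r) ->
  forall k, (k <= size s)%N -> 0 < (\prod_(r <- s) ('X + r%:P))`_k.
Proof.
have sz (u : seq R) : size (\prod_(r <- u) ('X + r%:P)) = (size u).+1.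
  rewrite -(size_map -%R u) -(size_prod_XsubC _ id) big_map; congr (size (polyseq _)).
  by apply: eq_bigr => r _; rewrite polyCN opprK.
elim: s => [|r s IH] hs k; first by rewrite leqn0 => /eqP ->; rewrite big_nil coef1.
have r0 : 0 < r by apply: hs; rewrite mem_head.
have hs' t : t \in s -> 0 < t by move=> ts; apply: hs; rewrite in_cons ts orbT.
rewrite big_cons mulrDl coefD coefXM mul_polyC coefZ /=.
case: k => [|k] hk /=; first by rewrite add0r mulr_gt0 ?IH.
have [ks|ks] := leqP k.+1 (size s).
  by rewrite addr_gt0 ?IH ?mulr_gt0 ?IH // ltnW.
rewrite [X in _ + _ * X](_ : _ = 0) ?mulr0 ?addr0 ?IH //.
by rewrite nth_default // sz.
Qed.

(** All roots are less than [y] iff all Taylor coefficients at [y] are positive. *)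
Lemma roots_lt_coef_gt0 (s : seq R) (y : R) :
  (forall r, r \in s -> r < y) <->
  (forall k, (k <= size s)%N -> 0 < ((\prod_(r <- s) ('X - r%:P)) \Po ('X + y%:P))`_k).
Proof.
have e : (\prod_(r <- s) ('X - r%:P)) \Po ('X + y%:P) =
    \prod_(r <- [seq y - r | r <- s]) ('X + r%:P).
  rewrite rmorph_prod /= big_map; apply: eq_bigr => r _.
  by rewrite comp_polyB comp_polyX comp_polyC polyCB -addrA.
rewrite e; split=> [h k ks|h r rs].
  apply: prod_XaddC_coef_gt0; rewrite ?size_map // => t /mapP[r rs ->].
  by rewrite subr_gt0 h.
rewrite ltNge; apply/negP => yr.
have sz : size (\prod_(r <- [seq y - r | r <- s]) ('X + r%:P)) = (size s).+1.
  rewrite -(size_map (fun r => r - y) s) -(size_prod_XsubC _ id) !big_map.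
  by congr (size (polyseq _)); apply: eq_bigr => t _; rewrite -polyCN opprB.
have : (\prod_(r <- [seq y - r | r <- s]) ('X + r%:P)).[r - y] = 0.
  apply/eqP; rewrite horner_prod prodf_seq_eq0; apply/hasP; exists (y - r).
    by apply/mapP; exists r.
  by rewrite /= hornerD hornerX hornerC -opprB addNr.
move=> /eqP; apply/negP; rewrite gt_eqF // horner_coef sz big_ord_recl /=.
rewrite expr0 mulr1 ltr_pwDl ?h // sumr_ge0 // => i _.
by rewrite mulr_ge0 ?exprn_ge0 ?subr_ge0 // ltW // h // lift0.
Qed.

Context d (T : measurableType d).

(** The largest root depends measurably on the coefficients, by the previous lemma;
    divide it out and repeat. *)
Lemma measurable_roots n : forall g : T -> {poly R},
  (forall i, measurable_fun setT (fun x => (g x)`_i)) ->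
  (forall x, exists2 s : seq R, size s = n & g x = \prod_(r <- s) ('X - r%:P)) ->
  exists zeta : 'I_n -> T -> R, (forall j, measurable_fun setT (zeta j)) /\
    forall x, g x = \prod_(j < n) ('X - (zeta j x)%:P).
Proof.
elim: n => [|n IH] g mg sg.
  exists (fun _ _ => 0); split=> [j|x]; first exact: measurable_cst.
  by have [[|//] _ ->] := sg x; rewrite big_nil big_ord0.
(* the largest root *)
have ex x : exists r, root (g x) r /\ forall t, root (g x) t -> t <= r.
  have [[|a s] //= ss gx] := sg x.
  have rE t : root (g x) t = (t \in a :: s) by rewrite gx root_prod_XsubC.
  exists (\big[Order.max/a]_(t <- a :: s) t); split.
    rewrite rE big_seq; apply: (big_ind (fun u => u \in a :: s)) => //.
      exact: mem_head.
    by move=> u v hu hv; rewrite /Order.max; case: ifP.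
  by move=> t; rewrite rE => ts; apply: le_bigmax_seq.
have [rt hrt] := choice ex.
have lt_rt x y : (rt x < y) <-> (forall k, (k <= n.+1)%N -> 0 < (g x \Po ('X + y%:P))`_k).
  have [s ss gx] := sg x; rewrite gx -ss -roots_lt_coef_gt0.
  have [h1 h2] := hrt x.
  have rE t : root (g x) t = (t \in s) by rewrite gx root_prod_XsubC.
  split=> [h r rs|h]; last by apply: h; rewrite -rE.
  by apply: le_lt_trans h; apply: h2; rewrite rE.
have sz x : size (g x) = n.+2.
  by have [s ss ->] := sg x; rewrite size_prod_XsubC ss.
have mrt : measurable_fun setT rt.
  apply: (measurability _ (RGenInftyO.measurableE R)).
  move=> _ [_ [y ->] <-]; rewrite setTI.
  have -> : rt @^-1` `]-oo, y[%classic =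
      \bigcap_(k in `I_n.+2) [set x | 0 < (g x \Po ('X + y%:P))`_k].
    apply/seteqP; split => x /=; rewrite in_itv /=.
      by move=> /lt_rt h k /=; rewrite ltnS; exact: h.
    by move=> h; apply/lt_rt => k kn; apply: h; rewrite /= ltnS.
  apply: bigcap_measurable; first by exists 0%N.
  move=> k _.
  have mk : measurable_fun setT (fun x => (g x \Po ('X + y%:P))`_k).
    have -> : (fun x => (g x \Po ('X + y%:P))`_k) =
        (fun x => \sum_(i < n.+2) (g x)`_i * (('X + y%:P) ^+ i)`_k).
      apply/funext => x; rewrite comp_polyE coef_sum sz.
      by apply: eq_bigr => i _; rewrite coefZ.
    apply: measurable_sum => i; apply: measurable_funM => //; exact: measurable_cst.
  rewrite (_ : [set x | _] = (fun x => 0 < (g x \Po ('X + y%:P))`_k) @^-1` [set true]).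
    rewrite -[X in measurable X]setTI.
    by apply: (measurable_fun_ltr (measurable_cst _) mk) => //.
  by apply/seteqP; split => x /=.
pose h x := g x %/ ('X - (rt x)%:P).
have gh x : g x = h x * ('X - (rt x)%:P).
  by rewrite /h divpK // dvdp_XsubCl; case: (hrt x).
have sh x : exists2 s : seq R, size s = n & h x = \prod_(r <- s) ('X - r%:P).
  have [s ss gx] := sg x; have [h1 _] := hrt x.
  have rs : rt x \in s by move: h1; rewrite gx root_prod_XsubC.
  exists (rem (rt x) s); first by rewrite size_rem // ss.
  have xn0 : 'X - (rt x)%:P != 0 by rewrite polyXsubC_eq0.
  apply: (mulIf xn0).
  by rewrite -gh gx (big_rem _ rs) /= mulrC.
have hsz x : size (h x) = n.+1.
  by have [s ss ->] := sh x; rewrite size_prod_XsubC ss.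
have mh i : measurable_fun setT (fun x => (h x)`_i).
  have : forall m i, (n < i + m)%N -> measurable_fun setT (fun x => (h x)`_i).
    elim=> [|m IHm] {}i him.
      rewrite (_ : (fun x => _) = fun=> 0); first exact: measurable_cst.
      by apply/funext => x; rewrite nth_default // hsz; lia.
    have -> : (fun x => (h x)`_i) = (fun x => (g x)`_i.+1 + rt x * (h x)`_i.+1).
      apply/funext => x; rewrite gh mulrBr coefB coefMX coefMC /=.
      by rewrite [_ * rt x]mulrC subrK.
    apply: measurable_funD => //; apply: measurable_funM => //; apply: IHm; lia.
  by move=> H; apply: (H n.+1); rewrite addnS ltnS leq_addl.
have [zeta [mz hz]] := IH h mh sh.
exists (fun j => if unlift ord0 j is Some j' then zeta j' else rt); split.
  by move=> j; case: unlift => //.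
move=> x; rewrite big_ord_recl unlift_none gh hz mulrC; congr (_ * _).
by apply: eq_bigr => j _; rewrite liftK.
Qed.
End Roots.

(** * Pulling a measure back along branches *)

Section Mixture.
Context d1 d2 (S : measurableType d1) (T : measurableType d2) (R : realType).
Variable nu : probability S R.
Variables (f : nat -> S -> T) (mf : forall n, measurable_fun setT (f n)).
Variables (q : nat) (q0 : (0 < q)%N).
Local Open Scope ereal_scope.

(** The mean of the images of [nu] under [q] maps. *)
Lemma mixture : exists omega : probability T R,
  (forall A, measurable A -> omega A = (q%:R^-1)%:E * \sum_(j < q) nu (f j @^-1` A)) /\
  (forall D (F : T -> \bar R), measurable D -> measurable_fun D F ->
     (forall x, D x -> 0 <= F x) -> (forall j x, (j < q)%N -> D (f j x)) ->
     \int[omega]_(x in D) F x = (q%:R^-1)%:E * \sum_(j < q) \int[nu]_x F (f j x)).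
Proof.
pose m n : {measure set T -> \bar R} :=
  measure_function_pushforward__canonical__measure_function_Measure nu (mf n).
have k0 : (0 <= q%:R^-1 :> R)%R by rewrite invr_ge0.
pose om := mscale (NngNum k0) (msum m q).
have omE A : om A = (q%:R^-1)%:E * \sum_(j < q) nu (f j @^-1` A) by [].
have om1 : om setT = 1.
  rewrite omE; under eq_bigr do rewrite preimage_setT probability_setT.
  rewrite sumEFin sumr_const card_ord -EFinM -[X in (_ * X)%R]mulr_natl mulr1 mulVf //.
  by rewrite pnatr_eq0 -lt0n.
pose omega : probability T R := HB.pack (mscale (NngNum k0) (msum m q))
  (Measure_isProbability.Build _ _ _ (mscale (NngNum k0) (msum m q)) om1).
exists omega; split=> [A mA|D F mD mF F0 Df]; first exact: omE.
rewrite -[LHS]/(\int[om]_(x in D) F x).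
rewrite ge0_integral_mscale //= ge0_integral_measure_sum //; congr (_ * _).
apply: eq_bigr => j _.
rewrite ge0_integral_pushforward //; last by move=> y /[!inE]; exact: F0.
by congr integral; apply/seteqP; split=> x //= _; exact: Df.
Qed.
End Mixture.

Section EnergyTransfer.
Context d1 d2 (S : measurableType d1) (T : measurableType d2) (R : realType).
Variable nu : probability S R.
Variables (f : nat -> S -> T) (mf : forall n, measurable_fun setT (f n)).
Variables (q : nat) (q0 : (0 < q)%N).
Variables (D : set T) (mD : measurable D).
Hypothesis fD : forall j x, (j < q)%N -> D (f j x).
Local Open Scope ereal_scope.
Variables (kS : S -> S -> \bar R) (kT : T -> T -> \bar R) (a : R).
Hypothesis a0 : (0 <= a)%R.
Hypothesis kS0 : forall x y, 0 <= kS x y.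
Hypothesis mkS : measurable_fun setT (fun p : S * S => kS p.1 p.2).
Hypothesis kT0 : forall x y, D x -> D y -> 0 <= kT x y.
Hypothesis mkT : forall x, D x -> measurable_fun D (kT x).
Hypothesis mUT : forall om : probability T R, om (~` D) = 0 ->
  measurable_fun D (fun x => \int[om]_(y in D) kT x y).
Hypothesis kTS : forall i x y, (i < q)%N ->
  \sum_(j < q) kT (f i x) (f j y) = kS x y + a%:E.

(** Energy of the mean of the images under [q] branches [f j], when summing the
    kernel over the branches gives the kernel on [S] plus a constant. *)
Lemma energy_transfer : exists om : probability T R, om (~` D) = 0 /\
  \int[om]_(x in D) \int[om]_(y in D) kT x y =
    (q%:R^-1)%:E * (\int[nu]_x \int[nu]_y kS x y + a%:E).
Proof.
have [om [omA omI]] := mixture nu mf q0.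
have omD : om (~` D) = 0.
  rewrite omA; last exact: measurableC.
  rewrite big1 ?mule0 // => j _.
  rewrite (_ : f j @^-1` (~` D) = set0) ?measure0 //.
  by apply/seteqP; split=> // x /=; apply; exact: fD.
have mU := mUT omD.
exists om; split=> //.
have qV0 : 0 <= (q%:R^-1)%:E :> \bar R by rewrite lee_fin invr_ge0.
have mkSx x : measurable_fun setT (kS x).
  exact: (measurable_fun_pair2 (f := fun p : S * S => kS p.1 p.2)).
have mUS : measurable_fun setT (fun x => \int[nu]_y kS x y).
  pose k (p : S * S) := kS p.1 p.2.
  rewrite (_ : (fun x => _) = fubini_F nu k) //.
  by apply: measurable_fun_fubini_tonelli_F => // p; exact: kS0.
have US0 x : 0 <= \int[nu]_y kS x y by apply: integral_ge0.
have inta : \int[nu]_x a%:E = a%:E.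
  by rewrite integral_cst // -[RHS]mule1; congr (_ * _); exact: probability_setT.
have inner i x : (i < q)%N -> \int[om]_(y in D) kT (f i x) y =
    (q%:R^-1)%:E * (\int[nu]_y kS x y + a%:E).
  move=> iq; rewrite omI //; first last.
  - by move=> y Dy; apply: kT0 => //; exact: fD.
  - by apply: mkT; exact: fD.
  congr (_ * _).
  rewrite -ge0_integral_sum //; first last.
  - by move=> j y _; apply: kT0; exact: fD.
  - move=> j; apply: (@measurable_comp _ _ _ _ _ _ D) => //.
    + by move=> _ [y _ <-]; exact: fD.
    + by apply: mkT; exact: fD.
  under eq_integral do rewrite kTS //.
  by rewrite ge0_integralD // inta.
rewrite omI //; last by move=> x Dx; apply: integral_ge0 => y Dy; exact: kT0.
congr (_ * _).
transitivity (\sum_(j < q) (q%:R^-1)%:E * (\int[nu]_x \int[nu]_y kS x y + a%:E)).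
  apply: eq_bigr => j _; under eq_integral do rewrite inner //.
  rewrite ge0_integralZl_EFin ?invr_ge0 //; first last.
  - by apply: emeasurable_funD => //; exact: measurable_cst.
  - by move=> x _; rewrite adde_ge0 ?lee_fin.
  by rewrite ge0_integralD // inta.
have : 0 <= \int[nu]_x \int[nu]_y kS x y + a%:E.
  by rewrite adde_ge0 ?lee_fin //; apply: integral_ge0.
set J := _ + a%:E => J0.
rewrite -ge0_sume_distrl //.
rewrite sumEFin sumr_const card_ord -[(_ *+ q)%R]mulr_natl mulfV ?mul1e //.
by rewrite pnatr_eq0 -lt0n.
Qed.
End EnergyTransfer.

(** * Potential of the uniform measure *)

Section KernBound.
Variable R : realType.
Local Open Scope ereal_scope.

Lemma kern_scale (A t : R) : (0 < A)%R -> (0 <= t)%R ->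
  kern (A^-1 * t) = kern t + (ln A)%:E.
Proof.
move=> A0 t0; rewrite kernM ?invr_ge0 ?(ltW A0) // kern_pos ?invr_gt0 //.
by rewrite lnV ?posrE // opprK addeC.
Qed.

(** Layer-cake bound of the logarithmic kernel. *)
Lemma kern_le_series (t : R) : (0 <= t <= 1)%R ->
  kern t <= \sum_(n <oo) (if (t <= (2 ^ n)%:R^-1)%R then 1 else 0)%:E.
Proof.
move=> /andP[t0 t1].
have ge0 n : 0 <= (if (t <= (2 ^ n)%:R^-1)%R then 1 else 0)%:E :> \bar R.
  by case: ifP; rewrite lee_fin.
have part N : (t <= (2 ^ N)%:R^-1)%R ->
    (N.+1)%:R%:E <= \sum_(n <oo) (if (t <= (2 ^ n)%:R^-1)%R then 1 else 0)%:E :> \bar R.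
  move=> tN; apply: le_trans (nneseries_lim_ge N.+1 _) => //.
  rewrite sumEFin lee_fin big_mkord (eq_bigr (fun=> 1%R)); last first.
    move=> i _; rewrite ifT //; apply: le_trans tN _.
    rewrite lef_pV2 ?posrE ?ltr0n ?expn_gt0 // ler_nat leq_exp2l //.
    by have := ltn_ord i; rewrite ltnS.
  by rewrite sumr_const card_ord.
move: t0; rewrite le_eqVlt => /orP[/eqP t0|t0].
  rewrite (_ : \sum_(n <oo) _ = +oo) ?leey //; apply/eqyP => A A0.
  apply: (@le_trans _ _ (Num.bound A).+1%:R%:E); last first.
    by apply: part; rewrite -t0 invr_ge0.
  rewrite lee_fin ltW //; apply: lt_le_trans (archi_boundP (ltW A0)) _.
  by rewrite ler_nat.
rewrite kern_pos //.
have ex : exists N, ((2 ^ N)%:R^-1 < t)%R.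
  exists (Num.bound t^-1); rewrite invf_plt ?posrE ?ltr0n ?expn_gt0 //.
  apply: lt_trans (archi_boundP _) _; first by rewrite invr_ge0 ltW.
  by rewrite ltr_nat ltn_expl.
have [N tN minN] := ex_minnP ex.
case: N tN minN => [|N] tN minN.
  by move: tN; rewrite expn0 invr1 ltNge t1.
have tN' : (t <= (2 ^ N)%:R^-1)%R.
  by rewrite leNgt; apply/negP => /minN; rewrite ltnn.
apply: le_trans (part N tN'); rewrite lee_fin -lnV ?posrE //.
have : (t^-1 <= (2 ^ N.+1)%:R)%R.
  by rewrite -[leRHS]invrK lef_pV2 ?posrE ?invr_gt0 ?ltr0n ?expn_gt0 // ltW.
move=> h; apply: (@le_trans _ _ (ln (2 ^ N.+1)%:R)%R).
  by rewrite ler_ln ?posrE ?invr_gt0 ?ltr0n ?expn_gt0.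
rewrite natrX lnXn // -[leRHS]mulr_natl mulr1 -[leLHS]mulr_natl -[leRHS]mulr1 ler_wpM2l //.
have := @le_ln1Dx R 1; rewrite (_ : 1 + 1 = 2 :> R)%R //; apply.
by rewrite (lt_trans _ ltr01) // ltrN10.
Qed.

Local Notation leb := (@lebesgue_measure R).

Lemma measurable_kern_dist d (T : measurableType d) (f g : T -> R) :
  measurable_fun setT f -> measurable_fun setT g ->
  measurable_fun setT (fun t => kern `|f t - g t|%R).
Proof.
move=> mf mg; apply: (measurableT_comp (@measurable_kern R)).
by apply: measurableT_comp => //; exact: measurable_funB.
Qed.

(** The uniform measure on the unit interval has bounded potential. *)
Lemma unif_potential (x : R) : (0 <= x <= 1)%R ->
  \int[leb]_(y in `[0%R, 1%R]) kern `|x - y|%R <= 4%:E.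
Proof.
move=> /andP[x0 x1].
pose F n (y : R) : \bar R := (if (`|x - y| <= (2 ^ n)%:R^-1)%R then 1 else 0)%:E.
have F0 n y : 0 <= F n y by rewrite /F; case: ifP; rewrite lee_fin.
pose I n : set R := `[(x - (2 ^ n)%:R^-1)%R, (x + (2 ^ n)%:R^-1)%R]%classic.
have FI n : F n = (fun y => (\1_(I n) y)%:E).
  apply/funext => y; rewrite /F indicE /I mem_setE in_itv /= -ler_distl distrC.
  by case: ifP.
have mF n : measurable_fun setT (F n).
  by rewrite FI; apply/measurable_EFinP; apply: measurable_indic; exact: measurable_itv.
have mI n : measurable (I n) by exact: measurable_itv.
have m01 : measurable (`[0%R, 1%R]%classic : set R) by exact: measurable_itv.
apply: (@le_trans _ _ (\int[leb]_(y in `[0%R, 1%R]) \sum_(n <oo) F n y)).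
  apply: ge0_le_integral => //.
  - move=> y; rewrite /= in_itv /= => /andP[y0 y1]; have := @kern_ge R 1 `|x - y|%R ltr01.
    rewrite ln1 oppr0; apply; rewrite normr_ge0 /= ler_distl; apply/andP; split; lra.
  - apply: measurable_funTS; apply: measurable_kern_dist => //; exact: measurable_cst.
  - by apply: ge0_emeasurable_sum => [n y _ _|n _]; [exact: F0|exact: (measurable_funTS (mF n))].
  - move=> y; rewrite /= in_itv /= => /andP[y0 y1]; apply: kern_le_series.
    by rewrite normr_ge0 /= ler_distl; apply/andP; split; lra.
rewrite integral_nneseries //; last by move=> n; exact: (measurable_funTS (mF n)).
have := @cvg_geometric_eseries_half R 4 0; rewrite expr0 divr1 => /cvg_lim <- //.
apply: lee_nneseries => [n _ _|n _]; first by apply: integral_ge0.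
rewrite FI integral_indic //=; last exact: mI.
apply: (@le_trans _ _ (leb (I n))).
  by apply: le_measure; rewrite ?inE; [exact: (measurableI _ _ (mI n) m01)|exact: mI|move=> ? []].
rewrite /I lebesgue_measure_itv /= lte_fin.
have p0 : (0 < (2 ^ n)%:R^-1 :> R)%R by rewrite invr_gt0 ltr0n expn_gt0.
rewrite ifT; last by lra.
rewrite -EFinB lee_fin expnD natrM invfM.
rewrite [X in (_ <= X)%R](_ : _ = 2 * (2 ^ n)%:R^-1)%R; last first.
  by field; rewrite gt_eqF // ltr0n expn_gt0.
lra.
Qed.
End KernBound.

(** * Measures of small energy on an interval *)

Section Interval.
Variable R : realType.
Variables (c M : R).
Hypothesis c1 : 1 <= c.
Hypothesis Mc : ln (4 * c) <= M.
Let c0 : 0 < c. Proof. exact: lt_le_trans c1. Qed.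
Let M0 : 0 <= M.
Proof. by apply: le_trans Mc; apply: ln_ge0; have := c1; lra. Qed.

(** The retraction of the line onto the interval [|x| <= 2 c]. *)
Definition clamp (x : R) : R := Num.max (- (2 * c)) (Num.min (2 * c) x).

Lemma clamp_bound x : `|clamp x| <= 2 * c.
Proof.
rewrite ler_norml /clamp le_max lexx /= ge_max ge_min lexx /= andbT.
by have := c0; lra.
Qed.

Lemma clamp_id x : `|x| <= 2 * c -> clamp x = x.
Proof. by rewrite ler_norml /clamp => /andP[h1 h2]; rewrite min_r // max_r. Qed.

Lemma measurable_clamp : measurable_fun setT clamp.
Proof.
apply: measurable_maxr; first exact: measurable_cst.
by apply: measurable_minr => //; exact: measurable_cst.
Qed.

Local Open Scope ereal_scope.

(** The logarithmic kernel after retraction, shifted to be nonnegative on the whole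
    line. *)
Definition clamp_kern (x y : R) : \bar R := kern `|clamp x - clamp y|%R + M%:E.

Lemma shifted_kern_ge0 (t : R) : (0 <= t <= 4 * c)%R -> 0 <= kern t + M%:E.
Proof.
move=> h; have h1 : (- ln (4 * c))%:E <= kern t.
  by apply: kern_ge => //; have := c0; lra.
apply: (@le_trans _ _ ((- ln (4 * c))%:E + M%:E)); last exact: leeD2r.
by rewrite -EFinD lee_fin addrC subr_ge0.
Qed.

Lemma clamp_kern_ge0 x y : 0 <= clamp_kern x y.
Proof.
apply: shifted_kern_ge0; rewrite normr_ge0 /=.
apply: le_trans (ler_normB _ _) _.
by have := clamp_bound x; have := clamp_bound y; lra.
Qed.

Lemma measurable_clamp_kern :
  measurable_fun setT (fun p : R * R => clamp_kern p.1 p.2).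
Proof.
apply: emeasurable_funD; last exact: measurable_cst.
apply: measurable_kern_dist; apply: (measurableT_comp measurable_clamp).
  exact: measurable_fst.
exact: measurable_snd.
Qed.

(** The energy of the retraction of [nu], shifted by [M]. *)
Definition clamp_energy (nu : probability R R) := \int[nu]_x \int[nu]_y clamp_kern x y.

Lemma measurable_clamp_potential (nu : probability R R) :
  measurable_fun setT (fun x => \int[nu]_y clamp_kern x y).
Proof.
pose k (p : R * R) := clamp_kern p.1 p.2.
rewrite (_ : (fun x => _) = fubini_F nu k) //.
apply: measurable_fun_fubini_tonelli_F; first exact: measurable_clamp_kern.
by move=> p; exact: clamp_kern_ge0.
Qed.

Lemma measurable_clamp_kern_r x : measurable_fun setT (clamp_kern x).
Proof.
exact: (measurable_fun_pair2 (f := fun p : R * R => clamp_kern p.1 p.2)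
  x measurable_clamp_kern).
Qed.

Lemma clamp_energy_base : exists nu : probability R R, clamp_energy nu <= (4 + M)%:E.
Proof.
pose nu : probability (measurableTypeR R) R := uniform_prob (@ltr01 R).
(* [energy_transfer] with one branch, the identity, turns a probability on
   [measurableTypeR R] into one on [R] *)
suff unif : \int[nu]_x \int[nu]_y clamp_kern x y <= (4 + M)%:E.
  have kk : forall (i : nat) (x y : R), (i < 1)%N ->
      \sum_(j < 1) clamp_kern x y = clamp_kern x y + 0%:E.
    by move=> i x y _; rewrite big_ord1 adde0.
  have [om [_ h]] := @energy_transfer _ _ (measurableTypeR R) R R nu (fun _ x => x)
    (fun _ => @measurable_id _ _ _) 1 isT setT measurableT
    (fun _ _ _ => I) clamp_kern clamp_kern 0%R (lexx _) clamp_kern_ge0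
    measurable_clamp_kern (fun x y _ _ => clamp_kern_ge0 x y)
    (fun x _ => measurable_clamp_kern_r x) (fun om _ => measurable_clamp_potential om) kk.
  by exists om; rewrite /clamp_energy h invr1 mul1e adde0; exact: unif.
have m01 : measurable (`[0%R, 1%R]%classic : set R) by exact: measurable_itv.
have leb01 : @lebesgue_measure R `[0%R, 1%R]%classic = 1.
  by rewrite lebesgue_measure_itv /= lte_fin ltr01 oppr0 adde0.
have intc (r : R) : \int[@lebesgue_measure R]_(y in `[0%R, 1%R]) r%:E = r%:E.
  by rewrite integral_cst // -[RHS]mule1; congr (_ * _); exact: leb01.
have in01 x : `[0%R, 1%R]%classic x -> clamp x = x.
  rewrite /= in_itv /= => /andP[x0 x1]; apply: clamp_id.
  by rewrite ger0_norm //; have := c1; lra.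
have inner x : `[0%R, 1%R]%classic x ->
    \int[nu]_y clamp_kern x y <= (4 + M)%:E.
  move=> x01; rewrite integral_uniform; first last.
  - by move=> y; exact: clamp_kern_ge0.
  - exact: measurable_clamp_kern_r.
  rewrite subr0 invr1 mul1e.
  have -> : \int[lebesgue_measure]_(y in `[0%R, 1%R]) clamp_kern x y =
      \int[lebesgue_measure]_(y in `[0%R, 1%R]) (kern `|x - y|%R + M%:E).
    by apply: eq_integral => y /[!inE] y01; rewrite /clamp_kern !in01.
  rewrite ge0_integralD //.
  - rewrite intc EFinD leeD2r //.
    by apply: unif_potential; move: x01; rewrite /= in_itv.
  - move=> y; move: x01; rewrite /= !in_itv /= => /andP[x0 x1] /andP[y0 y1].
    have := @kern_ge R 1 `|x - y|%R ltr01.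
    by rewrite ln1 oppr0; apply; rewrite normr_ge0 /= ler_distl; apply/andP; split; lra.
  - apply: measurable_funTS; apply: measurable_kern_dist => //; exact: measurable_cst.
have mpot : measurable_fun setT (fun x : measurableTypeR R => \int[nu]_y clamp_kern x y).
  pose k (p : measurableTypeR R * measurableTypeR R) := clamp_kern p.1 p.2.
  rewrite (_ : (fun x => _) = fubini_F nu k) //.
  apply: measurable_fun_fubini_tonelli_F; first exact: measurable_clamp_kern.
  by move=> p; exact: clamp_kern_ge0.
rewrite integral_uniform; first last.
- by move=> x; apply: integral_ge0 => y _; exact: clamp_kern_ge0.
- exact: mpot.
rewrite subr0 invr1 mul1e.
apply: (@le_trans _ _ (\int[lebesgue_measure]_(x in `[0%R, 1%R]) (4 + M)%:E)).
  apply: ge0_le_integral => //.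
  - by move=> x _; apply: integral_ge0 => y _; exact: clamp_kern_ge0.
  - apply: measurable_funTS; exact: mpot.
by rewrite intc.
Qed.

(** Pulling back along [x^2/c - 2 c], which maps the interval [|x| <= 2 c] two to one
    onto itself. *)
Lemma clamp_energy_step (nu : probability R R) : exists om : probability R R,
  clamp_energy om = (2%:R^-1)%:E * (clamp_energy nu + (M - ln c)%:E).
Proof.
pose s (x : R) := Num.sqrt (c * (clamp x + 2 * c)).
pose f (n : nat) (x : R) : R := if n == 0%N then s x else (- s x)%R.
have ms : measurable_fun setT s.
  apply: (measurableT_comp (continuous_measurable_fun (@sqrt_continuous R))).
  apply: measurable_funM; first exact: measurable_cst.
  by apply: measurable_funD; [exact: measurable_clamp|exact: measurable_cst].
have mf n : measurable_fun setT (f n).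
  by rewrite /f; case: (n == 0%N) => //; exact: measurableT_comp.
have cl_ge x : (0 <= clamp x + 2 * c <= 4 * c)%R.
  by have := clamp_bound x; rewrite ler_norml => /andP[]; lra.
have s2 x : (s x ^+ 2 = c * (clamp x + 2 * c))%R.
  by rewrite sqr_sqrtr // mulr_ge0 ?(ltW c0) //; case/andP: (cl_ge x).
have s0 x : (0 <= s x)%R by exact: sqrtr_ge0.
have sb x : (s x <= 2 * c)%R.
  rewrite -(@ler_pXn2r _ 2) ?nnegrE ?s0 ?mulr_ge0 ?(ltW c0) // s2.
  by case/andP: (cl_ge x) => h1 h2; have := c0; nra.
have fb n x : (`|f n x| <= 2 * c)%R.
  by rewrite /f; case: ifP => _; rewrite ?normrN ger0_norm.
have Mlnc : (0 <= M - ln c)%R.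
  rewrite subr_ge0; apply: le_trans Mc; rewrite ler_ln ?posrE //; have := c0; lra.
have kk : forall (i : nat) (x y : R), (i < 2)%N ->
    \sum_(j < 2) clamp_kern (f i x) (f j y) = clamp_kern x y + (M - ln c)%:E.
  move=> i x y _; rewrite big_ord_recl big_ord1 /clamp_kern !(@clamp_id (f _ _)) //=.
  rewrite addeACA -kernM ?normr_ge0 // -normrM.
  have -> : `|(f i x - f 0%N y) * (f i x - f (bump 0 0) y)|%R = (c * `|clamp x - clamp y|)%R.
    have -> : ((f i x - f 0%N y) * (f i x - f (bump 0 0) y) = f i x ^+ 2 - s y ^+ 2)%R.
      by rewrite /f /=; ring.
    have -> : (f i x ^+ 2 = s x ^+ 2)%R by rewrite /f; case: ifP => _; rewrite ?sqrrN.
    rewrite !s2 (_ : _ - _ = c * (clamp x - clamp y))%R; last by ring.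
    by rewrite normrM gtr0_norm.
  rewrite -[X in kern (X * _)]invrK kern_scale ?invr_gt0 // lnV ?posrE //.
  rewrite -!addeA; congr (_ + _); rewrite -!EFinD; congr (_%:E); ring.
have [om [_ h]] := @energy_transfer _ _ R R R nu f mf 2 isT setT measurableT
  (fun _ _ _ => I) clamp_kern clamp_kern (M - ln c)%R Mlnc clamp_kern_ge0
  measurable_clamp_kern (fun x y _ _ => clamp_kern_ge0 x y)
  (fun x _ => measurable_clamp_kern_r x) (fun om _ => measurable_clamp_potential om) kk.
by exists om; rewrite /clamp_energy h.
Qed.

(** The shifted energies tend to [M - ln c]. *)
Lemma clamp_energy_iter n : exists nu : probability R R,
  clamp_energy nu <= (M - ln c + (4 + ln c) / 2 ^+ n)%:E.
Proof.
elim: n => [|n [nu hnu]].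
  have [nu hnu] := clamp_energy_base; exists nu.
  by rewrite expr0 divr1 (_ : (M - ln c + (4 + ln c) = 4 + M)%R) //; ring.
have [om eom] := clamp_energy_step nu; exists om; rewrite eom.
apply: (@le_trans _ _ ((2%:R^-1)%:E * ((M - ln c + (4 + ln c) / 2 ^+ n)%:E + (M - ln c)%:E))).
  by apply: lee_wpmul2l; [rewrite lee_fin|exact: leeD2r].
rewrite -EFinD -EFinM lee_fin exprS invfM.
by rewrite le_eqVlt; apply/orP; left; apply/eqP; field; rewrite expf_neq0.
Qed.
End Interval.

(** * Capacity of a polynomial preimage of an interval *)

Section Preimage.
Variable R : realType.
Local Notation C := (R[i]).
Local Notation normc := Normc.normc.
Local Notation toC := (real_complex R).
Variables (D : {poly R}) (q : nat) (c : R).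
Hypothesis mD : D \is monic.
Hypothesis sD : size D = q.+1.
Hypothesis q0 : (0 < q)%N.
Hypothesis c1 : 1 <= c.
Let DC : {poly C} := map_poly toC D.
Hypothesis real_roots : forall (x : R) z, `|x| <= 2 * c -> DC.[z] = x%:C%C -> complex.Im z = 0.
Let E : set (borelC R) := [set z | exists2 x : R, `|x| <= 2 * c & DC.[z] = x%:C%C].

Let mDC : DC \is monic. Proof. by rewrite /DC map_monic. Qed.
Let sDC : size DC = q.+1. Proof. by rewrite /DC size_map_poly. Qed.

Lemma level_set_split (x : R) : `|x| <= 2 * c ->
  exists2 s : seq R, size s = q & D - x%:P = \prod_(r <- s) ('X - r%:P).
Proof.
move=> hx.
have ltx : (size (- x%:P) < size D)%N.
  by rewrite sD size_polyN; apply: leq_ltn_trans (size_polyC_leq1 _) _.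
have mDx : D - x%:P \is monic by rewrite monicE lead_coefDl // -monicE.
have sDx : size (D - x%:P) = q.+1 by rewrite size_polyDl.
have [s es] := closed_field_poly_normal (map_poly toC (D - x%:P)).
have lc : lead_coef (map_poly toC (D - x%:P)) = 1.
  by rewrite lead_coef_map (monicP mDx).
rewrite lc scale1r in es.
exists [seq complex.Re z | z <- s].
  rewrite size_map; have := congr1 (fun p : {poly C} => size p) es.
  by rewrite size_map_poly sDx size_prod_XsubC => -[].
apply: (map_poly_inj toC); rewrite es rmorph_prod /= big_map.
rewrite !big_seq; apply: eq_bigr => z zs.
rewrite rmorphB /= map_polyX map_polyC /=; congr ('X - _%:P).
have rz : root (map_poly toC (D - x%:P)) z by rewrite es root_prod_XsubC.
have : DC.[z] = x%:C%C.
  move: rz; rewrite /root rmorphB /= hornerD hornerN map_polyC hornerC subr_eq0.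
  by move/eqP.
by move/(real_roots hx); case: (z) => a b /= ->.
Qed.

Lemma preimage_real_image : E = toC @` [set x : R | `|D.[x]| <= 2 * c].
Proof.
apply/seteqP; split=> z /=.
  move=> [x hx ex]; have z0 := real_roots hx ex.
  have ez : z = (complex.Re z)%:C%C by move: z0; case: (z) => a b /= ->.
  exists (complex.Re z) => //; move: ex.
  by rewrite ez /DC horner_map /= => -[->].
move=> [x hx <-]; exists D.[x] => //.
by rewrite /DC horner_map.
Qed.

Lemma preimage_compact : compact (E : set (C^o)).
Proof.
rewrite preimage_real_image; apply: continuous_compact.
  by apply: continuous_subspaceT; exact: continuous_real_complex.
have [B B1 hB] := monic_sublevel_bounded (2 * c) mDC sDC q0.
apply: (@subclosed_compact _ _ `[(- B), B]%classic).
- rewrite (_ : [set x | _] = (fun x => `|D.[x]|) @^-1` [set y | y <= 2 * c]) //.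
  apply: closed_comp; last exact: closed_le.
  move=> x _; apply: continuous_comp; first exact: continuous_horner.
  exact: norm_continuous.
- exact: segment_compact.
- move=> x /= hx; rewrite in_itv /= -ler_norml -normc_real; apply: hB.
  by rewrite /DC horner_map normc_real.
Qed.

Lemma preimage_measurable : measurable E.
Proof.
apply: closed_measurableC; apply: compact_closed preimage_compact; exact: norm_hausdorff.
Qed.

(** Measures on the preimage with energies tending to [- (ln c) / q]. *)
Lemma preimage_energy_approx n : exists om : probability (borelC R) R, om (~` E) = 0%E /\
  (log_energy om <= ((- ln c + (4 + ln c) / 2 ^+ n) / q%:R)%:E)%E.
Proof.
have [B B1 hB] := monic_sublevel_bounded (2 * c) mDC sDC q0.
have c0 : 0 < c by exact: lt_le_trans c1.
have B0 : 0 < B by exact: lt_le_trans B1.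
have BcB : 4 * c <= 4 * c * B by rewrite ler_peMr // mulr_ge0 // ltW.
have B2 : 2 * B <= 4 * c * B by rewrite ler_pM2r //; have := c1; lra.
pose M := ln (4 * c * B).
have Mc : ln (4 * c) <= M by rewrite /M ler_ln ?posrE ?mulr_gt0.
have M0 : 0 <= M by apply: ln_ge0; apply: le_trans BcB; have := c1; lra.
have [nu hnu] := clamp_energy_iter c1 Mc n.
have EB z : E z -> normc z <= B.
  by move=> [x hx ez]; apply: hB; rewrite ez normc_real.
have kM z w : E z -> E w -> (0 <= log_kernel z w + M%:E)%E.
  move=> Ez Ew.
  have : ((- M)%:E <= log_kernel z w)%E.
    apply: kern_ge; first by rewrite !mulr_gt0.
    rewrite normc_ge0 /=; apply: le_trans (le_normcD _ _) _; rewrite normcN.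
    by have := EB _ Ez; have := EB _ Ew; move: B2; lra.
  by rewrite -leeBlDr // sub0e -EFinN.
(* the branches of the inverse of [D] are the roots of [g x] *)
pose g (x : R) := D - (clamp c x)%:P.
have mg i : measurable_fun setT (fun x : R => (g x)`_i).
  rewrite /g; under eq_fun do rewrite coefB coefC.
  apply: measurable_funB; first exact: measurable_cst.
  by case: (i == 0%N); [exact: measurable_clamp|exact: measurable_cst].
have sg x : exists2 s : seq R, size s = q & g x = \prod_(r <- s) ('X - r%:P).
  exact: level_set_split (clamp_bound c1 x).
have [zeta [mz hz]] := measurable_roots mg sg.
pose f (n : nat) (x : R) : borelC R :=
  if insub n is Some j then (zeta j x)%:C%C else 0.
have mf k : measurable_fun setT (f k).
  rewrite /f; case: insub => [j|]; last exact: measurable_cst.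
  by apply: (measurableT_comp (@measurable_real_complex R)); exact: mz.
have Dz i x : D.[zeta i x] = clamp c x.
  have : (g x).[zeta i x] = 0.
    by rewrite hz (bigD1 i) //= hornerM hornerXsubC subrr mul0r.
  by rewrite /g hornerD hornerN hornerC => /eqP; rewrite subr_eq0 => /eqP.
have fE j x : (j < q)%N -> E (f j x).
  move=> jq; rewrite /f insubT; exists (clamp c x); first exact: clamp_bound.
  by rewrite /DC horner_map /= Dz.
have mk z : measurable_fun E (fun w : borelC R => log_kernel z w + M%:E)%E.
  apply: emeasurable_funD; last exact: measurable_cst.
  apply: measurable_funTS; exact: measurable_log_kernel_r.
have mU (om : probability (borelC R) R) : om (~` E) = 0%E ->
    measurable_fun E (fun z : borelC R => \int[om]_(w in E) (log_kernel z w + M%:E))%E.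
  move=> om0.
  apply: (@eq_measurable_fun _ _ _ _ _ (fun z : borelC R => \int[om]_w log_kernel z w + M%:E)%E).
    move=> z /[!inE] Ez; apply: integral_shift => //.
    - exact: preimage_measurable.
    - exact: measurable_log_kernel_r.
    - by move=> w; exact: kM.
  apply: emeasurable_funD; last exact: measurable_cst.
  by apply: measurable_funTS; exact: measurable_potential.
pose a : R := (q%:R - 1) * M.
have a0 : 0 <= a by rewrite mulr_ge0 // subr_ge0 ler1n.
have kk : forall (i : nat) (x y : R), (i < q)%N ->
    (\sum_(j < q) (log_kernel (f i x) (f j y) + M%:E) = clamp_kern c M x y + a%:E)%E.
  move=> i x y iq.
  rewrite big_split /= sumEFin sumr_const card_ord.
  have -> : (\sum_(j < q) log_kernel (f i x) (f j y) = kern `|clamp c x - clamp c y|%R)%E.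
    have -> : `|clamp c x - clamp c y| = \prod_(j < q) normc (f i x - f j y).
      rewrite /f insubT -(Dz (Sub i iq) x).
      have -> : D.[zeta (Sub i iq) x] - clamp c y = (g y).[zeta (Sub i iq) x].
        by rewrite /g hornerD hornerN hornerC.
      rewrite hz horner_prod normr_prod; apply: eq_bigr => j _.
      by rewrite hornerXsubC valK -rmorphB normc_real.
    suff : forall r : seq 'I_q, (\sum_(j <- r) log_kernel (f i x) (f j y) =
        kern (\prod_(j <- r) normc (f i x - f j y)%R)%R)%E by apply.
    elim=> [|j r IH]; first by rewrite !big_nil kern1.
    rewrite !big_cons IH kernM ?normc_ge0 // prodr_ge0 // => k _; exact: normc_ge0.
  rewrite /clamp_kern -addeA -EFinD; congr (_ + _%:E)%E.
  by rewrite /a -[M *+ q]mulr_natl; ring.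
have [om [om0 omJ]] := @energy_transfer _ _ R (borelC R) R nu f mf q q0 E preimage_measurable
  fE (clamp_kern c M) (fun z w => log_kernel z w + M%:E)%E a a0 (clamp_kern_ge0 c1 Mc)
  (measurable_clamp_kern c M) kM (fun z _ => mk z) mU kk.
exists om; split=> //.
have := log_energy_shift preimage_measurable om0 M0 kM; rewrite omJ => eI.
rewrite -(@leeD2rE _ M%:E) // eI.
apply: (@le_trans _ _ ((q%:R^-1)%:E * ((M - ln c + (4 + ln c) / 2 ^+ n)%:E + a%:E))%E).
  by apply: lee_wpmul2l; [rewrite lee_fin invr_ge0|exact: leeD2r].
rewrite -EFinD -EFinM -EFinD lee_fin /a le_eqVlt; apply/orP; left; apply/eqP.
by field; rewrite pnatr_eq0 -lt0n q0 expf_neq0.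
Qed.
End Preimage.

Section CapPreimage.
Variable R : realType.
Local Notation C := (R[i]).

Lemma closed_measure_support (mu : probability (borelC R) R) : closed (measure_support mu).
Proof.
suff o : open (~` measure_support mu) by have := open_closedC o; rewrite setCK.
apply/openCP => z /=.
rewrite /measure_support /= => /existsNP[U /not_implyP[oU /not_implyP[Uz nU]]].
have [r r0 hr] := (openCP U).1 oU z Uz.
by exists r => // w /hr Uw /(_ U oU Uw); exact: nU.
Qed.

(** The capacity of the preimage of the interval [|x| <= 2 c], of capacity [c], by a
    monic polynomial of degree [q]. *)
Lemma Cap_preimage (D : {poly R}) (q : nat) (c : R) :
  D \is monic -> size D = q.+1 -> (0 < q)%N -> 1 <= c ->
  (forall (x : R) z, `|x| <= 2 * c ->
     (map_poly (real_complex R) D).[z] = x%:C%C -> complex.Im z = 0) ->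
  Cap [set z | exists2 x : R, `|x| <= 2 * c & (map_poly (real_complex R) D).[z] = x%:C%C] =
  (c `^ (q%:R^-1))%:E.
Proof.
move=> mD sD q0 c1 rr.
set E := [set z | _].
have mE : measurable (E : set (borelC R)) := preimage_measurable mD sD q0 rr.
have cE : compact (E : set (C^o)) := preimage_compact mD sD q0 rr.
have c0 : 0 < c by exact: lt_le_trans c1.
have ec : c `^ (q%:R^-1) = expR (ln c / q%:R).
  by rewrite /powR gt_eqF // mulrC.
have mD' : map_poly (real_complex R) D \is monic by rewrite map_monic.
have sD' : size (map_poly (real_complex R) D) = q.+1 by rewrite size_map_poly.
apply/eqP; rewrite eq_le; apply/andP; split.
  apply: ge_ereal_sup => _ [mu /= [cs sE] <-].
  have muE : mu (~` E : set (borelC R)) = 0%E.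
    apply: measure_negligible; first exact: measurableC.
    by apply: negligibleS (measure_support_negligible mu); exact: subsetC.
  have := log_energy_lower mD' sD' q0 c1 mE muE.
  rewrite ec -[(expR _)%:E]/(expeR (ln c / q%:R)%:E) lee_expeR leeNl.
  by rewrite EFinN.
set K := 4 + ln c.
have lowb n : ((expR ((ln c - K / 2 ^+ n) / q%:R))%:E <= Cap E)%E.
  have [om [om0 omI]] := preimage_energy_approx mD sD q0 c1 rr n.
  apply: (@le_trans _ _ (expeR (- log_energy om))%E).
    rewrite -[(expR _)%:E]/(expeR (((ln c - K / 2 ^+ n) / q%:R)%:E)) lee_expeR.
    rewrite leeNr -EFinN; apply: le_trans omI _; rewrite lee_fin -mulNr.
    by rewrite opprB addrC.
  have sub : measure_support om `<=` E.
    move=> z hz; apply: contrapT => nz.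
    have oE : open (~` E : set (C^o)).
      by apply: closed_openC; apply: compact_closed cE; exact: norm_hausdorff.
    by have := hz _ oE nz; rewrite om0 ltxx.
  apply: ereal_sup_ubound; exists om => //; split; last exact: sub.
  by apply: (@subclosed_compact _ _ (E : set (C^o))) => //; exact: closed_measure_support.
rewrite ec.
have cv : (fun n => expR ((ln c - K / 2 ^+ n) / q%:R)) @ \oo --> expR (ln c / q%:R).
  apply: continuous_cvg; first exact: continuous_expR.
  have -> : ln c / q%:R = (ln c - K * 0) / q%:R by rewrite mulr0 subr0.
  apply: cvgMl; apply: cvgB; first exact: cvg_cst.
  apply: cvgMr.
  under eq_fun do rewrite -exprVn.
  by apply: cvg_expr; rewrite ger0_norm ?invf_lt1 // ltr1n.
have : Cap E != -oo%E by apply: contraTneq (lowb 0%N) => ->; rewrite leNgt ltNyr.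
case eC : (Cap E) => [r| |] // _; last by rewrite leey.
rewrite lee_fin -(cvg_lim _ cv) //; apply: limr_le.
  by apply/cvg_ex; eexists; exact: cv.
by near=> n; have := lowb n; rewrite eC lee_fin.
Unshelve. all: by end_near. Qed.

Lemma Cap_S_plus (lam : R) (p : int) (q : nat) : (0 < q)%N -> coprimez p q%:Z ->
  Cap (S_plus (almost_mathieu_potential lam) (p%:~R / q%:R)) =
  ((1 + `|lam| ^+ q) `^ (q%:R^-1))%:E.
Proof.
move=> q0 cop; have [D [mD sD rr ->]] := S_plus_preimage lam q0 cop.
by apply: Cap_preimage => //; rewrite lerDl exprn_ge0.
Qed.
End CapPreimage.

(** * Limit of the capacities *)

Section Limit.
Variable R : realType.

Lemma powR_root (x : R) (m : nat) : 0 <= x -> (0 < m)%N -> (x ^+ m) `^ (m%:R^-1) = x.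
Proof.
by move=> x0 m0; rewrite -powR_mulrn // -powRrM mulfV ?powRr1 // pnatr_eq0 -lt0n.
Qed.

(** The limit of [(1 + t^m)^(1/m)], that is, the maximum of [1] and [t]. *)
Definition lim_cap (t : R) : R := if t < 1 then 1 else t.

Lemma lim_cap_pow (t : R) (m : nat) : 0 < t ->
  lim_cap t ^+ m < 1 + t ^+ m <= 2 * lim_cap t ^+ m.
Proof.
move=> t0; have tm : 0 < t ^+ m by rewrite exprn_gt0.
rewrite /lim_cap; case: (ltP t 1) => t1.
  rewrite expr1n ltrDl tm mulr1 /=; have : t ^+ m <= 1 by rewrite exprn_ile1 // ltW.
  lra.
rewrite ltrDr ltr01 /=; have : 1 <= t ^+ m by exact: exprn_ege1.
lra.
Qed.

Lemma lim_cap_ge0 (t : R) : 0 < t -> 0 <= lim_cap t.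
Proof. by rewrite /lim_cap; case: (ltP t 1) => // _ /ltW. Qed.

Lemma lim_cap_lt (t : R) (m : nat) : 0 < t -> (0 < m)%N ->
  lim_cap t < (1 + t ^+ m) `^ (m%:R^-1).
Proof.
move=> t0 m0; have /andP[h _] := lim_cap_pow m t0.
rewrite -[X in X < _](@powR_root _ m) ?lim_cap_ge0 //.
apply: gt0_ltr_powR => //; rewrite ?invr_gt0 ?ltr0n // nnegrE.
  by rewrite exprn_ge0 // lim_cap_ge0.
by rewrite addr_ge0 // exprn_ge0 // ltW.
Qed.

Lemma cap_le_lim (t y : R) (m : nat) : 0 < t -> (0 < m)%N -> m%:R^-1 <= y ->
  (1 + t ^+ m) `^ (m%:R^-1) <= lim_cap t * expR (y * ln 2).
Proof.
move=> t0 m0 hy; have /andP[_ h] := lim_cap_pow m t0.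
have L0 := lim_cap_ge0 t0.
apply: (@le_trans _ _ ((2 * lim_cap t ^+ m) `^ (m%:R^-1))).
  apply: ge0_ler_powR => //; rewrite ?invr_ge0 //.
    by rewrite nnegrE addr_ge0 // exprn_ge0 // ltW.
  by rewrite nnegrE mulr_ge0 // exprn_ge0.
rewrite powRM ?exprn_ge0 // powR_root // mulrC ler_wpM2l //.
rewrite /powR gt_eqF // ler_expR ler_wpM2r // ln_ge0 //; lra.
Qed.

(** A number which is not an integer, but has denominator [m] up to an integer, is at
    distance at least [1/m] from the integers. *)
Lemma circle_norm_ge (x : R) (a : int) (m : nat) (k : int) : (0 < m)%N ->
  x = - (a%:~R / m%:R) - k%:~R -> (forall j : int, x <> j%:~R) ->
  m%:R^-1 <= circle_norm x.
Proof.
move=> m0 ex nx; have mR : 0 < m%:R :> R by rewrite ltr0n.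
apply: lb_le_inf; first by exists `|x - 0%:~R|, 0.
move=> _ [j _ <-].
have -> : x - j%:~R = - ((a + (k + j) * m%:Z)%:~R / m%:R).
  by rewrite ex rmorphD rmorphM /= rmorphD /=; field; rewrite gt_eqF.
rewrite normrN normrM normfV (gtr0_norm mR) -[leLHS]mul1r ler_pM2r ?invr_gt0 //.
rewrite -intr_norm -[1]/(1%:~R) ler_int.
have : a + (k + j) * m%:Z != 0; last by lia.
apply/negP => /eqP e; apply: (nx j); apply/eqP; rewrite -subr_eq0.
have -> : x - j%:~R = - ((a + (k + j) * m%:Z)%:~R / m%:R).
  by rewrite ex rmorphD rmorphM /= rmorphD /=; field; rewrite gt_eqF.
by rewrite e mul0r oppr0.
Qed.

Lemma reduced_fraction (x : rat) : exists (a : int) (m : nat),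
  [/\ (0 < m)%N, coprimez a m%:Z & ratr x = a%:~R / m%:R :> R].
Proof.
exists (numq x), (absz (denq x)); split.
- by rewrite absz_gt0 denq_neq0.
- by rewrite /coprimez /gcdz absz_nat; have := coprime_num_den x; rewrite /coprime => /eqP ->.
- by rewrite /ratr; congr (_ / _); rewrite -[in LHS](gtz0_abs (denq_gt0 x)).
Qed.
End Limit.

Theorem mainTheorem7 (R : realType) (lambda : R) (hlambda : lambda != 0)
    (p : int) (q : nat) (hq : (0 < q)%N) (hpq : coprimez p q%:Z) :
  let v := almost_mathieu_potential lambda in
  let alpha : R := p%:~R / q%:R in
  Cap (S_plus v alpha) = ((1 + `|lambda| ^+ q) `^ (q%:R^-1))%:E /\
  forall (pn : nat -> int) (qn : nat -> nat),
    (forall n, (0 < qn n)%N) ->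
    (fun n => circle_norm ((pn n)%:~R / (qn n)%:R - alpha)) @ \oo --> (0 : R) ->
    (forall n, exists (pt : int) (qt : nat),
       [/\ (0 < qt)%N, coprimez pt qt%:Z &
           circle_eq (alpha - (pn n)%:~R / (qn n)%:R) (pt%:~R / qt%:R)]) /\
    forall (pt : nat -> int) (qt : nat -> nat),
      (forall n, [/\ (0 < qt n)%N, coprimez (pt n) (qt n)%:Z &
         circle_eq (alpha - (pn n)%:~R / (qn n)%:R)
                   ((pt n)%:~R / (qt n)%:R)]) ->
      (forall n, Cap (S_plus v ((pt n)%:~R / (qt n)%:R)) =
         ((1 + `|lambda| ^+ qt n) `^ ((qt n)%:R^-1))%:E) /\
      ((\forall n \near \oo, ~ circle_eq ((pn n)%:~R / (qn n)%:R) alpha) ->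
       let L : R := if `|lambda| < 1 then 1 else `|lambda| in
       [/\ (fun n => Cap (S_plus v ((pt n)%:~R / (qt n)%:R))) @ \oo --> L%:E,
           L != (1 + `|lambda| ^+ q) `^ (q%:R^-1) &
           ((1 + `|lambda| ^+ q) `^ (q%:R^-1))%:E = Cap (S_plus v alpha)]).
Proof.
move=> v alpha; have lam0 : 0 < `|lambda| by rewrite normr_gt0.
split; first exact: Cap_S_plus.
move=> pn qn qn0 cvg0; split=> [n|pt qt hpt].
  have [a [m [m0 am ex]]] := reduced_fraction R (p%:Q / q%:R - (pn n)%:Q / (qn n)%:R).
  exists a, m; split=> //; exists 0.
  by rewrite -ex rmorphB !rmorphM !fmorphV /= !ratr_int !ratr_nat subrr.
have capE n : Cap (S_plus v ((pt n)%:~R / (qt n)%:R)) =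
    ((1 + `|lambda| ^+ qt n) `^ ((qt n)%:R^-1))%:E.
  by have [h1 h2 _] := hpt n; exact: Cap_S_plus.
split=> // hne L; split; last exact/esym/Cap_S_plus.
- rewrite (funext capE); apply: cvg_EFin; first by near=> n.
  (* the n-th capacity lies between [L] and [L * 2 ^ x] for [x] the distance of
     [pn n / qn n] to [alpha], which is at least the inverse of [qt n] *)
  have cv1 : (fun n => L * expR (circle_norm ((pn n)%:~R / (qn n)%:R - alpha) * ln 2)) @ \oo --> L.
    have -> : nbhs L = nbhs (L * expR (0 * ln 2)) by rewrite mul0r expR0 mulr1.
    apply: cvgMl_tmp; apply: continuous_cvg; first exact: continuous_expR.
    by apply: cvgMr_tmp; exact: cvg0.
  apply: (squeeze_cvgr _ (cvg_cst L) cv1); near=> n.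
  have [m0 _ [k ek]] := hpt n.
  rewrite ltW ?lim_cap_lt //=; apply: cap_le_lim => //.
  apply: (@circle_norm_ge _ _ (pt n) (qt n) k) => // [|j ej].
    by rewrite -ek; ring.
  have : ~ circle_eq ((pn n)%:~R / (qn n)%:R) alpha by near: n.
  by apply; exists j.
- by rewrite lt_eqF // lim_cap_lt.
Unshelve. all: by end_near. Qed.
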